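(* Set $\Gamma=\Gamma(1/4)$ and write $p_{n}=p_n(1/2)$ and $p_n^{(k)}=p_n^{(k)}(1/2)$ (the $k$-th derivative of the polynomial $p_n$ evaluated at $1/2$; $p_n'$, $p_n''$ denote $k=1,2$). For every integer $m>0$: $$\sum_{n=0}^{\infty}\frac{(-1)^n(2n+1)^{4m+1}}{\cosh^3((2n+1)\pi/2)}=\frac{\Gamma^{8m+4}}{2^{4m+5}\pi^{6m+4}}\left[\pi p_{4m+1}+(4m+1)p'_{4m-1}\right],$$ $$\sum_{n=0}^{\infty}\frac{(-1)^n(2n+1)^{4m-1}}{\cosh^3((2n+1)\pi/2)}=-\frac{\Gamma^{8m-4}}{2^{4m+7}\pi^{6m+3}}\Big\{128(8m^2-6m+1)\pi^4 p_{4m-3}+\Gamma^8\left[(4m-6)p_{4m-3}+p''_{4m-3}\right]\Big\},$$ $$\sum_{n=0}^{\infty}\frac{(-1)^n(2n+1)^{4m}\sinh((2n+1)\pi/2)}{\cosh^4((2n+1)\pi/2)}=\frac{\Gamma^{8m-4}}{3\cdot2^{4m+6}\pi^{6m}}\Big\{-256m(8m^2-6m+1)p_{4m-3}-\frac{\Gamma^8}{\pi^4}\left[\pi p'_{4m-1}+6m\left((4m-6)p_{4m-3}+p''_{4m-3}\right)\right]\Big\},$$ $$\sum_{n=0}^{\infty}\frac{(-1)^n(2n+1)^{4m+1}}{\cosh^5((2n+1)\pi/2)}=\frac{\Gamma^{8m-4}}{3\cdot2^{4m+15}\pi^{6m+9}}\Big\{32768\,m(2m-1)(4m-1)(4m+1)\pi^8p_{4m-3}$$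 $$\qquad+256\pi^4\Gamma^8\Big[9\pi^2 p_{4m+1}+10(4m+1)\pi p'_{4m-1}+6m(4m+1)\left((4m-6)p_{4m-3}+p''_{4m-3}\right)\Big]$$ $$\qquad+\Gamma^{16}\Big[8(m-2)(6m-7)p_{4m-3}+12(2m-5)p''_{4m-3}+p^{(4)}_{4m-3}\Big]\Big\}.$$
   Context: $\Gamma(1/4)$ is the value of the Euler Gamma function. For a modulus $k$ with $0<k<1$, the Jacobi elliptic functions are defined by inverting $u=\int_0^{\varphi}\frac{dt}{\sqrt{1-k^2\sin^2t}}$: $\mathrm{sn}(u,k)=\sin\varphi$, $\mathrm{dn}(u,k)=\sqrt{1-k^2\mathrm{sn}^2(u,k)}$ (positive near $u=0$), and $\mathrm{sd}(u,k)=\mathrm{sn}(u,k)/\mathrm{dn}(u,k)$. With $x=k^2$, the Maclaurin expansion of $\mathrm{sd}$ in $u$ has the form $$\mathrm{sd}(u,k)=\sum_{m\ge0}\frac{p_{2m+1}(x)}{(2m+1)!}u^{2m+1},$$ where each $p_{2m+1}(x)\in\mathbb{Z}[x]$; this defines the polynomials $p_{2m+1}$ (for instance $p_1(x)=1$, $p_3(x)=2x-1$, $p_5(x)=16x^2-16x+1$). *)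

(* Defs.v *)
From Stdlib Require Import Reals Factorial ClassicalEpsilon.
From Coquelicot Require Import Coquelicot.
From mathcomp Require Import ssreflect ssrfun ssralg ssrint poly Rstruct.
Open Scope R_scope.

Definition Gamma (s : R) : R :=
  RInt_gen (fun t => Rpower t (s - 1) * exp (- t))
    (at_right 0) (Rbar_locally p_infty).

Definition ellF (phi k : R) : R :=
  RInt (fun t => / sqrt (1 - k ^ 2 * sin t ^ 2)) 0 phi.

(* For 0 < k < 1, [fun phi => ellF phi k] is an increasing bijection of R,
   so [am u k] is the unique phi with [ellF phi k = u]. *)
Definition am (u k : R) : R :=
  epsilon (inhabits 0) (fun phi => ellF phi k = u).

Definition sn (u k : R) : R := sin (am u k).

Definition dn (u k : R) : R := sqrt (1 - k ^ 2 * sn u k ^ 2).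

Definition sd (u k : R) : R := sn u k / dn u k.

(* The value at the real x of the j-th derivative of an integer polynomial. *)
Definition pder (q : {poly int}) (j : nat) (x : R) : R :=
  (map_poly intr q)^`(j).[x]%R.

(* [p n] is only constrained for odd n; since the expansion is required for
   every modulus, these [p n] are uniquely determined. *)
Definition sd_maclaurin (p : nat -> {poly int}) : Prop :=
  forall k : R, 0 < k < 1 ->
    locally 0 (fun u : R =>
      is_series
        (fun m : nat =>
           pder (p (2 * m + 1)%nat) 0 (k ^ 2) / INR (fact (2 * m + 1))
             * u ^ (2 * m + 1))
        (sd u k)).

(* Main.v *)
Require Import Defs.
From Stdlib Require Import Reals Lra Lia ZArith.
From Coquelicot Require Import Coquelicot.
From mathcomp Require Import ssralg ssrint poly Rstruct.
Open Scope R_scope.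
Delimit Scope Z_scope with Z.
Delimit Scope R_scope with coqR.

(* For h > 0 the Lambert series of dn, sn and cn with nome e^(-2h) satisfy Jacobi's differential
   equations: in a product of two of them the coefficients are sums of products of hyperbolic
   secants and cosecants, which telescope by the addition formulas. The same computation with a
   missing zero frequency yields the derivatives in h of the theta constants cc = theta_2^2,
   zz = theta_3^2 and of the quasi-modular sum ee. Following the amplitude along the real and the
   imaginary period identifies zz pi/2 and zz h with the complete integrals K(k) and K(k'), where
   k = cc / zz. Hence h -> pi^2/(4h) exchanges k and k'; so k^2 = 1/2 at h = pi/2, and
   differentiating zz (pi^2/(4h)) = (2h/pi) zz h there gives the value of ee. The value of zz is
   Gamma(1/4)^2 / (2 pi^(3/2)), by the polar-coordinate evaluation of the square of the integral
   of e^(-x^4).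

   Shifting cn by a quarter period gives the Fourier series of sd, whose derivatives at 0 express
   the sums of (-1)^n (2n+1)^s / cosh((2n+1)h), s odd, by the polynomials p_s at k^2. The four
   series of the theorem are combinations of derivatives in h of these sums at h = pi/2; in
   the result, half of the derivatives of p_s at 1/2 vanish, because p_s(1-x) = +-p_s(x). *)

(** Complex arguments never occur: the values on the imaginary axis are the separate real series
    [Hdn], [Hsn], [Hcn], which obey the same product identities with the weight [exp] in place of
    [cos] and [sin]. They converge only for |t| < h, and the blow-up of [Hsn] at the edge of this
    strip is what identifies the second period. The odd powers of cosh come from the fact that the
    second and fourth derivatives of sech are polynomials in sech. Each derivative in h also brings
    down a factor 2n+1. So the power 4m+1 is reached from p_(4m+1), p_(4m-1), p_(4m-3) after 0, 2, 4
    derivatives, and the power 4m-1 or 4m in the same way; this is why several polynomials meet in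
    one formula. At h = pi/2 the logarithmic derivative of [zz] is -1/pi while [zz^2] is
    Gamma(1/4)^4 / (4 pi^3). These two numbers account for all powers of pi and of Gamma in the
    results. *)

Ltac eqR := match goal with |- ?a = ?b => change (@eq R a b) end.
Ltac unscal := unfold scal; simpl; unfold mult; simpl.

Notation zabs j := (IZR (Z.abs j)).

(** * Calculus lemmas specialised to real functions *)

Lemma exp_ge0 (x : R) : 0 <= exp x.
Proof. apply Rlt_le, exp_pos. Qed.

Lemma ex_derive_cont (f : R -> R) (x : R) : ex_derive f x -> continuous f x.
Proof. apply (ex_derive_continuous (V := R_NormedModule)). Qed.

Lemma is_derive_cont (f : R -> R) (x l : R) : is_derive f x l -> continuous f x.
Proof. intros H. apply ex_derive_cont. exists l; exact H. Qed.

Lemma is_derive_eq (f : R -> R) (x l l' : R) : is_derive f x l -> l = l' -> is_derive f x l'.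
Proof. intros H <-. exact H. Qed.

Lemma is_derive_cst (c x : R) : is_derive (fun _ : R => c) x 0.
Proof. apply (is_derive_const (V := R_NormedModule)). Qed.

Lemma is_derive_add (f g : R -> R) (x f' g' : R) : is_derive f x f' -> is_derive g x g' ->
  is_derive (fun t => f t + g t) x (f' + g').
Proof. apply (is_derive_plus (V := R_NormedModule)). Qed.

Lemma is_derive_prod (f g : R -> R) (x f' g' : R) : is_derive f x f' -> is_derive g x g' ->
  is_derive (fun t => f t * g t) x (f' * g x + f x * g').
Proof. intros Hf Hg. apply (is_derive_mult f g); auto. intros; apply Rmult_comm. Qed.

Lemma is_derive_cmult (f : R -> R) (x k f' : R) : is_derive f x f' ->
  is_derive (fun t => k * f t) x (k * f').
Proof. apply (is_derive_scal f). Qed.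

Lemma is_derive_chain (f g : R -> R) (x f' g' : R) : is_derive f (g x) f' -> is_derive g x g' ->
  is_derive (fun t => f (g t)) x (g' * f').
Proof. apply (is_derive_comp f g). Qed.

Lemma ex_series_bound (a b : nat -> R) : (forall n, Rabs (a n) <= b n) -> ex_series b -> ex_series a.
Proof. apply (ex_series_le (V := R_CompleteNormedModule)). Qed.

Lemma ex_series_add (a b : nat -> R) : ex_series a -> ex_series b -> ex_series (fun n => a n + b n).
Proof. apply (ex_series_plus (V := R_NormedModule)). Qed.

Lemma is_series_zero : is_series (fun _ : nat => 0) 0.
Proof.
  change (is_lim_seq (sum_n (fun _ => 0)) 0). apply is_lim_seq_ext with (fun _ => 0).
  intros n. rewrite sum_n_const. eqR. ring. apply is_lim_seq_const.
Qed.

Lemma Series_nonneg (a : nat -> R) : (forall n, 0 <= a n) -> ex_series a -> 0 <= Series a.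
Proof.
  intros H Ha. rewrite <- (is_series_unique _ _ is_series_zero). apply Series_le; auto.
  intros; split; auto. lra.
Qed.

Lemma RInt_cst (c a b : R) : RInt (fun _ => c) a b = c * (b - a).
Proof. rewrite RInt_const. unscal. ring. Qed.

Lemma sign_sq (n : nat) : (-1) ^ n * (-1) ^ n = 1.
Proof. rewrite <- Rpow_mult_distr. replace (-1 * -1) with 1 by ring. apply pow1. Qed.


(** * Sums over the integers *)

(* The index -1 - n runs through the negative integers. *)
Definition ZS (f : Z -> R) : R :=
  Series (fun n => f (Z.of_nat n) + f (-1 - Z.of_nat n)%Z).

(* [f j = O (e^(-r |j|))]; a negative [r] gives a growth bound. *)
Definition dec (r : R) (f : Z -> R) : Prop :=
  exists K, forall j, Rabs (f j) <= K * exp (- r * zabs j).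

Lemma exp_INR (r : R) (n : nat) : exp (r * INR n) = exp r ^ n.
Proof.
  induction n as [|n IH].
  - simpl. rewrite Rmult_0_r. apply exp_0.
  - rewrite S_INR, Rmult_plus_distr_l, exp_plus, IH, Rmult_1_r. simpl. ring.
Qed.

Lemma exp_neg_lt1 (r : R) : 0 < r -> 0 < exp (- r) < 1.
Proof.
  intros Hr. split. apply exp_pos. rewrite <- exp_0. apply exp_increasing. lra.
Qed.

Lemma ex_series_exp (r K : R) : 0 < r -> ex_series (fun n => K * exp (- r * INR n)).
Proof.
  intros Hr. apply (ex_series_scal (V := R_NormedModule) K).
  apply ex_series_ext with (fun n => exp (- r) ^ n).
  - intros n. symmetry. apply exp_INR.
  - apply ex_series_geom. destruct (exp_neg_lt1 r Hr). rewrite Rabs_pos_eq; lra.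
Qed.

Lemma IZR_abs_nat (n : nat) : zabs (Z.of_nat n) = INR n.
Proof. rewrite Z.abs_eq by lia. symmetry. apply INR_IZR_INZ. Qed.

Lemma IZR_abs_neg (n : nat) : zabs (-1 - Z.of_nat n) = INR n + 1.
Proof.
  replace (Z.abs (-1 - Z.of_nat n)) with (Z.of_nat n + 1)%Z by lia.
  rewrite plus_IZR, <- INR_IZR_INZ. reflexivity.
Qed.

Lemma dec_nonneg (r K : R) (f : Z -> R) :
  (forall j, Rabs (f j) <= K * exp (- r * zabs j)) -> 0 <= K.
Proof.
  intros H. specialize (H 0%Z). simpl in H. rewrite Rmult_0_r, exp_0 in H.
  pose proof (Rabs_pos (f 0%Z)). lra.
Qed.

Lemma dec_ex_pos (r : R) (f : Z -> R) :
  0 < r -> dec r f -> ex_series (fun n => Rabs (f (Z.of_nat n))).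
Proof.
  intros Hr [K HK]. apply ex_series_bound with (2 := ex_series_exp r K Hr).
  intros n. change (Rabs (Rabs (f (Z.of_nat n))) <= K * exp (- r * INR n)).
  rewrite Rabs_Rabsolu, <- IZR_abs_nat. apply HK.
Qed.

Lemma dec_ex_neg (r : R) (f : Z -> R) :
  0 < r -> dec r f -> ex_series (fun n => Rabs (f (-1 - Z.of_nat n)%Z)).
Proof.
  intros Hr [K HK]. apply ex_series_bound with (2 := ex_series_exp r K Hr).
  intros n. change (Rabs (Rabs (f (-1 - Z.of_nat n)%Z)) <= K * exp (- r * INR n)).
  rewrite Rabs_Rabsolu. eapply Rle_trans. apply HK.
  apply Rmult_le_compat_l. apply (dec_nonneg r K f HK).
  apply Rlt_le, exp_increasing. rewrite IZR_abs_neg. nra.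
Qed.

Lemma dec_ex_posR (r : R) (f : Z -> R) :
  0 < r -> dec r f -> ex_series (fun n => f (Z.of_nat n)).
Proof. intros. apply ex_series_Rabs. eapply dec_ex_pos; eauto. Qed.

Lemma dec_ex_negR (r : R) (f : Z -> R) :
  0 < r -> dec r f -> ex_series (fun n => f (-1 - Z.of_nat n)%Z).
Proof. intros. apply ex_series_Rabs. eapply dec_ex_neg; eauto. Qed.

Lemma ZS_split (r : R) (f : Z -> R) : 0 < r -> dec r f ->
  ZS f = Series (fun n => f (Z.of_nat n)) + Series (fun n => f (-1 - Z.of_nat n)%Z).
Proof.
  intros Hr Hf. unfold ZS. apply Series_plus.
  eapply dec_ex_posR; eauto. eapply dec_ex_negR; eauto.
Qed.

Lemma ZS_ext (f g : Z -> R) : (forall j, f j = g j) -> ZS f = ZS g.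
Proof. intros H. apply Series_ext. intros n. rewrite !H. reflexivity. Qed.

Lemma ZS_scal (k : R) (f : Z -> R) : ZS (fun j => k * f j) = k * ZS f.
Proof.
  unfold ZS. rewrite <- Series_scal_l. apply Series_ext. intros n. ring.
Qed.

Lemma ZS_zero : ZS (fun _ => 0) = 0.
Proof.
  rewrite (ZS_ext _ (fun j => 0 * 0)) by (intros; ring). rewrite ZS_scal. ring.
Qed.

Lemma ZS_plus (r : R) (f g : Z -> R) : 0 < r -> dec r f -> dec r g ->
  ZS (fun j => f j + g j) = ZS f + ZS g.
Proof.
  intros Hr Hf Hg. unfold ZS. rewrite <- Series_plus.
  - apply Series_ext. intros n. ring.
  - apply ex_series_add;
      [eapply dec_ex_posR | eapply dec_ex_negR]; eauto.
  - apply ex_series_add;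
      [eapply dec_ex_posR | eapply dec_ex_negR]; eauto.
Qed.

Lemma dec_ext (r : R) (f g : Z -> R) : (forall j, f j = g j) -> dec r f -> dec r g.
Proof. intros H [K HK]. exists K. intros j. rewrite <- H. apply HK. Qed.

Lemma dec_scal (r k : R) (f : Z -> R) : dec r f -> dec r (fun j => k * f j).
Proof.
  intros [K HK]. exists (Rabs k * K). intros j.
  rewrite Rabs_mult, Rmult_assoc. apply Rmult_le_compat_l. apply Rabs_pos. apply HK.
Qed.

Lemma dec_plus (r : R) (f g : Z -> R) : dec r f -> dec r g -> dec r (fun j => f j + g j).
Proof.
  intros [K HK] [L HL]. exists (K + L). intros j.
  eapply Rle_trans. apply Rabs_triang. specialize (HK j). specialize (HL j). lra.
Qed.

Lemma dec_minus (r : R) (f g : Z -> R) : dec r f -> dec r g -> dec r (fun j => f j - g j).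
Proof.
  intros Hf Hg. apply dec_ext with (fun j => f j + -1 * g j). intros; ring.
  apply dec_plus; auto. apply dec_scal; auto.
Qed.

Lemma ZS_minus (r : R) (f g : Z -> R) : 0 < r -> dec r f -> dec r g ->
  ZS (fun j => f j - g j) = ZS f - ZS g.
Proof.
  intros Hr Hf Hg. rewrite (ZS_ext _ (fun j => f j + -1 * g j)) by (intros; ring).
  rewrite (ZS_plus r) by auto using dec_scal. rewrite ZS_scal. ring.
Qed.

Lemma dec_le (r s : R) (f : Z -> R) : s <= r -> dec r f -> dec s f.
Proof.
  intros Hs [K HK]. exists K. intros j. eapply Rle_trans. apply HK.
  apply Rmult_le_compat_l. apply (dec_nonneg r K f HK).
  assert (0 <= zabs j) by (apply IZR_le; lia).
  destruct (Req_dec (- r * zabs j) (- s * zabs j)) as [E|E].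
  rewrite E; lra. apply Rlt_le, exp_increasing. nra.
Qed.

Lemma exp_le (x y : R) : x <= y -> exp x <= exp y.
Proof. intros [H|H]. apply Rlt_le, exp_increasing, H. rewrite H; lra. Qed.

(** Shifts and reflections of the index change |j| by at most a constant [c], which costs only the
    factor e^(r c) in the bound. *)
Lemma dec_comp (r : R) (f : Z -> R) (phi : Z -> Z) (c : Z) : 0 <= r ->
  (forall j, (Z.abs j <= Z.abs (phi j) + c)%Z) -> dec r f -> dec r (fun j => f (phi j)).
Proof.
  intros Hr Hphi [K HK]. exists (K * exp (r * IZR c)). intros j.
  eapply Rle_trans. apply HK. rewrite Rmult_assoc, <- exp_plus.
  apply Rmult_le_compat_l. apply (dec_nonneg r K f HK).
  apply exp_le. specialize (Hphi j). apply IZR_le in Hphi. rewrite plus_IZR in Hphi. nra.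
Qed.

Lemma ZS_shift1 (r : R) (f : Z -> R) : 0 < r -> dec r f ->
  ZS (fun j => f (j + 1)%Z) = ZS f.
Proof.
  intros Hr Hf.
  assert (Hf1 : dec r (fun j => f (j + 1)%Z)).
  { apply (dec_comp r f (fun j => j + 1)%Z 1); auto. lra. intros; lia. }
  rewrite (ZS_split r f), (ZS_split r (fun j => f (j + 1)%Z)) by auto.
  rewrite (Series_incr_1 (fun n => f (Z.of_nat n))) by (eapply dec_ex_posR; eauto).
  rewrite (Series_incr_1 (fun n => f (-1 - Z.of_nat n + 1)%Z))
    by (apply (dec_ex_negR r (fun j => f (j + 1)%Z)); auto).
  rewrite (Series_ext (fun n => f (Z.of_nat n + 1)%Z) (fun n => f (Z.of_nat (S n)))).
  rewrite (Series_ext (fun n => f (-1 - Z.of_nat (S n) + 1)%Z) (fun n => f (-1 - Z.of_nat n)%Z)).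
  simpl. ring.
  intros n; f_equal; lia. intros n; f_equal; lia.
Qed.

Lemma ZS_shift (r : R) (f : Z -> R) (m : Z) : 0 < r -> dec r f ->
  ZS (fun j => f (j + m)%Z) = ZS f.
Proof.
  intros Hr Hf.
  assert (Hn : forall n f, dec r f -> ZS (fun j => f (j + Z.of_nat n)%Z) = ZS f).
  { clear f Hf. induction n as [|n IH]; intros f Hf.
    - apply ZS_ext. intros; f_equal; lia.
    - rewrite <- (IH f Hf). rewrite <- (ZS_shift1 r (fun j => f (j + Z.of_nat n)%Z)); auto.
      apply ZS_ext. intros; f_equal; lia.
      apply (dec_comp r f (fun j => j + Z.of_nat n)%Z (Z.of_nat n)); auto. lra. intros; lia. }
  destruct (Z_le_dec 0 m) as [Hm|Hm].
  - rewrite <- (Hn (Z.to_nat m) f Hf). apply ZS_ext. intros; f_equal; lia.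
  - rewrite <- (Hn (Z.to_nat (- m)) (fun j => f (j + m)%Z)).
    apply ZS_ext. intros; f_equal; lia.
    apply (dec_comp r f (fun j => j + m)%Z (- m)); auto. lra. intros; lia.
Qed.

(** The reflection about -1/2 exchanges the two terms that [ZS] pairs, so the sums agree term by
    term, whether or not they converge. *)
Lemma ZS_reflect (f : Z -> R) : ZS (fun j => f (-1 - j)%Z) = ZS f.
Proof.
  apply Series_ext. intros n. rewrite Rplus_comm. f_equal; f_equal; lia.
Qed.

Lemma ZS_opp (r : R) (f : Z -> R) : 0 < r -> dec r f -> ZS (fun j => f (- j)%Z) = ZS f.
Proof.
  intros Hr Hf. rewrite <- (ZS_reflect f).
  rewrite <- (ZS_shift r (fun j => f (-1 - j)%Z) (-1)); auto.
  apply ZS_ext. intros; f_equal; lia.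
  apply (dec_comp r f (fun j => -1 - j)%Z 1); auto. lra. intros; lia.
Qed.

Lemma ZS_odd (f : Z -> R) (r : R) (s : Z) : 0 < r -> dec r f ->
  (forall j, f (s - j)%Z = - f j) -> ZS f = 0.
Proof.
  intros Hr Hf H.
  assert (E : ZS f = - ZS f); [|lra].
  rewrite <- (ZS_opp r f) at 1; auto.
  assert (Hf' : dec r (fun j => f (- j)%Z)).
  { apply (dec_comp r f (fun j => - j)%Z 0); auto. lra. intros; lia. }
  rewrite <- (ZS_shift r _ (- s) Hr Hf').
  rewrite (ZS_ext _ (fun j => -1 * f j)). rewrite ZS_scal; ring.
  intros j. replace (- (j + - s))%Z with (s - j)%Z by lia. rewrite H. ring.
Qed.

Lemma Series_Rabs_le (a b : nat -> R) :
  (forall n, Rabs (a n) <= b n) -> ex_series b -> Rabs (Series a) <= Series b.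
Proof.
  intros H Hb.
  assert (Ha : ex_series (fun n => Rabs (a n))).
  { apply ex_series_bound with b; auto.
    intros n. change (Rabs (Rabs (a n)) <= b n). rewrite Rabs_Rabsolu. auto. }
  eapply Rle_trans. apply Series_Rabs, Ha.
  apply Series_le; auto. intros n. split. apply Rabs_pos. apply H.
Qed.

Lemma Series_sum_n (g : nat -> nat -> R) (L : nat) : (forall i, ex_series (g i)) ->
  ex_series (fun j => sum_n (fun i => g i j) L) /\
  Series (fun j => sum_n (fun i => g i j) L) = sum_n (fun i => Series (g i)) L.
Proof.
  intros H. induction L as [|L [IH1 IH2]].
  - split. apply ex_series_ext with (2 := H O). intros; now rewrite sum_O.
    rewrite sum_O. apply Series_ext. intros; now rewrite sum_O.
  - split.
    + apply ex_series_ext with (fun j => sum_n (fun i => g i j) L + g (S L) j).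
      intros j. rewrite sum_Sn. reflexivity.
      apply ex_series_add; auto.
    + rewrite sum_Sn, <- IH2. unfold plus; simpl. rewrite <- Series_plus by auto.
      apply Series_ext. intros j. rewrite sum_Sn. reflexivity.
Qed.

(** The rows beyond [L], summed over all columns, contribute at most K G^2 e^(-r (L + 1)), where G
    is the sum of e^(-r n). Hence the partial sums over rows tend to the sum of the column sums. *)
Lemma Series_fubini (g : nat -> nat -> R) (K r : R) : 0 < r ->
  (forall i j, Rabs (g i j) <= K * exp (- r * INR i) * exp (- r * INR j)) ->
  Series (fun i => Series (fun j => g i j)) = Series (fun j => Series (fun i => g i j)).
Proof.
  intros Hr Hg.
  set (T := fun j => Series (fun i => g i j)).
  assert (Hi : forall i, ex_series (g i)).
  { intros i. apply ex_series_bound with (2 := ex_series_exp r (K * exp (- r * INR i)) Hr).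
    intros j; apply Hg. }
  assert (Hj : forall j, ex_series (fun i => g i j)).
  { intros j. apply ex_series_bound with (2 := ex_series_exp r (K * exp (- r * INR j)) Hr).
    intros i. eapply Rle_trans. apply Hg. right; ring. }
  set (G := Series (fun n => exp (- r * INR n))).
  assert (HG : ex_series (fun n => exp (- r * INR n))).
  { apply ex_series_ext with (2 := ex_series_exp r 1 Hr). intros; apply Rmult_1_l. }
  assert (Hcol : forall j, Rabs (T j) <= K * G * exp (- r * INR j)).
  { intros j. eapply Rle_trans. apply (Series_Rabs_le _ (fun i => (K * exp (- r * INR j)) * exp (- r * INR i))).
    intros i. eapply Rle_trans. apply Hg. right; ring.
    apply ex_series_exp; auto. rewrite Series_scal_l. fold G. right; ring. }
  assert (Hexcol : ex_series T).
  { apply ex_series_bound with (2 := ex_series_exp r (K * G) Hr). apply Hcol. }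
  apply is_series_unique.
  change (is_lim_seq (sum_n (fun i => Series (g i))) (Series T)).
  apply is_lim_seq_ext with (fun L => Series (fun j => sum_n (fun i => g i j) L)).
  { intros L. apply Series_sum_n, Hi. }
  assert (Hl : is_lim_seq (fun L => K * G * G * exp (- r * INR (S L))) 0).
  { apply is_lim_seq_incr_1 with (u := fun L => K * G * G * exp (- r * INR L)).
    apply (ex_series_lim_0 (fun L => K * G * G * exp (- r * INR L))). apply ex_series_exp; auto. }
  apply is_lim_seq_le_le_loc with
    (fun L => Series T - K * G * G * exp (- r * INR (S L)))
    (fun L => Series T + K * G * G * exp (- r * INR (S L))).
  - exists O. intros L _.
    cut (Rabs (Series T - Series (fun j => sum_n (fun i => g i j) L))
      <= K * G * G * exp (- r * INR (S L))).
    { intros H. apply Rabs_le_between in H. lra. }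
    rewrite <- Series_minus by (auto; apply Series_sum_n, Hi).
    eapply Rle_trans. apply (Series_Rabs_le _ (fun j => (K * G * exp (- r * INR (S L))) * exp (- r * INR j))).
    + intros j.
      unfold T. rewrite (Series_incr_n (fun i => g i j) (S L)) by (auto; lia). simpl pred.
      rewrite sum_n_Reals. match goal with |- Rabs ?x <= _ =>
        replace x with (Series (fun k => g (S L + k)%nat j)) by ring end.
      eapply Rle_trans. apply (Series_Rabs_le _ (fun i => (K * exp (- r * INR (S L)) * exp (- r * INR j)) * exp (- r * INR i))).
      * intros i. eapply Rle_trans. apply Hg. rewrite plus_INR, Rmult_plus_distr_l, exp_plus. right; ring.
      * apply ex_series_exp; auto.
      * rewrite Series_scal_l. fold G. right; ring.
    + apply ex_series_exp; auto.
    + rewrite Series_scal_l. fold G. right; ring.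
  - rewrite <- (Rminus_0_r (Series _)) at 1. apply is_lim_seq_minus'; auto. apply is_lim_seq_const.
  - rewrite <- (Rplus_0_r (Series _)) at 1. apply is_lim_seq_plus'; auto. apply is_lim_seq_const.
Qed.

Lemma ZS_fubini (f : Z -> Z -> R) (K r : R) : 0 < r ->
  (forall a b, Rabs (f a b) <= K * exp (- r * zabs a) * exp (- r * zabs b)) ->
  ZS (fun a => ZS (fun b => f a b)) = ZS (fun b => ZS (fun a => f a b)).
Proof.
  intros Hr Hf.
  assert (HK : 0 <= K).
  { specialize (Hf 0%Z 0%Z). simpl in Hf. rewrite Rmult_0_r, exp_0 in Hf.
    pose proof (Rabs_pos (f 0%Z 0%Z)). lra. }
  assert (Da : forall a, dec r (f a)) by (intros a; eexists; intros b; apply Hf).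
  assert (Db : forall b, dec r (fun a => f a b)).
  { intros b. exists (K * exp (- r * zabs b)). intros a. eapply Rle_trans. apply Hf. right; ring. }
  unfold ZS.
  set (g := fun i j : nat => f (Z.of_nat i) (Z.of_nat j) + f (Z.of_nat i) (-1 - Z.of_nat j)%Z
    + (f (-1 - Z.of_nat i)%Z (Z.of_nat j) + f (-1 - Z.of_nat i)%Z (-1 - Z.of_nat j)%Z)).
  transitivity (Series (fun i => Series (fun j => g i j))).
  { apply Series_ext. intros i. rewrite <- Series_plus. reflexivity.
    apply ex_series_add; [eapply dec_ex_posR | eapply dec_ex_negR]; eauto.
    apply ex_series_add; [eapply dec_ex_posR | eapply dec_ex_negR]; eauto. }
  transitivity (Series (fun j => Series (fun i => g i j))).
  { apply Series_fubini with (4 * K) r; auto. intros i j. unfold g.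
    assert (B : forall a b : Z, INR i <= zabs a -> INR j <= zabs b ->
      Rabs (f a b) <= K * exp (- r * INR i) * exp (- r * INR j)).
    { intros a b Ha Hb. eapply Rle_trans. apply Hf.
      apply Rmult_le_compat. apply Rmult_le_pos; auto. apply exp_ge0. apply exp_ge0.
      apply Rmult_le_compat_l; auto. apply exp_le; nra. apply exp_le; nra. }
    assert (Ei := Req_le_sym _ _ (IZR_abs_nat i)). assert (Ej := Req_le_sym _ _ (IZR_abs_nat j)).
    assert (Ni : INR i <= zabs (-1 - Z.of_nat i)) by (rewrite IZR_abs_neg; lra).
    assert (Nj : INR j <= zabs (-1 - Z.of_nat j)) by (rewrite IZR_abs_neg; lra).
    pose proof (B _ _ Ei Ej). pose proof (B _ _ Ei Nj). pose proof (B _ _ Ni Ej). pose proof (B _ _ Ni Nj).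
    eapply Rle_trans. apply Rabs_triang.
    eapply Rle_trans. apply Rplus_le_compat; apply Rabs_triang. lra. }
  { apply Series_ext. intros j. rewrite <- Series_plus. apply Series_ext. intros i. unfold g. ring.
    apply ex_series_add.
    apply (dec_ex_posR r (fun a => f a (Z.of_nat j))); auto. apply (dec_ex_negR r (fun a => f a (Z.of_nat j))); auto.
    apply ex_series_add.
    apply (dec_ex_posR r (fun a => f a (-1 - Z.of_nat j)%Z)); auto.
    apply (dec_ex_negR r (fun a => f a (-1 - Z.of_nat j)%Z)); auto. }
Qed.

Lemma ZS_single (n : Z) (x : R) : ZS (fun i => if Z.eq_dec i n then x else 0) = x.
Proof.
  assert (D : forall m, dec 1 (fun i => if Z.eq_dec i m then x else 0)).
  { intros m. exists (Rabs x * exp (zabs m)). intros j. rewrite Rmult_assoc, <- exp_plus.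
    destruct (Z.eq_dec j m) as [->|].
    - replace (zabs m + - (1) * zabs m) with 0 by ring. rewrite exp_0. lra.
    - rewrite Rabs_R0. apply Rmult_le_pos. apply Rabs_pos. apply exp_ge0. }
  rewrite <- (ZS_shift 1 _ n Rlt_0_1 (D n)).
  rewrite (ZS_ext _ (fun i => if Z.eq_dec i 0 then x else 0)).
  2: { intros i. destruct (Z.eq_dec (i + n) n), (Z.eq_dec i 0); auto; lia. }
  unfold ZS. rewrite Series_incr_1.
  - rewrite (Series_ext _ (fun n => 0 * 0)). rewrite Series_scal_l. simpl. ring.
    intros k. destruct (Z.eq_dec (Z.of_nat (S k)) 0); [lia|].
    destruct (Z.eq_dec (-1 - Z.of_nat (S k)) 0); [lia|]. ring.
  - apply ex_series_add.
    apply (dec_ex_posR 1 _ Rlt_0_1 (D 0%Z)). apply (dec_ex_negR 1 _ Rlt_0_1 (D 0%Z)).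
Qed.

Lemma dec_mult (r s : R) (u g : Z -> R) :
  dec r u -> dec s g -> dec (r + s) (fun j => u j * g j).
Proof.
  intros [K HK] [L HL]. exists (K * L). intros j. rewrite Rabs_mult.
  replace (K * L * exp (- (r + s) * zabs j))
    with ((K * exp (- r * zabs j)) * (L * exp (- s * zabs j))).
  apply Rmult_le_compat; auto using Rabs_pos.
  replace (- (r + s) * zabs j) with (- r * zabs j + - s * zabs j) by ring.
  rewrite exp_plus. ring.
Qed.

Lemma ZS_sub (r : R) (f : Z -> R) (m : Z) : 0 < r -> dec r f -> ZS (fun j => f (m - j)%Z) = ZS f.
Proof.
  intros Hr Hf. rewrite <- (ZS_reflect f).
  rewrite <- (ZS_shift r (fun j => f (-1 - j)%Z) (- m - 1)); auto.
  apply ZS_ext. intros; f_equal; lia.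
  apply (dec_comp r f (fun j => -1 - j)%Z 1); auto. lra. intros; lia.
Qed.

(** A weight that depends only on a + b turns a double sum into a single sum over n = a + b of
    convolutions. The weight may grow at rate [s], below the rate [r] at which both factors
    decay. *)
Lemma ZS_prod (r s : R) (u v g : Z -> R) : 0 <= s < r -> dec r u -> dec r v -> dec (- s) g ->
  ZS (fun a => u a * ZS (fun b => v b * g (a + b)%Z))
  = ZS (fun n => g n * ZS (fun a => u a * v (n - a)%Z)).
Proof.
  intros Hs Hu Hv Hg.
  assert (E : forall a, u a * ZS (fun b => v b * g (a + b)%Z)
    = ZS (fun n => u a * (v (n - a)%Z * g n))).
  { intros a. rewrite ZS_scal. f_equal.
    rewrite <- (ZS_shift (r - s) (fun b => v b * g (a + b)%Z) (- a)). 2: lra.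
    - apply ZS_ext. intros n. f_equal; f_equal; lia.
    - apply (dec_mult r (- s)); auto. destruct Hg as [K HK].
      exists (K * exp (s * zabs a)). intros j. eapply Rle_trans. apply HK.
      rewrite Rmult_assoc, <- exp_plus. apply Rmult_le_compat_l. apply (dec_nonneg _ _ _ HK).
      apply exp_le. assert (H : (Z.abs (a + j) <= Z.abs a + Z.abs j)%Z) by lia.
      apply IZR_le in H. rewrite plus_IZR in H. nra. }
  rewrite (ZS_ext _ _ E).
  destruct Hu as [K HK], Hv as [L HL], Hg as [M HM].
  (* As |n| <= |a| + |n - a|, the exponent r|a| + r|n - a| - s|n| is at least (r - s)(|a| + |n -
     a|), hence at least (r - s)/2 times |a| + |n|. *)
  rewrite (ZS_fubini _ (K * L * M) ((r - s) / 2)).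
  - apply ZS_ext. intros n. rewrite <- ZS_scal. apply ZS_ext. intros a. ring.
  - lra.
  - intros a n.
    pose proof (dec_nonneg _ _ _ HK). pose proof (dec_nonneg _ _ _ HL). pose proof (dec_nonneg _ _ _ HM).
    rewrite !Rabs_mult.
    apply Rle_trans with ((K * exp (- r * zabs a)) *
       ((L * exp (- r * zabs (n - a))) * (M * exp (- - s * zabs n)))).
    { repeat apply Rmult_le_compat; auto using Rabs_pos. apply Rmult_le_pos; apply Rabs_pos. }
    replace ((K * exp (- r * zabs a)) *
       ((L * exp (- r * zabs (n - a))) * (M * exp (- - s * zabs n))))
     with (K * L * M * exp (- r * zabs a + - r * zabs (n - a) + - - s * zabs n))
     by (rewrite !exp_plus; ring).
    rewrite (Rmult_assoc (K * L * M)), <- exp_plus.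
    apply Rmult_le_compat_l. repeat apply Rmult_le_pos; auto.
    apply exp_le.
    assert (H2 : (Z.abs n <= Z.abs a + Z.abs (n - a))%Z) by lia.
    assert (H3 : (0 <= Z.abs a)%Z) by lia. assert (H4 : (0 <= Z.abs (n - a))%Z) by lia.
    apply IZR_le in H2, H3, H4. rewrite plus_IZR in H2.
    set (x := zabs a) in *. set (y := zabs (n - a)) in *. set (w := zabs n) in *.
    nra.
Qed.

(** * Telescoping convolutions of step-like sequences *)

Definition sg (j : Z) : R := if Z_le_dec 0 j then 1 else -1.

(* [F j] tends to 1 at +oo and to -1 at -oo, exponentially fast. *)
Definition step (r : R) (F : Z -> R) : Prop := dec r (fun j => F j - sg j).

Lemma dec_finite (r M : R) (f : Z -> R) (B : Z) : 0 <= r -> (0 <= B)%Z -> 0 <= M ->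
  (forall j, Rabs (f j) <= M) -> (forall j, (B < Z.abs j)%Z -> f j = 0) -> dec r f.
Proof.
  intros Hr HB HM Hf H0. exists (M * exp (r * IZR B)). intros j.
  rewrite Rmult_assoc, <- exp_plus.
  destruct (Z_le_dec (Z.abs j) B) as [Hj|Hj].
  - eapply Rle_trans. apply Hf. rewrite <- (Rmult_1_r M) at 1. apply Rmult_le_compat_l; auto.
    rewrite <- exp_0. apply exp_le. apply IZR_le in Hj. nra.
  - rewrite H0 by lia. rewrite Rabs_R0. apply Rmult_le_pos; auto. apply exp_ge0.
Qed.

(** For |j| > |n| the indices j and n - j have opposite signs, so the limits of F and G cancel and
    only their exponentially small errors remain. *)
Lemma dec_step_sum (r : R) (F G : Z -> R) (n : Z) : 0 <= r -> step r F -> step r G ->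
  dec r (fun j => F j + G (n - j)%Z).
Proof.
  intros Hr HF HG.
  apply dec_ext with (fun j => (F j - sg j) + (G (n - j)%Z - sg (n - j)) + (sg j + sg (n - j))).
  intros; ring.
  apply dec_plus. apply dec_plus; auto.
  apply (dec_comp r (fun j => G j - sg j) (fun j => n - j)%Z (Z.abs n)); auto. intros; lia.
  apply (dec_finite r 2 _ (Z.abs n)); auto. lia. lra.
  intros j. unfold sg. destruct (Z_le_dec 0 j), (Z_le_dec 0 (n - j)); apply Rabs_le; lra.
  intros j Hj. unfold sg. destruct (Z_le_dec 0 j), (Z_le_dec 0 (n - j)); try lra; lia.
Qed.

(** The differences add up to the total rise from -1 to 1; the sequence [sg] makes this rise in one
    jump, at j = -1. *)
Lemma ZS_step_diff (r : R) (G : Z -> R) : 0 < r -> step r G ->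
  dec r (fun j => G (j + 1)%Z - G j) /\ ZS (fun j => G (j + 1)%Z - G j) = 2.
Proof.
  intros Hr HG.
  assert (D1 : dec r (fun j => G (j + 1)%Z - sg (j + 1))).
  { apply (dec_comp r (fun j => G j - sg j) (fun j => j + 1)%Z 1); auto. lra. intros; lia. }
  assert (D2 : dec r (fun j => if Z.eq_dec j (-1) then 2 else 0)).
  { apply (dec_finite r 2 _ 1). lra. lia. lra.
    intros j. destruct (Z.eq_dec j (-1)); apply Rabs_le; lra.
    intros j Hj. destruct (Z.eq_dec j (-1)); auto; lia. }
  assert (E : forall j, G (j + 1)%Z - G j
    = ((G (j + 1)%Z - sg (j + 1)) - (G j - sg j)) + (if Z.eq_dec j (-1) then 2 else 0)).
  { intros j. unfold sg. destruct (Z.eq_dec j (-1)), (Z_le_dec 0 j), (Z_le_dec 0 (j + 1)); try lra; lia. }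
  split.
  - eapply dec_ext. intros j; symmetry; apply E. apply dec_plus; auto. apply dec_minus; auto.
  - rewrite (ZS_ext _ _ E), (ZS_plus r), (ZS_minus r), ZS_single; auto.
    rewrite (ZS_shift r (fun j => G j - sg j)); auto. ring. apply dec_minus; auto.
Qed.

(* The sum grows by 2 when n grows by 1 (it telescopes); the reflections of F and G then fix the
   additive constant. *)
Lemma ZS_step_sum (r : R) (F G : Z -> R) (p q n : Z) : 0 < r -> step r F -> step r G ->
  (forall j, F (- p - j)%Z = - F j) -> (forall j, G (- q - j)%Z = - G j) ->
  ZS (fun j => F j + G (n - j)%Z) = IZR (2 * n + (p + q)).
Proof.
  intros Hr HF HG HFo HGo.
  set (T := fun n => ZS (fun j => F j + G (n - j)%Z)).
  assert (D : forall n, dec r (fun j => F j + G (n - j)%Z)) by (intros; apply dec_step_sum; auto; lra).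
  assert (HT : forall n, T (n + 1)%Z = T n + 2).
  { intros k. unfold T. destruct (ZS_step_diff r G Hr HG) as [DG EG].
    cut (ZS (fun j => (F j + G (k + 1 - j)%Z) - (F j + G (k - j)%Z)) = 2).
    { rewrite (ZS_minus r); auto. lra. }
    rewrite <- EG, <- (ZS_sub r _ k Hr DG). apply ZS_ext. intros j.
    replace (k + 1 - j)%Z with (k - j + 1)%Z by lia. ring. }
  assert (HT0 : forall n, T n = T 0%Z + 2 * IZR n).
  { assert (P : forall k : nat, forall m, T (m + Z.of_nat k)%Z = T m + 2 * INR k).
    { induction k as [|k IH]; intros m. simpl. rewrite Z.add_0_r. ring.
      replace (m + Z.of_nat (S k))%Z with (m + Z.of_nat k + 1)%Z by lia.
      rewrite HT, IH, S_INR. ring. }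
    intros k. destruct (Z_le_dec 0 k).
    - specialize (P (Z.to_nat k) 0%Z). rewrite INR_IZR_INZ, Z2Nat.id in P by lia. apply P.
    - specialize (P (Z.to_nat (- k)) k). rewrite INR_IZR_INZ, Z2Nat.id in P by lia.
      replace (k + - k)%Z with 0%Z in P by lia. rewrite opp_IZR in P. lra. }
  assert (HR : T n = - T (- p - q - n)%Z).
  { unfold T. rewrite <- (ZS_sub r (fun j => F j + G (n - j)%Z) (- p)); auto.
    rewrite (ZS_ext _ (fun j => -1 * (F j + G (- p - q - n - j)%Z))).
    rewrite ZS_scal; ring. intros j. rewrite HFo.
    replace (n - (- p - j))%Z with (- q - (- p - q - n - j))%Z by lia. rewrite HGo. ring. }
  fold (T n). rewrite (HT0 (- p - q - n)%Z) in HR.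
  rewrite (HT0 n) in *. rewrite !minus_IZR, opp_IZR in HR. rewrite !plus_IZR, mult_IZR. lra.
Qed.

(** The corrections [x] at i = n and [y] at i = 0 are for kernels with a pole: there the addition
    formula fails, and the default values of [csch] and [coth] at 0 leave a defect. *)
Lemma ZS_conv (r : R) (u v F G : Z -> R) (p q n : Z) (w x y : R) : 0 < r -> step r F -> step r G ->
  (forall j, F (- p - j)%Z = - F j) -> (forall j, G (- q - j)%Z = - G j) ->
  (forall i, u i * v (n - i)%Z = w * (F i + G (n - i)%Z)
     - (if Z.eq_dec i n then x else 0) - (if Z.eq_dec i 0 then y else 0)) ->
  ZS (fun i => u i * v (n - i)%Z) = w * IZR (2 * n + (p + q)) - x - y.
Proof.
  intros Hr HF HG HFo HGo H. rewrite (ZS_ext _ _ H).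
  assert (D : forall m x, dec r (fun j => if Z.eq_dec j m then x else 0)).
  { intros m z. apply (dec_finite r (Rabs z) _ (Z.abs m)). lra. lia. apply Rabs_pos.
    intros j. destruct (Z.eq_dec j m). lra. rewrite Rabs_R0. apply Rabs_pos.
    intros j Hj. destruct (Z.eq_dec j m); auto. lia. }
  assert (D2 : dec r (fun j => w * (F j + G (n - j)%Z))).
  { apply dec_scal, dec_step_sum; auto; lra. }
  rewrite (ZS_minus r), (ZS_minus r), !ZS_single, ZS_scal; auto.
  rewrite (ZS_step_sum r F G p q n); auto. apply dec_minus; auto.
Qed.

(** * Hyperbolic kernels *)

(* The even integers for b = 0, the odd ones for b = 1. *)
Definition fr (b j : Z) : R := IZR (2 * j + b).

Notation hdec b u h := (dec (2 * h) (fun j => u (fr b j * h))).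

Definition sech (x : R) : R := / cosh x.
(* [/ 0 = 0], so [csch 0 = 0] and [coth 0 = 0]: a sum over all j of [csch (fr 0 j * h)]
   silently skips j = 0. *)
Definition csch (x : R) : R := / sinh x.
Definition th (x : R) : R := sinh x / cosh x.
Definition coth (x : R) : R := cosh x / sinh x.

Lemma fr_add (b c i j : Z) : fr b i + fr c j = fr (b + c) (i + j).
Proof. unfold fr. rewrite <- plus_IZR. f_equal. lia. Qed.

Lemma fr_refl (b j : Z) : fr b (- b - j) = - fr b j.
Proof. unfold fr. rewrite <- opp_IZR. f_equal. lia. Qed.

Lemma cosh_neg (x : R) : cosh (- x) = cosh x.
Proof. unfold cosh. rewrite Ropp_involutive. field. Qed.

Lemma sinh_neg (x : R) : sinh (- x) = - sinh x.
Proof. unfold sinh. rewrite Ropp_involutive. field. Qed.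

Lemma cosh_pos (x : R) : 0 < cosh x.
Proof. unfold cosh. pose proof (exp_pos x). pose proof (exp_pos (- x)). lra. Qed.

Lemma sinh_pos (x : R) : 0 < x -> 0 < sinh x.
Proof. intros H. rewrite <- sinh_0. apply sinh_lt, H. Qed.

Lemma sinh_neq0 (x : R) : x <> 0 -> sinh x <> 0.
Proof.
  intros H. destruct (Rdichotomy _ _ H) as [H1|H1].
  - rewrite <- (Ropp_involutive x), sinh_neg. pose proof (sinh_pos (- x)). lra.
  - pose proof (sinh_pos x). lra.
Qed.

Lemma sech_neg (x : R) : sech (- x) = sech x.
Proof. unfold sech. now rewrite cosh_neg. Qed.
Lemma csch_neg (x : R) : csch (- x) = - csch x.
Proof. unfold csch. rewrite sinh_neg. apply Rinv_opp. Qed.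
Lemma th_neg (x : R) : th (- x) = - th x.
Proof. unfold th, Rdiv. rewrite cosh_neg, sinh_neg. ring. Qed.
Lemma coth_neg (x : R) : coth (- x) = - coth x.
Proof. unfold coth, Rdiv. rewrite cosh_neg, sinh_neg, Rinv_opp. ring. Qed.
Lemma csch_0 : csch 0 = 0.
Proof. unfold csch. rewrite sinh_0. apply Rinv_0. Qed.
Lemma coth_0 : coth 0 = 0.
Proof. unfold coth, Rdiv. rewrite sinh_0, Rinv_0. ring. Qed.
Lemma cosh_sq (x : R) : cosh x * cosh x = 1 + sinh x * sinh x.
Proof.
  unfold cosh, sinh.
  assert (exp x * exp (- x) = 1) by (rewrite <- exp_plus, Rplus_opp_r; apply exp_0). nra.
Qed.

Lemma cosh_add (x y : R) : cosh (x + y) = cosh x * cosh y + sinh x * sinh y.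
Proof. unfold cosh, sinh. rewrite Ropp_plus_distr, !exp_plus. field. Qed.
Lemma sinh_add (x y : R) : sinh (x + y) = sinh x * cosh y + cosh x * sinh y.
Proof. unfold cosh, sinh. rewrite Ropp_plus_distr, !exp_plus. field. Qed.

Lemma sech_mult (x y : R) : x + y <> 0 -> sech x * sech y = csch (x + y) * (th x + th y).
Proof.
  intros H. apply sinh_neq0 in H. unfold sech, csch, th. rewrite sinh_add in *.
  pose proof (cosh_pos x). pose proof (cosh_pos y). field. lra.
Qed.

Lemma csch_sech_mult (x y : R) : x <> 0 -> csch x * sech y = sech (x + y) * (coth x + th y).
Proof.
  intros H. apply sinh_neq0 in H. unfold sech, csch, th, coth.
  pose proof (cosh_pos (x + y)) as P. rewrite cosh_add in *. pose proof (cosh_pos y).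
  field. repeat split; lra.
Qed.

Lemma csch_mult (x y : R) : x <> 0 -> y <> 0 -> x + y <> 0 ->
  csch x * csch y = csch (x + y) * (coth x + coth y).
Proof.
  intros H1 H2 H. apply sinh_neq0 in H, H1, H2. unfold csch, coth. rewrite sinh_add in *.
  field. repeat split; lra.
Qed.

Lemma sech_bound (x : R) : Rabs (sech x) <= 2 * exp (- Rabs x).
Proof.
  assert (H : forall x, 0 <= x -> Rabs (sech x) <= 2 * exp (- x)).
  { intros y Hy. pose proof (cosh_pos y) as P. unfold sech.
    rewrite Rabs_pos_eq by (apply Rlt_le, Rinv_0_lt_compat, P).
    apply Rmult_le_reg_r with (cosh y); auto. rewrite Rinv_l by lra.
    unfold cosh. pose proof (exp_pos (- y)).
    assert (exp (- y) * exp y = 1) by (rewrite <- exp_plus, Rplus_opp_l; apply exp_0).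
    nra. }
  destruct (Rle_dec 0 x). rewrite (Rabs_pos_eq x) by auto. auto.
  rewrite <- sech_neg. rewrite (Rabs_left x) by lra. apply H; lra.
Qed.

(** From sinh y = e^y (1 - e^(-2y)) / 2 and y >= d. The distance [d] keeps away from the pole at
    0. *)
Lemma csch_bound (d x : R) : 0 < d -> d <= Rabs x ->
  Rabs (csch x) <= 2 / (1 - exp (- (2 * d))) * exp (- Rabs x).
Proof.
  intros Hd.
  assert (H : forall x, d <= x -> Rabs (csch x) <= 2 / (1 - exp (- (2 * d))) * exp (- x)).
  { intros y Hy. pose proof (sinh_pos y ltac:(lra)) as P. unfold csch.
    rewrite Rabs_pos_eq by (apply Rlt_le, Rinv_0_lt_compat, P).
    assert (Hq : exp (- (2 * d)) < 1) by (rewrite <- exp_0; apply exp_increasing; lra).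
    apply Rmult_le_reg_r with (sinh y); auto. rewrite Rinv_l by lra.
    apply Rmult_le_reg_r with (1 - exp (- (2 * d))). lra.
    replace (2 / (1 - exp (- (2 * d))) * exp (- y) * sinh y * (1 - exp (- (2 * d))))
      with (2 * exp (- y) * sinh y) by (field; lra).
    unfold sinh.
    assert (E1 : exp (- y) * exp y = 1) by (rewrite <- exp_plus, Rplus_opp_l; apply exp_0).
    assert (E2 : exp (- y) * exp (- y) <= exp (- (2 * d))).
    { rewrite <- exp_plus. apply exp_le. lra. }
    nra. }
  intros Hx. destruct (Rle_dec 0 x). rewrite (Rabs_pos_eq x) in * by auto. auto.
  rewrite <- (Ropp_involutive x), csch_neg, Rabs_Ropp, Rabs_Ropp. rewrite (Rabs_left x) in Hx by lra.
  rewrite (Rabs_pos_eq (- x)) by lra. apply H; lra.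
Qed.

Lemma th_sech (x : R) : 0 <= x -> 1 - th x = exp (- x) * sech x.
Proof.
  intros Hx. unfold th, sech. pose proof (cosh_pos x).
  apply Rmult_eq_reg_r with (cosh x); try lra.
  replace ((1 - sinh x / cosh x) * cosh x) with (cosh x - sinh x) by (field; lra).
  rewrite Rmult_assoc, Rinv_l by lra. unfold cosh, sinh. field.
Qed.

(** Since cosh^2 = 1 + sinh^2, [coth] differs from [th] by an exponentially small term, so its
    limits at infinity follow from those of [th]. The default values make the identity true at 0 as
    well. *)
Lemma coth_th (x : R) : coth x = th x + csch x * sech x.
Proof.
  destruct (Req_dec x 0) as [->|Hx]. rewrite coth_0, csch_0. unfold th. rewrite sinh_0. unfold Rdiv. ring.
  unfold coth, th, csch, sech. apply sinh_neq0 in Hx. pose proof (cosh_pos x).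
  apply Rmult_eq_reg_r with (sinh x * cosh x); [|apply Rmult_integral_contrapositive_currified; lra].
  transitivity (cosh x * cosh x). field. auto. rewrite cosh_sq. field. lra.
Qed.

Lemma fr_abs (b j : Z) (h : R) : 0 <= h ->
  2 * h * zabs j <= Rabs (fr b j * h) + h * zabs b.
Proof.
  intros Hh. rewrite Rabs_mult, (Rabs_pos_eq h) by auto. unfold fr. rewrite <- abs_IZR.
  assert (H : (2 * Z.abs j <= Z.abs (2 * j + b) + Z.abs b)%Z) by lia.
  apply IZR_le in H. rewrite mult_IZR, plus_IZR in H. nra.
Qed.

Lemma dec_of_bound (b : Z) (h K : R) (f : R -> R) : 0 < h -> 0 <= K ->
  (forall j, Rabs (f (fr b j * h)) <= K * exp (- Rabs (fr b j * h))) ->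
  hdec b f h.
Proof.
  intros Hh HK H. exists (K * exp (h * zabs b)). intros j. eapply Rle_trans. apply H.
  rewrite Rmult_assoc, <- exp_plus. apply Rmult_le_compat_l; auto. apply exp_le.
  pose proof (fr_abs b j h). lra.
Qed.

Lemma fr_cases (b j : Z) (h : R) : 0 < h ->
  (2 * j + b = 0)%Z /\ fr b j * h = 0 \/ (2 * j + b <> 0)%Z /\ h <= Rabs (fr b j * h).
Proof.
  intros Hh. destruct (Z.eq_dec (2 * j + b) 0) as [E|E].
  - left. split; auto. unfold fr. rewrite E. ring.
  - right. split; auto. unfold fr. rewrite Rabs_mult, <- abs_IZR, (Rabs_pos_eq h) by lra.
    assert (H : (1 <= Z.abs (2 * j + b))%Z) by lia. apply IZR_le in H. nra.
Qed.

(** Decay like e^(-|x|), demanded only at 0 and at distance at least [d] from 0. The points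
    [fr b j * h] are all of this kind with d = h, so [csch] qualifies in spite of its pole. *)
Definition tame (u : R -> R) : Prop :=
  forall d, 0 < d -> exists K, 0 <= K /\ forall x, x = 0 \/ d <= Rabs x -> Rabs (u x) <= K * exp (- Rabs x).

Lemma tame_dec (u : R -> R) (b : Z) (h : R) : 0 < h -> tame u -> hdec b u h.
Proof.
  intros Hh Hu. destruct (Hu h Hh) as [K [HK H]]. apply dec_of_bound with K; auto.
  intros j. apply H. destruct (fr_cases b j h Hh) as [[_ E]|[_ E]]; auto.
Qed.

Lemma tame_sech : tame sech.
Proof. intros d Hd. exists 2. split. lra. intros; apply sech_bound. Qed.

Lemma tame_csch : tame csch.
Proof.
  intros d Hd.
  assert (Hq : exp (- (2 * d)) < 1) by (rewrite <- exp_0; apply exp_increasing; lra).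
  assert (P : 0 < 2 / (1 - exp (- (2 * d)))) by (apply Rdiv_lt_0_compat; lra).
  exists (2 / (1 - exp (- (2 * d)))). split. lra. intros x [->|Hx].
  - rewrite csch_0, Rabs_R0. apply Rmult_le_pos. lra. apply exp_ge0.
  - apply csch_bound; auto.
Qed.

Lemma sech_dec (b : Z) (h : R) : 0 < h -> hdec b sech h.
Proof. intros Hh. apply (tame_dec sech); auto. apply tame_sech. Qed.

Lemma csch_dec (b : Z) (h : R) : 0 < h -> hdec b csch h.
Proof. intros Hh. apply (tame_dec csch); auto. apply tame_csch. Qed.

(** For b = 0 or 1 the sign of [fr b j] is [sg j], except that [fr 0 0] is 0; there the defect 1 -
    th 0 is still [sech 0]. *)
Lemma th_step (b : Z) (h : R) : 0 < h -> (b = 0 \/ b = 1)%Z -> step (2 * h) (fun j => th (fr b j * h)).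
Proof.
  intros Hh Hb. destruct (sech_dec b h Hh) as [K HK]. exists K. intros j.
  eapply Rle_trans. 2: apply HK. unfold sg.
  assert (B : forall x, 0 <= x -> Rabs (1 - th x) <= Rabs (sech x)).
  { intros x Hx. rewrite th_sech by auto. rewrite Rabs_mult. rewrite <- Rmult_1_l.
    apply Rmult_le_compat_r. apply Rabs_pos. rewrite Rabs_pos_eq by apply exp_ge0.
    rewrite <- exp_0. apply exp_le; lra. }
  destruct (Z_le_dec 0 j) as [Hj|Hj].
  - rewrite Rabs_minus_sym. apply B. apply Rmult_le_pos; try lra. apply IZR_le. lia.
  - rewrite <- (Ropp_involutive (fr b j * h)), th_neg, sech_neg.
    replace (- th (- (fr b j * h)) - -1) with (1 - th (- (fr b j * h))) by ring. apply B.
    assert (fr b j <= 0) by (apply IZR_le; lia). nra.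
Qed.

Lemma coth_step (b : Z) (h : R) : 0 < h -> (b = 0 \/ b = 1)%Z -> step (2 * h) (fun j => coth (fr b j * h)).
Proof.
  intros Hh Hb. unfold step.
  apply dec_ext with (fun j => (th (fr b j * h) - sg j) + csch (fr b j * h) * sech (fr b j * h)).
  intros j. rewrite coth_th. ring. apply dec_plus. apply th_step; auto.
  apply dec_le with (2 * h + 2 * h). lra. apply dec_mult. apply csch_dec, Hh. apply sech_dec, Hh.
Qed.

(** * Products of Lambert series *)

(** Exponential growth of rate [s]. Such a weight is summable against a kernel that decays like
    e^(-h |x|) as soon as s < h. *)
Definition gr (s : R) (g : R -> R) : Prop := exists M, forall x, Rabs (g x) <= M * exp (s * Rabs x).

Lemma gr_dec (s : R) (g : R -> R) (b : Z) : 0 <= s -> gr s g ->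
  dec (- (2 * s)) (fun j => g (fr b j)).
Proof.
  intros Hs [M HM]. exists (M * exp (s * zabs b)). intros j. eapply Rle_trans. apply HM.
  rewrite Rmult_assoc, <- exp_plus.
  assert (0 <= M).
  { specialize (HM 0). rewrite Rabs_R0, Rmult_0_r, exp_0 in HM. pose proof (Rabs_pos (g 0)). lra. }
  apply Rmult_le_compat_l; auto. apply exp_le. unfold fr. rewrite <- abs_IZR.
  assert (H2 : (Z.abs (2 * j + b) <= 2 * Z.abs j + Z.abs b)%Z) by lia.
  apply IZR_le in H2. rewrite plus_IZR, mult_IZR in H2. nra.
Qed.

Lemma pow_exp_bound (k : nat) : forall s, 0 < s -> exists M, forall x, 0 <= x -> x ^ k <= M * exp (s * x).
Proof.
  induction k as [|k IH]; intros s Hs.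
  - exists 1. intros x Hx. simpl. rewrite Rmult_1_l, <- exp_0. apply exp_le. nra.
  - destruct (IH (s / 2) ltac:(lra)) as [M HM]. exists (2 / s * M). intros x Hx. simpl.
    apply Rle_trans with ((2 / s * exp (s / 2 * x)) * (M * exp (s / 2 * x))).
    + apply Rmult_le_compat; auto. apply pow_le; auto.
      pose proof (exp_ineq1_le (s / 2 * x)).
      apply Rmult_le_reg_l with (s / 2). lra. rewrite <- Rmult_assoc.
      replace (s / 2 * (2 / s)) with 1 by (field; lra). lra.
    + replace (s * x) with (s / 2 * x + s / 2 * x) by field. rewrite exp_plus. right; ring.
Qed.

Lemma gr_pow (k : nat) (s : R) : 0 < s -> gr s (fun x => x ^ k).
Proof.
  intros Hs. destruct (pow_exp_bound k s Hs) as [M HM]. exists M. intros x.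
  rewrite <- RPow_abs. apply HM, Rabs_pos.
Qed.

Lemma gr_bounded (s M : R) (g : R -> R) : 0 <= s -> (forall x, Rabs (g x) <= M) -> gr s g.
Proof.
  intros Hs H. exists M. intros x. eapply Rle_trans. apply H. rewrite <- (Rmult_1_r M) at 1.
  apply Rmult_le_compat_l. eapply Rle_trans. apply Rabs_pos. apply (H 0).
  rewrite <- exp_0. apply exp_le. apply Rmult_le_pos; auto. apply Rabs_pos.
Qed.

Lemma gr_cos (s t : R) : 0 <= s -> gr s (fun x => cos (t * x)).
Proof. intros. apply gr_bounded with 1; auto. intros. apply Rabs_le, COS_bound. Qed.
Lemma gr_sin (s t : R) : 0 <= s -> gr s (fun x => sin (t * x)).
Proof. intros. apply gr_bounded with 1; auto. intros. apply Rabs_le, SIN_bound. Qed.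
Lemma gr_const (s k : R) : 0 <= s -> gr s (fun x => k).
Proof. intros. apply gr_bounded with (Rabs k); auto. intros. lra. Qed.
Lemma gr_exp (t : R) : gr (Rabs t) (fun x => exp (t * x)).
Proof.
  exists 1. intros x. rewrite Rabs_pos_eq by apply exp_ge0. rewrite Rmult_1_l.
  apply exp_le. rewrite <- Rabs_mult. apply Rle_abs.
Qed.
Lemma gr_opp (s : R) (g : R -> R) : gr s g -> gr s (fun x => - g x).
Proof. intros [M H]. exists M. intros. rewrite Rabs_Ropp. auto. Qed.
Lemma gr_scal (s k : R) (g : R -> R) : gr s g -> gr s (fun x => k * g x).
Proof.
  intros [M H]. exists (Rabs k * M). intros. rewrite Rabs_mult, Rmult_assoc.
  apply Rmult_le_compat_l; auto. apply Rabs_pos.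
Qed.
Lemma gr_mult (s s' : R) (f g : R -> R) : gr s f -> gr s' g -> gr (s + s') (fun x => f x * g x).
Proof.
  intros [M H] [M' H']. exists (M * M'). intros. rewrite Rabs_mult, Rmult_plus_distr_r, exp_plus.
  replace (M * M' * (exp (s * Rabs x) * exp (s' * Rabs x)))
    with ((M * exp (s * Rabs x)) * (M' * exp (s' * Rabs x))) by ring.
  apply Rmult_le_compat; auto using Rabs_pos.
Qed.

(** The variable t of the elliptic functions enters through the weight [g], the nome through the
    kernel [u]. Keeping the two apart allows one product rule for all weights. *)
Definition LS (g : R -> R) (b : Z) (u : R -> R) (h : R) : R :=
  ZS (fun j => g (fr b j) * u (fr b j * h)).

Definition conv (b c : Z) (u v : R -> R) (h : R) (n : Z) : R :=
  ZS (fun i => u (fr b i * h) * v (fr c (n - i) * h)).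

Lemma LS_dec (s : R) (g : R -> R) (b : Z) (u : R -> R) (h : R) : 0 <= s -> gr s g ->
  hdec b u h -> dec (2 * h - 2 * s) (fun j => g (fr b j) * u (fr b j * h)).
Proof.
  intros Hs Hg Hu. replace (2 * h - 2 * s) with (- (2 * s) + 2 * h) by ring.
  apply (dec_mult _ _ (fun j => g (fr b j))); auto. apply gr_dec; auto.
Qed.

(** Three terms are what the weight (x + y)^2 requires; the addition formulas of cos, sin, exp and
    the identity need fewer and are instances. *)
Lemma LS_prod3 (s h : R) (b c : Z) (u v g a1 b1 a2 b2 a3 b3 : R -> R) : 0 <= s < h ->
  hdec b u h -> hdec c v h ->
  gr s g -> gr s a1 -> gr s a2 -> gr s a3 -> gr s b1 -> gr s b2 -> gr s b3 ->
  (forall x y, g (x + y) = a1 x * b1 y + a2 x * b2 y + a3 x * b3 y) ->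
  LS a1 b u h * LS b1 c v h + LS a2 b u h * LS b2 c v h + LS a3 b u h * LS b3 c v h
  = ZS (fun n => g (fr (b + c) n) * conv b c u v h n).
Proof.
  intros Hs Hu Hv Hg Ha1 Ha2 Ha3 Hb1 Hb2 Hb3 Hadd.
  unfold conv. rewrite <- (ZS_prod (2 * h) (2 * s) (fun j => u (fr b j * h)) (fun j => v (fr c j * h))
    (fun n => g (fr (b + c) n))); auto; try lra.
  2: { apply gr_dec; auto; lra. }
  assert (P : 0 < 2 * h - 2 * s) by lra.
  assert (Da1 := LS_dec s a1 b u h (proj1 Hs) Ha1 Hu).
  assert (Da2 := LS_dec s a2 b u h (proj1 Hs) Ha2 Hu).
  assert (Da3 := LS_dec s a3 b u h (proj1 Hs) Ha3 Hu).
  assert (Db1 := LS_dec s b1 c v h (proj1 Hs) Hb1 Hv).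
  assert (Db2 := LS_dec s b2 c v h (proj1 Hs) Hb2 Hv).
  assert (Db3 := LS_dec s b3 c v h (proj1 Hs) Hb3 Hv).
  rewrite (ZS_ext (fun a => u (fr b a * h) * ZS (fun b0 => v (fr c b0 * h) * g (fr (b + c) (a + b0))))
    (fun a => LS b1 c v h * (a1 (fr b a) * u (fr b a * h)) + LS b2 c v h * (a2 (fr b a) * u (fr b a * h))
      + LS b3 c v h * (a3 (fr b a) * u (fr b a * h)))).
  - rewrite (ZS_plus _ _ _ P), (ZS_plus _ _ _ P), !ZS_scal; auto using dec_scal, dec_plus.
    unfold LS. ring.
  - intros a.
    rewrite (ZS_ext _ (fun j => a1 (fr b a) * (b1 (fr c j) * v (fr c j * h))
      + a2 (fr b a) * (b2 (fr c j) * v (fr c j * h)) + a3 (fr b a) * (b3 (fr c j) * v (fr c j * h)))).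
    + rewrite (ZS_plus _ _ _ P), (ZS_plus _ _ _ P), !ZS_scal; auto using dec_scal, dec_plus.
      unfold LS. ring.
    + intros j. rewrite <- fr_add, Hadd. ring.
Qed.

Lemma LS_prod2 (s h : R) (b c : Z) (u v g a1 b1 a2 b2 : R -> R) : 0 <= s < h ->
  hdec b u h -> hdec c v h ->
  gr s g -> gr s a1 -> gr s a2 -> gr s b1 -> gr s b2 ->
  (forall x y, g (x + y) = a1 x * b1 y + a2 x * b2 y) ->
  LS a1 b u h * LS b1 c v h + LS a2 b u h * LS b2 c v h
  = ZS (fun n => g (fr (b + c) n) * conv b c u v h n).
Proof.
  intros Hs Hu Hv Hg Ha1 Ha2 Hb1 Hb2 Hadd.
  rewrite <- (LS_prod3 s h b c u v g a1 b1 a2 b2 (fun _ => 0) (fun _ => 0)); auto;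
    try (apply gr_const; lra).
  - assert (E : LS (fun _ => 0) b u h = 0).
    { unfold LS. rewrite (ZS_ext _ (fun _ => 0)) by (intros; ring). apply ZS_zero. }
    rewrite E. ring.
  - intros. rewrite Hadd. ring.
Qed.

Lemma LS_parity (s : R) (g : R -> R) (b : Z) (u : R -> R) (h : R) : 0 <= s < h -> gr s g ->
  hdec b u h ->
  (forall x, g (- x) * u (- (x * h)) = - (g x * u (x * h))) -> LS g b u h = 0.
Proof.
  intros Hs Hg Hu H. unfold LS. apply ZS_odd with (2 * h - 2 * s) (- b)%Z. lra.
  apply LS_dec; auto; lra. intros j. rewrite fr_refl, Ropp_mult_distr_l_reverse. apply H.
Qed.

Lemma LS_ext (g g' : R -> R) (b : Z) (u u' : R -> R) (h : R) :
  (forall j, g (fr b j) * u (fr b j * h) = g' (fr b j) * u' (fr b j * h)) -> LS g b u h = LS g' b u' h.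
Proof. intros H. apply ZS_ext. apply H. Qed.

Lemma fr_0_neq (n : Z) (h : R) : 0 < h -> n <> 0%Z -> fr 0 n * h <> 0.
Proof.
  intros Hh Hn. apply Rmult_integral_contrapositive_currified; [|lra]. apply IZR_neq. lia.
Qed.

Lemma fr_1_neq (n : Z) (h : R) : 0 < h -> fr 1 n * h <> 0.
Proof. intros Hh. apply Rmult_integral_contrapositive_currified; [|lra]. apply IZR_neq. lia. Qed.

Lemma refl_arg (f : R -> R) (b : Z) (h : R) : (forall x, f (- x) = - f x) ->
  forall j, f (fr b (- b - j) * h) = - f (fr b j * h).
Proof. intros Hf j. rewrite fr_refl, Ropp_mult_distr_l_reverse. apply Hf. Qed.

Lemma if_same (A B : Prop) (d : {A} + {B}) (x : R) : (if d then x else x) = x.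
Proof. destruct d; auto. Qed.

Lemma fr_add_h (b c i n : Z) (h : R) : fr b i * h + fr c (n - i) * h = fr (b + c) n * h.
Proof. rewrite <- Rmult_plus_distr_r, fr_add. do 2 f_equal. lia. Qed.

(* By the addition formula the summand is [th x + th y] up to a factor that depends on the sum
   x + y only, so the convolution is an instance of [ZS_step_sum]. *)
Lemma conv_sech (b c n : Z) (h : R) : 0 < h -> (b = 0 \/ b = 1)%Z -> (c = 0 \/ c = 1)%Z ->
  (2 * n + (b + c) <> 0)%Z ->
  conv b c sech sech h n = fr (b + c) n * csch (fr (b + c) n * h).
Proof.
  intros Hh Hb Hc Hn. unfold conv.
  rewrite (ZS_conv (2 * h) (fun i => sech (fr b i * h)) (fun i => sech (fr c i * h))
    (fun i => th (fr b i * h)) (fun i => th (fr c i * h)) b c n (csch (fr (b + c) n * h)) 0 0);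
    try (apply th_step; auto); try (apply refl_arg, th_neg); try lra.
  - fold (fr (b + c) n). ring.
  - intros i. rewrite !if_same. rewrite sech_mult, fr_add_h. ring.
    rewrite fr_add_h. apply Rmult_integral_contrapositive_currified; [|lra]. apply IZR_neq, Hn.
Qed.

Lemma conv_csch_sech1 (c n : Z) (h : R) : 0 < h -> (c = 0 \/ c = 1)%Z ->
  conv 1 c csch sech h n = fr (1 + c) n * sech (fr (1 + c) n * h).
Proof.
  intros Hh Hc. unfold conv.
  rewrite (ZS_conv (2 * h) (fun i => csch (fr 1 i * h)) (fun i => sech (fr c i * h))
    (fun i => coth (fr 1 i * h)) (fun i => th (fr c i * h)) 1 c n (sech (fr (1 + c) n * h)) 0 0);
    try (apply th_step; auto); try (apply coth_step; auto);
    try (apply refl_arg, th_neg); try (apply refl_arg, coth_neg); try lra.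
  - fold (fr (1 + c) n). ring.
  - intros i. rewrite !if_same. rewrite csch_sech_mult, fr_add_h. ring. apply fr_1_neq, Hh.
Qed.

(** At i = 0 the product is 0 by the default value of [csch], whereas the telescoping formula would
    give [sech * th]. Removing this surplus produces the second term. *)
Lemma conv_csch_sech0 (c n : Z) (h : R) : 0 < h -> (c = 0 \/ c = 1)%Z ->
  conv 0 c csch sech h n
  = fr c n * sech (fr c n * h) - th (fr c n * h) * sech (fr c n * h).
Proof.
  intros Hh Hc. unfold conv.
  rewrite (ZS_conv (2 * h) (fun i => csch (fr 0 i * h)) (fun i => sech (fr c i * h))
    (fun i => coth (fr 0 i * h)) (fun i => th (fr c i * h)) 0 c n (sech (fr c n * h)) 0
    (sech (fr c n * h) * th (fr c n * h)));
    try (apply th_step; auto); try (apply coth_step; auto);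
    try (apply refl_arg, th_neg); try (apply refl_arg, coth_neg); try lra.
  - rewrite Z.add_0_l. fold (fr c n). ring.
  - intros i. rewrite if_same. destruct (Z.eq_dec i 0) as [->|Hi].
    + assert (E0 : fr 0 0 * h = 0) by (unfold fr; simpl; ring).
      rewrite E0, csch_0, coth_0, Z.sub_0_r. ring.
    + rewrite csch_sech_mult, fr_add_h, Z.add_0_l. ring. apply fr_0_neq; auto.
Qed.

(** Here both factors have a missing frequency, at i = 0 and at i = n, which are distinct because n
    is not 0. Each removes one product [coth * csch]. *)
Lemma conv_csch0 (n : Z) (h : R) : 0 < h -> (n <> 0)%Z ->
  conv 0 0 csch csch h n
  = fr 0 n * csch (fr 0 n * h) - 2 * (coth (fr 0 n * h) * csch (fr 0 n * h)).
Proof.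
  intros Hh Hn. unfold conv.
  rewrite (ZS_conv (2 * h) (fun i => csch (fr 0 i * h)) (fun i => csch (fr 0 i * h))
    (fun i => coth (fr 0 i * h)) (fun i => coth (fr 0 i * h)) 0 0 n (csch (fr 0 n * h))
    (csch (fr 0 n * h) * coth (fr 0 n * h))
    (csch (fr 0 n * h) * coth (fr 0 n * h)));
    try (apply coth_step; auto); try (apply refl_arg, coth_neg); try lra.
  - change (0 + 0)%Z with 0%Z. fold (fr 0 n). ring.
  - intros i.
    assert (E0 : fr 0 0 * h = 0) by (unfold fr; simpl; ring).
    destruct (Z.eq_dec i 0) as [->|Hi]; [|destruct (Z.eq_dec i n) as [->|Hi']].
    + destruct (Z.eq_dec 0 n); [lia|]. rewrite E0, csch_0, coth_0, Z.sub_0_r. ring.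
    + rewrite Z.sub_diag, E0, csch_0, coth_0. ring.
    + rewrite csch_mult, fr_add_h. change (0 + 0)%Z with 0%Z. ring.
      apply fr_0_neq; auto. apply fr_0_neq; auto; lia. rewrite fr_add_h. apply fr_0_neq; auto.
Qed.

(** * Termwise differentiation *)

Lemma Series_tail_le (a b : nat -> R) (n : nat) :
  (forall k, Rabs (a k) <= b k) -> ex_series b ->
  Rabs (sum_n a n - Series a) <= Series b - sum_n b n.
Proof.
  intros H Hb.
  assert (Ha : ex_series a).
  { apply ex_series_bound with b; auto. }
  rewrite (Series_incr_n a (S n)), (Series_incr_n b (S n)) by (auto; lia). simpl pred.
  rewrite !sum_n_Reals.
  match goal with |- Rabs (?s - (?s + ?x)) <= ?t + ?y - ?t =>
    replace (s - (s + x)) with (- x) by ring; replace (t + y - t) with y by ring end.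
  rewrite Rabs_Ropp. apply Series_Rabs_le; auto.
  apply (ex_series_incr_n b (S n)), Hb.
Qed.

Lemma CVU_dom_series (a : nat -> R -> R) (b : nat -> R) (D : R -> Prop) :
  (forall n x, D x -> Rabs (a n x) <= b n) -> ex_series b ->
  CVU_dom (fun n x => sum_n (fun k => a k x) n) D.
Proof.
  intros H Hb eps. destruct Hb as [l Hl].
  assert (Hb : ex_series b) by (exists l; auto).
  assert (Hl' : is_lim_seq (sum_n b) l) by exact Hl. apply is_lim_seq_spec in Hl'. destruct (Hl' eps) as [N HN].
  exists N. intros n Hn x Hx.
  change (Lim_seq (fun n0 => sum_n (fun k => a k x) n0)) with (Lim_seq (sum_n (fun k => a k x))).
  fold (Series (fun k => a k x)).
  eapply Rle_lt_trans. apply (Series_tail_le (fun k => a k x) b); auto.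
  rewrite (is_series_unique b l) by auto. specialize (HN n Hn). apply Rabs_def2 in HN. lra.
Qed.

Lemma continuous_sum_n (f : nat -> R -> R) (x : R) (n : nat) :
  (forall k, continuous (f k) x) -> continuous (fun y => sum_n (fun k => f k y) n) x.
Proof.
  intros H. induction n as [|n IH].
  - apply continuous_ext with (f O). intros y. now rewrite sum_O. apply H.
  - apply continuous_ext with (fun y => plus (sum_n (fun k => f k y) n) (f (S n) y)).
    intros y. now rewrite sum_Sn. apply (continuous_plus (V := R_NormedModule)); auto.
Qed.

Lemma Series_derive (a a' : nat -> R -> R) (b : nat -> R) (x d : R) : 0 < d ->
  (forall n y, Rabs (y - x) < d -> is_derive (a n) y (a' n y)) ->
  (forall n y, Rabs (y - x) < d -> continuous (a' n) y) ->
  (forall n y, Rabs (y - x) < d -> Rabs (a n y) <= b n) ->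
  (forall n y, Rabs (y - x) < d -> Rabs (a' n y) <= b n) ->
  ex_series b ->
  is_derive (fun y => Series (fun n => a n y)) x (Series (fun n => a' n x)).
Proof.
  intros Hd Hder Hcont Hb Hb' Hex.
  set (D := fun y => Rabs (y - x) < d).
  assert (Dopen : open D).
  { intros y Hy. assert (P : 0 < d - Rabs (y - x)) by (unfold D in Hy; lra).
    exists (mkposreal _ P). intros z Hz. change (Rabs (z - y) < d - Rabs (y - x)) in Hz.
    unfold D. replace (z - x) with ((z - y) + (y - x)) by ring.
    eapply Rle_lt_trans. apply Rabs_triang. lra. }
  assert (Dx : D x) by (unfold D; rewrite Rminus_diag, Rabs_R0; auto).
  assert (EqD : forall n y, D y -> Derive (fun z => sum_n (fun k => a k z) n) y = sum_n (fun k => a' k y) n).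
  { intros n y Hy. apply is_derive_unique, (is_derive_sum_n (K := R_AbsRing) (V := R_NormedModule) a). intros k _; apply Hder, Hy. }
  assert (K := CVU_Derive (fun n y => sum_n (fun k => a k y) n) D Dopen).
  assert (E : Lim_seq (fun n => Derive (fun y => sum_n (fun k => a k y) n) x) = Lim_seq (sum_n (fun k => a' k x))).
  { apply Lim_seq_ext. intros n. apply EqD, Dx. }
  unfold Series. rewrite <- E. apply K; auto.
  - intros p q y Hp Hq Hy. unfold D in *. apply Rabs_def2 in Hp, Hq. apply Rabs_def1; lra.
  - apply CVU_dom_series with b; auto.
  - intros n y Hy. exists (sum_n (fun k => a' k y) n).
    apply (is_derive_sum_n (K := R_AbsRing) (V := R_NormedModule) a). intros k _; apply Hder, Hy.
  - intros n y Hy. apply continuity_pt_filterlim.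
    apply (continuous_ext_loc _ (fun z => sum_n (fun k => a' k z) n)).
    + destruct (Dopen y Hy) as [e He]. exists e. intros z Hz. symmetry. apply EqD, He, Hz.
    + apply continuous_sum_n. intros k. apply Hcont, Hy.
  - intros eps. destruct (CVU_dom_series a' b D Hb' Hex eps) as [N HN]. exists N. intros n Hn y Hy.
    rewrite EqD by auto.
    rewrite (Lim_seq_ext (fun n0 => Derive (fun x0 => sum_n (fun k => a k x0) n0) y)
      (fun n0 => sum_n (fun k => a' k y) n0)) by (intros; apply EqD; auto).
    apply HN; auto.
Qed.

Lemma ZS_derive (f f' : Z -> R -> R) (K r x d : R) : 0 < d -> 0 < r ->
  (forall j y, Rabs (y - x) < d -> is_derive (f j) y (f' j y)) ->
  (forall j y, Rabs (y - x) < d -> continuous (f' j) y) ->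
  (forall j y, Rabs (y - x) < d -> Rabs (f j y) <= K * exp (- r * zabs j)) ->
  (forall j y, Rabs (y - x) < d -> Rabs (f' j y) <= K * exp (- r * zabs j)) ->
  is_derive (fun y => ZS (fun j => f j y)) x (ZS (fun j => f' j x)).
Proof.
  intros Hd Hr Hder Hcont Hb Hb'.
  assert (HK : 0 <= K).
  { specialize (Hb 0%Z x). simpl in Hb. rewrite Rmult_0_r, exp_0, Rminus_diag, Rabs_R0 in Hb.
    specialize (Hb Hd). pose proof (Rabs_pos (f 0%Z x)). lra. }
  assert (B : forall g : Z -> R -> R,
    (forall j y, Rabs (y - x) < d -> Rabs (g j y) <= K * exp (- r * zabs j)) ->
    forall n y, Rabs (y - x) < d ->
    Rabs (g (Z.of_nat n) y + g (-1 - Z.of_nat n)%Z y) <= (2 * K) * exp (- r * INR n)).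
  { intros g Hg n y Hy. eapply Rle_trans. apply Rabs_triang.
    pose proof (Hg (Z.of_nat n) y Hy) as H1. pose proof (Hg (-1 - Z.of_nat n)%Z y Hy) as H2.
    rewrite IZR_abs_nat in H1. rewrite IZR_abs_neg in H2.
    assert (K * exp (- r * (INR n + 1)) <= K * exp (- r * INR n)).
    { apply Rmult_le_compat_l; auto. apply exp_le. lra. }
    lra. }
  unfold ZS.
  apply (Series_derive (fun n y => f (Z.of_nat n) y + f (-1 - Z.of_nat n)%Z y)
    (fun n y => f' (Z.of_nat n) y + f' (-1 - Z.of_nat n)%Z y)
    (fun n => (2 * K) * exp (- r * INR n)) x d); auto.
  - intros n y Hy. apply is_derive_add; auto.
  - intros n y Hy. apply (continuous_plus (V := R_NormedModule)); auto.
  - apply ex_series_exp, Hr.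
Qed.

Lemma fr_abs2 (b j : Z) : 2 * zabs j <= Rabs (fr b j) + zabs b.
Proof.
  pose proof (fr_abs b j 1 ltac:(lra)) as H.
  replace (fr b j * 1) with (fr b j) in H by ring. lra.
Qed.

Lemma fr_abs3 (b j : Z) : Rabs (fr b j) <= 2 * zabs j + zabs b.
Proof.
  unfold fr. rewrite <- abs_IZR.
  assert (H : (Z.abs (2 * j + b) <= 2 * Z.abs j + Z.abs b)%Z) by lia.
  apply IZR_le in H. rewrite plus_IZR, mult_IZR in H. lra.
Qed.

Lemma LS_derive_t (gt gt' : R -> R -> R) (b : Z) (u : R -> R) (h t0 d s M : R) :
  0 < d -> 0 <= s < h -> hdec b u h ->
  (forall t x, Rabs (t - t0) < d -> is_derive (fun t => gt t x) t (gt' t x)) ->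
  (forall t x, Rabs (t - t0) < d -> continuous (fun t => gt' t x) t) ->
  (forall t x, Rabs (t - t0) < d -> Rabs (gt t x) <= M * exp (s * Rabs x)) ->
  (forall t x, Rabs (t - t0) < d -> Rabs (gt' t x) <= M * exp (s * Rabs x)) ->
  is_derive (fun t => LS (gt t) b u h) t0 (LS (gt' t0) b u h).
Proof.
  intros Hd Hs [K HK] Hder Hcont Hb Hb'. unfold LS.
  pose proof (dec_nonneg _ _ _ HK) as K0.
  assert (M0 : 0 <= M).
  { specialize (Hb t0 0). rewrite Rabs_R0, Rmult_0_r, exp_0, Rminus_diag, Rabs_R0 in Hb.
    specialize (Hb Hd). pose proof (Rabs_pos (gt t0 0)). lra. }
  assert (B : forall g : R -> R -> R,
    (forall t x, Rabs (t - t0) < d -> Rabs (g t x) <= M * exp (s * Rabs x)) ->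
    forall j t, Rabs (t - t0) < d -> Rabs (g t (fr b j) * u (fr b j * h))
      <= (M * K * exp (s * zabs b)) * exp (- (2 * h - 2 * s) * zabs j)).
  { intros g Hg j t Ht. rewrite Rabs_mult.
    apply Rle_trans with ((M * exp (s * Rabs (fr b j))) * (K * exp (- (2 * h) * zabs j))).
    apply Rmult_le_compat; auto using Rabs_pos.
    replace (M * exp (s * Rabs (fr b j)) * (K * exp (- (2 * h) * zabs j)))
      with (M * K * exp (s * Rabs (fr b j) + - (2 * h) * zabs j)) by (rewrite exp_plus; ring).
    rewrite (Rmult_assoc (M * K)), <- exp_plus. apply Rmult_le_compat_l. apply Rmult_le_pos; auto.
    apply exp_le. pose proof (fr_abs3 b j). nra. }
  apply (ZS_derive (fun j t => gt t (fr b j) * u (fr b j * h)) (fun j t => gt' t (fr b j) * u (fr b j * h))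
    (M * K * exp (s * zabs b)) (2 * h - 2 * s) t0 d); auto. lra.
  - intros j t Ht. specialize (Hder t (fr b j) Ht).
    apply is_derive_ext with (fun t => scal (u (fr b j * h)) (gt t (fr b j))).
    intros; unscal; ring.
    replace (gt' t (fr b j) * u (fr b j * h)) with (scal (u (fr b j * h)) (gt' t (fr b j)))
      by (unscal; ring).
    apply is_derive_cmult. auto.
  - intros j t Ht. apply (continuous_mult (fun t => gt' t (fr b j)) (fun _ => u (fr b j * h))).
    auto. apply continuous_const.
Qed.

Lemma tame_mult (u v : R -> R) : tame u ->
  (forall d, 0 < d -> exists M, 0 <= M /\ forall x, x = 0 \/ d <= Rabs x -> Rabs (v x) <= M) ->
  tame (fun x => v x * u x).
Proof.
  intros Hu Hv d Hd. destruct (Hu d Hd) as [K [HK H]], (Hv d Hd) as [M [HM H']].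
  exists (M * K). split. apply Rmult_le_pos; auto. intros x Hx.
  rewrite Rabs_mult, Rmult_assoc. apply Rmult_le_compat; auto using Rabs_pos.
Qed.

Lemma th_bound (x : R) : Rabs (th x) <= 1.
Proof.
  pose proof (cosh_pos x). pose proof (cosh_sq x). unfold th, Rdiv.
  rewrite Rabs_mult, Rabs_inv, (Rabs_pos_eq (cosh x)) by lra.
  apply Rmult_le_reg_r with (cosh x); auto. rewrite Rmult_assoc, Rinv_l by lra.
  rewrite Rmult_1_r, Rmult_1_l. apply Rabs_le. nra.
Qed.

Lemma sech_le1 (x : R) : Rabs (sech x) <= 1.
Proof.
  pose proof (cosh_pos x). pose proof (cosh_sq x). unfold sech.
  rewrite Rabs_inv, (Rabs_pos_eq (cosh x)) by lra.
  rewrite <- Rinv_1. apply Rinv_le_contravar. lra. nra.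
Qed.

Lemma coth_bound (d : R) : 0 < d -> exists M, 0 <= M /\ forall x, x = 0 \/ d <= Rabs x -> Rabs (coth x) <= M.
Proof.
  intros Hd. destruct (tame_csch d Hd) as [K [HK H]]. exists (1 + K * 1). split. lra. intros x Hx.
  rewrite coth_th. eapply Rle_trans. apply Rabs_triang. apply Rplus_le_compat. apply th_bound.
  rewrite Rabs_mult. apply Rmult_le_compat; auto using Rabs_pos, sech_le1.
  eapply Rle_trans. apply H, Hx. rewrite <- (Rmult_1_r K) at 2. apply Rmult_le_compat_l; auto.
  rewrite <- exp_0. apply exp_le. pose proof (Rabs_pos x). lra.
Qed.

Lemma tame_th_sech : tame (fun x => th x * sech x).
Proof. apply tame_mult. apply tame_sech. intros d Hd. exists 1. split. lra. intros; apply th_bound. Qed.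

Lemma tame_coth_csch : tame (fun x => coth x * csch x).
Proof. apply tame_mult. apply tame_csch. apply coth_bound. Qed.

Lemma tame_opp (u : R -> R) : tame u -> tame (fun x => - u x).
Proof.
  intros H d Hd. destruct (H d Hd) as [K [HK Hx]]. exists K. split; auto.
  intros. rewrite Rabs_Ropp. auto.
Qed.

(** The kernel may have a pole at 0, so the frequency 0 is treated apart: its term does not depend
    on h. For the other frequencies the condition |y - h| < h/2 keeps the argument at distance at
    least h/2 from 0, where [tame] gives a uniform bound. *)
Lemma LS_derive_h (g u w : R -> R) (b : Z) (h : R) : 0 < h -> (forall s, 0 < s -> gr s g) ->
  tame u -> tame w -> (forall x, x <> 0 -> is_derive u x (w x)) ->
  (forall x, x <> 0 -> continuous w x) ->
  is_derive (fun h => LS g b u h) h (LS (fun x => x * g x) b w h).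
Proof.
  intros Hh Hg Hu Hw Hder Hcont.
  destruct (Hu (h / 2) ltac:(lra)) as [Ku [Ku0 HKu]].
  destruct (Hw (h / 2) ltac:(lra)) as [Kw [Kw0 HKw]].
  destruct (Hg (h / 4) ltac:(lra)) as [M HM].
  assert (Hg' : gr (h / 4) (fun x => x * g x)).
  { replace (h / 4) with (h / 8 + h / 8) by field.
    destruct (gr_mult (h / 8) (h / 8) (fun x => x ^ 1) g (gr_pow 1 (h / 8) ltac:(lra)) (Hg (h / 8) ltac:(lra))) as [N HN].
    exists N. intros x. rewrite <- (pow_1 x) at 1. apply HN. }
  destruct Hg' as [N HN].
  assert (B : forall (k v : R -> R) (C A : R), 0 <= A -> (forall x, Rabs (k x) <= C * exp (h / 4 * Rabs x)) ->
    (forall x, x = 0 \/ h / 2 <= Rabs x -> Rabs (v x) <= A * exp (- Rabs x)) ->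
    forall j y, Rabs (y - h) < h / 2 -> Rabs (k (fr b j) * v (fr b j * y))
      <= (C * A * exp (h / 4 * zabs b)) * exp (- (h / 2) * zabs j)).
  { intros k v C A A0 Hk Hv j y Hy. apply Rabs_def2 in Hy.
    assert (C0 : 0 <= C).
    { specialize (Hk 0). rewrite Rabs_R0, Rmult_0_r, exp_0 in Hk. pose proof (Rabs_pos (k 0)). lra. }
    rewrite Rabs_mult.
    apply Rle_trans with ((C * exp (h / 4 * Rabs (fr b j))) * (A * exp (- Rabs (fr b j * y)))).
    { apply Rmult_le_compat; auto using Rabs_pos. apply Hv.
      destruct (fr_cases b j y ltac:(lra)) as [[_ E]|[_ E]]; auto. right; lra. }
    replace (C * exp (h / 4 * Rabs (fr b j)) * (A * exp (- Rabs (fr b j * y))))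
      with (C * A * exp (h / 4 * Rabs (fr b j) + - Rabs (fr b j * y))) by (rewrite exp_plus; ring).
    rewrite (Rmult_assoc (C * A)), <- exp_plus. apply Rmult_le_compat_l. apply Rmult_le_pos; auto.
    (* Growth h/4 against decay y > h/2 leaves the exponent -(h/4)|x| at frequency x, which is at
       most -(h/2)|j| + (h/4)|b|. *)
    apply exp_le. rewrite Rabs_mult, (Rabs_pos_eq y) by lra. pose proof (fr_abs2 b j).
    pose proof (Rabs_pos (fr b j)). nra. }
  set (c1 := M * Ku * exp (h / 4 * zabs b)). set (c2 := N * Kw * exp (h / 4 * zabs b)).
  unfold LS.
  assert (Nz : forall j y, Rabs (y - h) < h / 2 -> fr b j * y = 0 -> fr b j = 0).
  { intros j y Hy E. apply Rabs_def2 in Hy. apply Rmult_integral in E. destruct E; auto. lra. }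
  apply (ZS_derive (fun j y => g (fr b j) * u (fr b j * y)) (fun j y => fr b j * g (fr b j) * w (fr b j * y))
    (Rmax c1 c2) (h / 2) h (h / 2)); try lra.
  - intros j y Hy. destruct (Req_dec (fr b j * y) 0) as [E|E].
    + rewrite (Nz j y Hy E). apply is_derive_ext with (fun _ : R => g 0 * u 0).
      intros; f_equal; f_equal. simpl. ring.
      replace (0 * g 0 * w (0 * y)) with 0 by ring. apply is_derive_cst.
    + specialize (Hder _ E).
      replace (fr b j * g (fr b j) * w (fr b j * y)) with (g (fr b j) * (fr b j * w (fr b j * y))) by ring.
      apply is_derive_cmult.
      apply (is_derive_chain u (fun y => fr b j * y)); auto.
      auto_derive; auto. ring.
  - intros j y Hy. destruct (Req_dec (fr b j * y) 0) as [E|E].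
    + rewrite (Nz j y Hy E). apply continuous_ext with (fun _ : R => 0).
      intros; simpl; ring. apply continuous_const.
    + apply (continuous_mult (fun _ => fr b j * g (fr b j)) (fun y => w (fr b j * y))).
      apply continuous_const. apply (continuous_comp (fun y => fr b j * y) w).
      apply (continuous_mult (fun _ => fr b j) (fun y => y)). apply continuous_const. apply continuous_id.
      apply Hcont, E.
  - intros j y Hy. eapply Rle_trans. apply (B g u M Ku); auto.
    apply Rmult_le_compat_r. apply exp_ge0. apply Rmax_l.
  - intros j y Hy. eapply Rle_trans. apply (B (fun x => x * g x) w N Kw); auto.
    apply Rmult_le_compat_r. apply exp_ge0. apply Rmax_r.
Qed.

Lemma is_derive_cosh (x : R) : is_derive cosh x (sinh x).
Proof. apply is_derive_Reals, derivable_pt_lim_cosh. Qed.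
Lemma is_derive_sinh (x : R) : is_derive sinh x (cosh x).
Proof. apply is_derive_Reals, derivable_pt_lim_sinh. Qed.

Lemma is_derive_sech (x : R) : is_derive sech x (- (th x * sech x)).
Proof.
  pose proof (cosh_pos x). unfold sech, th.
  replace (- (sinh x / cosh x * / cosh x)) with (- sinh x / cosh x ^ 2) by (field; lra).
  apply is_derive_inv. apply is_derive_cosh. lra.
Qed.

Lemma is_derive_csch (x : R) : x <> 0 -> is_derive csch x (- (coth x * csch x)).
Proof.
  intros H. apply sinh_neq0 in H. unfold csch, coth.
  replace (- (cosh x / sinh x * / sinh x)) with (- cosh x / sinh x ^ 2) by (field; lra).
  apply is_derive_inv. apply is_derive_sinh. lra.
Qed.

Lemma is_derive_th (x : R) : is_derive th x (1 - th x ^ 2).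
Proof.
  pose proof (cosh_pos x). unfold th.
  replace (1 - (sinh x / cosh x) ^ 2) with ((cosh x * cosh x - sinh x * sinh x) / cosh x ^ 2) by (field; lra).
  apply is_derive_div. apply is_derive_sinh. apply is_derive_cosh. lra.
Qed.

Lemma ex_derive_cosh (x : R) : ex_derive cosh x.
Proof. eexists; apply is_derive_cosh. Qed.
Lemma ex_derive_sinh (x : R) : ex_derive sinh x.
Proof. eexists; apply is_derive_sinh. Qed.
Lemma ex_derive_sech (x : R) : ex_derive sech x.
Proof. eexists; apply is_derive_sech. Qed.
Lemma ex_derive_th (x : R) : ex_derive th x.
Proof. eexists; apply is_derive_th. Qed.

Lemma continuous_coth_csch (x : R) : x <> 0 -> continuous (fun x => - (coth x * csch x)) x.
Proof.
  intros H. assert (H' := sinh_neq0 x H). apply ex_derive_cont.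
  apply ex_derive_ext with (fun x => - (cosh x * / sinh x * / sinh x)). reflexivity.
  auto_derive. repeat split; auto using ex_derive_cosh, ex_derive_sinh.
Qed.

(** A product of two series over odd frequencies lands on [fr 2], which lists the same even integers
    as [fr 0]. *)
Lemma ZS_ext_fr2 (r : R) (f : R -> R) : 0 < r -> dec r (fun j => f (fr 0 j)) ->
  ZS (fun n => f (fr 2 n)) = ZS (fun n => f (fr 0 n)).
Proof.
  intros Hr Hf. rewrite <- (ZS_shift r _ 1 Hr Hf). apply ZS_ext. intros n. f_equal.
  unfold fr. f_equal. lia.
Qed.

(** * Product and moment identities between Lambert series *)

Section Identities.

Variable h : R.
Hypothesis Hh : 0 < h.

Let Dse : forall b, hdec b sech h.
Proof. intros; apply sech_dec, Hh. Qed.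
Let Dcs : forall b, hdec b csch h.
Proof. intros; apply csch_dec, Hh. Qed.

Lemma LS_fr2 (s : R) (g u : R -> R) : 0 <= s < h -> gr s g -> hdec 0 u h ->
  LS g 2 u h = LS g 0 u h.
Proof.
  intros Hs Hg Hu. apply (ZS_ext_fr2 (2 * h - 2 * s) (fun x => g x * u (x * h))). lra.
  apply LS_dec; auto. lra.
Qed.

(* With nome q = e^(-2h), these are the Fourier series of (2K/pi) dn, (2K/pi) k sn and (2K/pi) k cn
   at 2Kt/pi; the versions with exp instead of cos and sin are their values at imaginary arguments
   (up to a factor i for sn). In terms of theta constants, [cc = theta_2^2] and
   [zz = theta_3^2 = 2K/pi]. *)
Definition Fdn (t h : R) : R := LS (fun x => cos (t * x)) 0 sech h.
Definition Fsn (t h : R) : R := LS (fun x => sin (t * x)) 1 csch h.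
Definition Fcn (t h : R) : R := LS (fun x => cos (t * x)) 1 sech h.
Definition Hdn (t h : R) : R := LS (fun x => exp (t * x)) 0 sech h.
Definition Hsn (t h : R) : R := LS (fun x => exp (t * x)) 1 csch h.
Definition Hcn (t h : R) : R := LS (fun x => exp (t * x)) 1 sech h.
Definition cc (h : R) : R := LS (fun _ => 1) 1 sech h.
Definition zz (h : R) : R := LS (fun _ => 1) 0 sech h.
Definition ee (h : R) : R := LS (fun x => x) 0 csch h.

Lemma gr_xmult (s s' : R) (g : R -> R) : 0 < s' -> gr s g -> gr (s' + s) (fun x => x * g x).
Proof.
  intros Hs Hg. destruct (gr_mult s' s (fun x => x ^ 1) g (gr_pow 1 s' Hs) Hg) as [M HM].
  exists M. intros x. rewrite <- (pow_1 x) at 1. apply HM.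
Qed.

Lemma LS_sin_sech (b : Z) (t : R) : LS (fun x => sin (t * x)) b sech h = 0.
Proof.
  apply (LS_parity 0); auto. lra. apply gr_sin; lra.
  intros x. rewrite sech_neg, <- Ropp_mult_distr_r, sin_neg. ring.
Qed.

Lemma LS_cos_mult_sech (b c : Z) (u : R -> R) (t : R) : hdec b u h ->
  LS (fun x => cos (t * x)) b u h * LS (fun x => cos (t * x)) c sech h
  = ZS (fun n => cos (t * fr (b + c) n) * conv b c u sech h n).
Proof.
  intros Hu. rewrite <- (LS_prod2 0 h b c u sech (fun x => cos (t * x)) (fun x => cos (t * x)) (fun x => cos (t * x))
    (fun x => - sin (t * x)) (fun x => sin (t * x))); auto using gr_cos, gr_sin, gr_opp, Rle_refl.
  - rewrite LS_sin_sech. ring.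
  - intros x y. rewrite Rmult_plus_distr_l, cos_plus. ring.
Qed.

Lemma LS_sin_mult_sech (b c : Z) (u : R -> R) (t : R) : hdec b u h ->
  LS (fun x => sin (t * x)) b u h * LS (fun x => cos (t * x)) c sech h
  = ZS (fun n => sin (t * fr (b + c) n) * conv b c u sech h n).
Proof.
  intros Hu. rewrite <- (LS_prod2 0 h b c u sech (fun x => sin (t * x)) (fun x => sin (t * x)) (fun x => cos (t * x))
    (fun x => cos (t * x)) (fun x => sin (t * x))); auto using gr_cos, gr_sin, Rle_refl.
  - rewrite LS_sin_sech. ring.
  - intros x y. rewrite Rmult_plus_distr_l, sin_plus. ring.
Qed.

Lemma Fcn_Fdn (t : R) : Fcn t h * Fdn t h = LS (fun x => x * cos (t * x)) 1 csch h.
Proof.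
  unfold Fcn, Fdn. rewrite LS_cos_mult_sech by auto. apply ZS_ext. intros n.
  rewrite conv_sech; auto; try lia. change (1 + 0)%Z with 1%Z. ring.
Qed.

Lemma Fsn_Fdn (t : R) : Fsn t h * Fdn t h = LS (fun x => x * sin (t * x)) 1 sech h.
Proof.
  unfold Fsn, Fdn. rewrite LS_sin_mult_sech by auto. apply ZS_ext. intros n.
  rewrite conv_csch_sech1 by auto. change (1 + 0)%Z with 1%Z. ring.
Qed.

Lemma Fsn_Fcn (t : R) : Fsn t h * Fcn t h = LS (fun x => x * sin (t * x)) 0 sech h.
Proof.
  unfold Fsn, Fcn. rewrite LS_sin_mult_sech by auto.
  rewrite <- (LS_fr2 (h / 2 + 0)); auto. 2: lra. 2: apply gr_xmult; [|apply gr_sin]; lra.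
  apply ZS_ext. intros n. rewrite conv_csch_sech1 by auto. change (1 + 1)%Z with 2%Z. ring.
Qed.

Lemma LS_prod1 (s : R) (b c : Z) (u v g : R -> R) : 0 <= s < h ->
  hdec b u h -> hdec c v h ->
  gr s g -> (forall x y, g (x + y) = g x * g y) ->
  LS g b u h * LS g c v h = ZS (fun n => g (fr (b + c) n) * conv b c u v h n).
Proof.
  intros Hs Hu Hv Hg Hadd.
  rewrite <- (LS_prod2 s h b c u v g g g (fun _ => 0) (fun _ => 0)); auto; try (apply gr_const; lra).
  - assert (E : LS (fun _ => 0) b u h = 0).
    { unfold LS. rewrite (ZS_ext _ (fun _ => 0)) by (intros; ring). apply ZS_zero. }
    rewrite E. ring.
  - intros. rewrite Hadd. ring.
Qed.

Section Mult.
Variables (s : R) (g : R -> R).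
Hypotheses (Hs : 0 <= s < h) (Hg : gr s g) (Hadd : forall x y, g (x + y) = g x * g y).

(** The multiplicative weights to be used are exp (t x) and the constant 1. Their addition formula
    has a single term, so the products need no parity argument. *)
Lemma mult_cn_dn : LS g 1 sech h * LS g 0 sech h = LS (fun x => x * g x) 1 csch h.
Proof.
  rewrite (LS_prod1 s); auto. apply ZS_ext. intros n. rewrite conv_sech; auto; try lia.
  change (1 + 0)%Z with 1%Z. ring.
Qed.

Lemma mult_sn_dn : LS g 1 csch h * LS g 0 sech h = LS (fun x => x * g x) 1 sech h.
Proof.
  rewrite (LS_prod1 s); auto. apply ZS_ext. intros n. rewrite conv_csch_sech1; auto; try lia.
  change (1 + 0)%Z with 1%Z. ring.
Qed.

Lemma mult_sn_cn : LS g 1 csch h * LS g 1 sech h = LS (fun x => x * g x) 0 sech h.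
Proof.
  rewrite (LS_prod1 s); auto. rewrite <- (LS_fr2 ((h - s) / 2 + s)); auto. 2: lra. 2: apply gr_xmult; auto; lra.
  apply ZS_ext. intros n. rewrite conv_csch_sech1; auto; try lia.
  change (1 + 1)%Z with 2%Z. ring.
Qed.
End Mult.

(** The moments are the derivatives at t = 0 of the series with weight exp (t x), so products of
    them obey Leibniz rules. *)
Definition LP (k : nat) (b : Z) (u : R -> R) (h : R) : R := LS (fun x => x ^ k) b u h.

Let Gp : forall k, gr (h / 2) (fun x => x ^ k).
Proof. intros k. apply gr_pow. lra. Qed.

Lemma cc_zz : cc h * zz h = LP 1 1 csch h.
Proof.
  unfold cc, zz. rewrite (mult_cn_dn 0); try lra.
  - apply LS_ext. intros j. ring.
  - apply gr_const. lra.
  - intros; ring.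
Qed.

Lemma LP_prod_first (b c : Z) (u v : R -> R) :
  hdec b u h -> hdec c v h ->
  LP 1 b u h * LP 0 c v h + LP 0 b u h * LP 1 c v h
  = ZS (fun n => fr (b + c) n * conv b c u v h n).
Proof.
  intros Hu Hv. unfold LP.
  rewrite (LS_prod2 (h / 2) h b c u v (fun x => x ^ 1) (fun x => x ^ 1) (fun x => x ^ 0)
    (fun x => x ^ 0) (fun x => x ^ 1)); auto. 2: lra.
  apply ZS_ext. intros n. ring. intros; ring.
Qed.

Lemma LP_prod_second (b c : Z) (u v : R -> R) :
  hdec b u h -> hdec c v h ->
  LP 2 b u h * LP 0 c v h + 2 * LP 1 b u h * LP 1 c v h + LP 0 b u h * LP 2 c v h
  = ZS (fun n => fr (b + c) n ^ 2 * conv b c u v h n).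
Proof.
  intros Hu Hv.
  rewrite <- (LS_prod3 (h / 2) h b c u v (fun x => x ^ 2) (fun x => x ^ 2) (fun x => x ^ 0)
    (fun x => 2 * x ^ 1) (fun x => x ^ 1) (fun x => x ^ 0) (fun x => x ^ 2)); auto.
  - assert (E : LS (fun x => 2 * x ^ 1) b u h = 2 * LS (fun x => x ^ 1) b u h).
    { unfold LS. rewrite <- ZS_scal. apply ZS_ext. intros; ring. }
    rewrite E. reflexivity.
  - lra.
  - apply gr_scal; auto.
  - intros; ring.
Qed.

Lemma LP_parity (k : nat) (b : Z) (u : R -> R) : hdec b u h ->
  (forall x, (- x) ^ k * u (- (x * h)) = - (x ^ k * u (x * h))) -> LP k b u h = 0.
Proof. intros Hu H. apply (LS_parity (h / 2)); auto. lra. Qed.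

Lemma LP_zz : LP 0 0 sech h = zz h.
Proof. apply LS_ext. intros; ring. Qed.
Lemma LP_cc : LP 0 1 sech h = cc h.
Proof. apply LS_ext. intros; ring. Qed.
Lemma LP_ee : LP 1 0 csch h = ee h.
Proof. apply LS_ext. intros; ring. Qed.

Lemma LP0_csch (b : Z) : LP 0 b csch h = 0.
Proof. apply LP_parity; auto. intros. rewrite csch_neg. ring. Qed.
Lemma LP1_sech (b : Z) : LP 1 b sech h = 0.
Proof. apply LP_parity; auto. intros. rewrite sech_neg. ring. Qed.

(** The first moment of csch times sech: parity kills one Leibniz term, the other is (cc zz) zz by
    [cc_zz], and the convolution supplies one more factor x. *)
Lemma LP2_sech1 : LP 2 1 sech h = cc h * zz h ^ 2.
Proof.
  assert (E := LP_prod_first 1 0 csch sech (Dcs 1) (Dse 0)).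
  rewrite LP0_csch, LP_zz, <- cc_zz in E.
  replace (cc h * zz h ^ 2) with (cc h * zz h * zz h + 0 * LP 1 0 sech h) by ring. rewrite E.
  apply ZS_ext. intros n. rewrite conv_csch_sech1 by auto. change (1 + 0)%Z with 1%Z. ring.
Qed.

Lemma LP2_sech0 : LP 2 0 sech h = cc h ^ 2 * zz h.
Proof.
  assert (E := LP_prod_first 1 1 csch sech (Dcs 1) (Dse 1)).
  rewrite LP0_csch, LP_cc, <- cc_zz in E.
  replace (cc h ^ 2 * zz h) with (cc h * zz h * cc h + 0 * LP 1 1 sech h) by ring. rewrite E.
  unfold LP. rewrite <- (LS_fr2 (h / 2)); auto. 2: lra.
  apply ZS_ext. intros n. rewrite conv_csch_sech1 by auto. change (1 + 1)%Z with 2%Z. ring.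
Qed.

(** The missing frequency 0 of [csch] turns to advantage: the defect term in [conv_csch_sech0] is,
    up to sign, the derivative of [sech], so the first moment of the convolution evaluates the
    derivative in h of a [sech] series. *)
Lemma LP_csch_sech (c : Z) : (c = 0 \/ c = 1)%Z ->
  LP 1 c (fun x => th x * sech x) h = LP 2 c sech h - ee h * LP 0 c sech h.
Proof.
  intros Hc.
  assert (E := LP_prod_first 0 c csch sech (Dcs 0) (Dse c)).
  rewrite LP0_csch, LP_ee, Rmult_0_l, Rplus_0_r in E. rewrite E.
  assert (D1 : forall k (u : R -> R), tame u -> dec h (fun j => fr c j ^ k * u (fr c j * h))).
  { intros k u Hu. replace h with (2 * h - 2 * (h / 2)) at 1 by field.
    apply (LS_dec _ (fun x => x ^ k)); auto. lra. apply tame_dec; auto. }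
  unfold LP, LS. rewrite Z.add_0_l.
  rewrite (ZS_ext (fun n => fr c n * conv 0 c csch sech h n)
    (fun n => fr c n ^ 2 * sech (fr c n * h) - fr c n ^ 1 * (th (fr c n * h) * sech (fr c n * h)))).
  - rewrite (ZS_minus h); auto. ring. apply D1, tame_sech.
    apply (D1 1%nat (fun x => th x * sech x)), tame_th_sech.
  - intros n. rewrite conv_csch_sech0 by auto. ring.
Qed.

Lemma LP3_csch : LP 3 0 csch h = 2 * cc h ^ 2 * zz h ^ 2.
Proof.
  assert (E := LP_prod_second 0 0 sech sech (Dse 0) (Dse 0)).
  rewrite LP1_sech, LP_zz, LP2_sech0 in E.
  transitivity (cc h ^ 2 * zz h * zz h + 2 * 0 * 0 + zz h * (cc h ^ 2 * zz h)). 2: ring.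
  rewrite E. apply ZS_ext. intros n. change (0 + 0)%Z with 0%Z.
  (* At n = 0 the formula [conv_sech] does not apply, but the weight x^2 vanishes there. *)
  destruct (Z.eq_dec n 0) as [->|Hn].
  - unfold fr. simpl. ring.
  - rewrite conv_sech by (auto; lia). change (0 + 0)%Z with 0%Z. ring.
Qed.

(** The second moment of csch times csch is 2 ee^2. In its convolution the main term is the sum of
    [LP3_csch], and the defect of [conv_csch0] is twice the sum wanted. *)
Lemma LP2_coth_csch : LP 2 0 (fun x => coth x * csch x) h = cc h ^ 2 * zz h ^ 2 - ee h ^ 2.
Proof.
  assert (E := LP_prod_second 0 0 csch csch (Dcs 0) (Dcs 0)).
  rewrite LP0_csch, LP_ee in E.
  assert (E2 : 2 * LP 2 0 (fun x => coth x * csch x) h = LP 3 0 csch h - 2 * ee h ^ 2).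
  2: { rewrite LP3_csch in E2. lra. }
  replace (2 * ee h ^ 2) with (LP 2 0 csch h * 0 + 2 * ee h * ee h + 0 * LP 2 0 csch h) by ring.
  rewrite E. unfold LP, LS. rewrite <- ZS_scal.
  assert (D1 : dec h (fun j => fr 0 j ^ 3 * csch (fr 0 j * h))).
  { replace h with (2 * h - 2 * (h / 2)) at 1 by field. apply (LS_dec _ (fun x => x ^ 3)); auto. lra. }
  assert (D2 : dec h (fun j => fr 0 j ^ 2 * (coth (fr 0 j * h) * csch (fr 0 j * h)))).
  { replace h with (2 * h - 2 * (h / 2)) at 1 by field.
    apply (LS_dec _ (fun x => x ^ 2) 0 (fun x => coth x * csch x)); auto. lra.
    apply (tame_dec _ 0 h Hh tame_coth_csch). }
  assert (Eq : forall j, fr (0 + 0) j ^ 2 * conv 0 0 csch csch h j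
    = fr 0 j ^ 3 * csch (fr 0 j * h) - 2 * (fr 0 j ^ 2 * (coth (fr 0 j * h) * csch (fr 0 j * h)))).
  { intros n. change (0 + 0)%Z with 0%Z. destruct (Z.eq_dec n 0) as [->|Hn].
    - unfold fr. simpl. ring.
    - rewrite conv_csch0 by auto. ring. }
  rewrite (ZS_ext _ _ Eq).
  rewrite (ZS_minus h); auto using dec_scal. rewrite !ZS_scal. ring.
Qed.

End Identities.

(** * Differential equations in t and in h *)

Lemma gr_one (s : R) : 0 < s -> gr s (fun _ => 1).
Proof. intros. apply gr_const. lra. Qed.

Lemma gr_id (s : R) : 0 < s -> gr s (fun x => x).
Proof.
  intros Hs. destruct (gr_pow 1 s Hs) as [M HM]. exists M. intros x. rewrite <- (pow_1 x) at 1. apply HM.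
Qed.

Lemma LS_neg (g g' : R -> R) (b : Z) (u v : R -> R) (h : R) :
  (forall x, g x * u (x * h) = - (g' x * v (x * h))) -> LS g b u h = - LS g' b v h.
Proof.
  intros H. unfold LS. rewrite (ZS_ext _ (fun j => -1 * (g' (fr b j) * v (fr b j * h)))).
  rewrite ZS_scal. ring. intros j. rewrite H. ring.
Qed.

Lemma is_derive_LS_sech (g : R -> R) (b : Z) (h : R) : 0 < h -> (forall s, 0 < s -> gr s g) ->
  is_derive (LS g b sech) h (- LS (fun x => x * g x) b (fun x => th x * sech x) h).
Proof.
  intros Hh Hg.
  rewrite <- (LS_neg (fun x => x * g x) (fun x => x * g x) b (fun x => - (th x * sech x))) by (intros; ring).
  apply (LS_derive_h g sech (fun x => - (th x * sech x))); auto.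
  apply tame_sech. apply tame_opp, tame_th_sech.
  intros x _. apply is_derive_sech.
  intros x _. apply ex_derive_cont.
  auto_derive. repeat split; auto using ex_derive_th, ex_derive_sech.
Qed.

(** Together with [is_derive_zz] and [is_derive_ee] this is a closed differential system, the
    analogue for theta constants of Ramanujan's system for Eisenstein series. *)
Lemma is_derive_cc (h : R) : 0 < h -> is_derive cc h (cc h * (ee h - zz h ^ 2)).
Proof.
  intros Hh.
  replace (cc h * (ee h - zz h ^ 2)) with (- LS (fun x => x * 1) 1 (fun x => th x * sech x) h).
  - apply (is_derive_LS_sech (fun _ => 1)); auto. intros; apply gr_one; auto.
  - change (- LP 1 1 (fun x => th x * sech x) h = cc h * (ee h - zz h ^ 2)).
    rewrite LP_csch_sech, LP2_sech1 by auto.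
    change (LP 0 1 sech h) with (cc h). ring.
Qed.

Lemma is_derive_zz (h : R) : 0 < h -> is_derive zz h (zz h * (ee h - cc h ^ 2)).
Proof.
  intros Hh.
  replace (zz h * (ee h - cc h ^ 2)) with (- LS (fun x => x * 1) 0 (fun x => th x * sech x) h).
  - apply (is_derive_LS_sech (fun _ => 1)); auto. intros; apply gr_one; auto.
  - change (- LP 1 0 (fun x => th x * sech x) h = zz h * (ee h - cc h ^ 2)).
    rewrite LP_csch_sech, LP2_sech0 by auto.
    change (LP 0 0 sech h) with (zz h). ring.
Qed.

Lemma is_derive_ee (h : R) : 0 < h -> is_derive ee h (ee h ^ 2 - cc h ^ 2 * zz h ^ 2).
Proof.
  intros Hh.
  replace (ee h ^ 2 - cc h ^ 2 * zz h ^ 2) with (LS (fun x => x * x) 0 (fun x => - (coth x * csch x)) h).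
  - apply (LS_derive_h (fun x => x) csch (fun x => - (coth x * csch x))); auto.
    apply gr_id. apply tame_csch. apply tame_opp, tame_coth_csch.
    apply is_derive_csch. apply continuous_coth_csch.
  - rewrite (LS_neg (fun x => x * x) (fun x => x ^ 2) 0 _ (fun x => coth x * csch x)) by (intros; ring).
    fold (LP 2 0 (fun x => coth x * csch x) h). rewrite LP2_coth_csch by auto. ring.
Qed.

Lemma gr_id_bound (s : R) : 0 < s -> exists M, 1 <= M /\ forall x, Rabs x <= M * exp (s * Rabs x).
Proof.
  intros Hs. destruct (gr_id s Hs) as [M HM]. exists (Rmax 1 M). split. apply Rmax_l.
  intros x. eapply Rle_trans. apply HM. apply Rmult_le_compat_r. apply exp_ge0. apply Rmax_r.
Qed.

Lemma le_exp_mult (M s x : R) : 1 <= M -> 0 <= s -> 1 <= M * exp (s * Rabs x).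
Proof.
  intros HM Hs. assert (1 <= exp (s * Rabs x)).
  { rewrite <- exp_0 at 1. apply exp_le. apply Rmult_le_pos; auto. apply Rabs_pos. }
  nra.
Qed.

(** Differentiation only raises [k] and adds pi/2 to the phase [p], so all higher derivatives keep
    this shape; the offset [a] accommodates the shift by a quarter period. *)
Lemma is_derive_LS_trig (k : nat) (a p : R) (b : Z) (u : R -> R) (h t : R) : 0 < h ->
  hdec b u h ->
  is_derive (fun t => LS (fun x => x ^ k * cos (a * x + t * x + p)) b u h) t
    (LS (fun x => x ^ S k * cos (a * x + t * x + (p + PI / 2))) b u h).
Proof.
  intros Hh Hu.
  destruct (gr_pow k (h / 2) ltac:(lra)) as [M1 H1]. destruct (gr_pow (S k) (h / 2) ltac:(lra)) as [M2 H2].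
  apply (LS_derive_t (fun t x => x ^ k * cos (a * x + t * x + p))
    (fun t x => x ^ S k * cos (a * x + t * x + (p + PI / 2))) b u h t 1 (h / 2) (Rmax M1 M2)); auto; try lra.
  - intros t' x _. auto_derive; auto.
    replace (a * x + t' * x + (p + PI / 2)) with (PI / 2 + (a * x + t' * x + p)) by ring.
    rewrite cos_plus, cos_PI2, sin_PI2. simpl. ring.
  - intros t' x _. apply ex_derive_cont. auto_derive; auto.
  - intros t' x _. rewrite Rabs_mult. rewrite <- (Rmult_1_r (Rmax M1 M2 * _)).
    apply Rmult_le_compat; auto using Rabs_pos. 2: apply Rabs_le, COS_bound.
    eapply Rle_trans. apply H1. apply Rmult_le_compat_r. apply exp_ge0. apply Rmax_l.
  - intros t' x _. rewrite Rabs_mult. rewrite <- (Rmult_1_r (Rmax M1 M2 * _)).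
    apply Rmult_le_compat; auto using Rabs_pos. 2: apply Rabs_le, COS_bound.
    eapply Rle_trans. apply H2. apply Rmult_le_compat_r. apply exp_ge0. apply Rmax_r.
Qed.

Lemma is_derive_LS_cos (b : Z) (u : R -> R) (h t : R) : 0 < h ->
  hdec b u h ->
  is_derive (fun t => LS (fun x => cos (t * x)) b u h) t (- LS (fun x => x * sin (t * x)) b u h).
Proof.
  intros Hh Hu.
  rewrite <- (LS_neg (fun x => x ^ 1 * cos (0 * x + t * x + (0 + PI / 2))) (fun x => x * sin (t * x)) b u u).
  - apply is_derive_ext with (fun t => LS (fun x => x ^ 0 * cos (0 * x + t * x + 0)) b u h).
    intros t'. apply LS_ext. intros j. f_equal. simpl.
    replace (0 * fr b j + t' * fr b j + 0) with (t' * fr b j) by ring. ring.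
    apply (is_derive_LS_trig 0 0 0); auto.
  - intros x. replace (0 * x + t * x + (0 + PI / 2)) with (PI / 2 + t * x) by ring.
    rewrite cos_plus, cos_PI2, sin_PI2. ring.
Qed.

Lemma is_derive_LS_sin (b : Z) (u : R -> R) (h t : R) : 0 < h ->
  hdec b u h ->
  is_derive (fun t => LS (fun x => sin (t * x)) b u h) t (LS (fun x => x * cos (t * x)) b u h).
Proof.
  intros Hh Hu.
  rewrite (LS_ext (fun x => x * cos (t * x)) (fun x => x ^ 1 * cos (0 * x + t * x + (- (PI / 2) + PI / 2))) b u u).
  - apply is_derive_ext with (fun t => LS (fun x => x ^ 0 * cos (0 * x + t * x + - (PI / 2))) b u h).
    intros t'. apply LS_ext. intros j. f_equal. simpl.
    replace (0 * fr b j + t' * fr b j + - (PI / 2)) with (t' * fr b j - PI / 2) by ring.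
    rewrite cos_minus, cos_PI2, sin_PI2. ring.
    apply (is_derive_LS_trig 0 0 (- (PI / 2))); auto.
  - intros j. replace (0 * fr b j + t * fr b j + (- (PI / 2) + PI / 2)) with (t * fr b j) by ring. ring.
Qed.

Lemma is_derive_LS_exp (b : Z) (u : R -> R) (h t : R) : Rabs t < h ->
  hdec b u h ->
  is_derive (fun t => LS (fun x => exp (t * x)) b u h) t (LS (fun x => x * exp (t * x)) b u h).
Proof.
  intros Ht Hu. pose proof (Rabs_pos t).
  (* A quarter of the distance to the edge of the strip: one [d] for moving t, one for absorbing the
     factor x, and still |t| + 2d < h. *)
  set (d := (h - Rabs t) / 4).
  destruct (gr_id_bound d ltac:(unfold d; lra)) as [M [HM HM']].
  assert (B : forall t' x, Rabs (t' - t) < d -> exp (t' * x) <= exp ((Rabs t + d) * Rabs x)).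
  { intros t' x Ht'. apply exp_le. eapply Rle_trans. apply Rle_abs. rewrite Rabs_mult.
    apply Rmult_le_compat_r. apply Rabs_pos.
    replace t' with (t + (t' - t)) by ring. eapply Rle_trans. apply Rabs_triang. lra. }
  apply (LS_derive_t (fun t x => exp (t * x)) (fun t x => x * exp (t * x)) b u h t d (Rabs t + 2 * d) M);
    auto; try (unfold d; lra).
  - intros t' x _. auto_derive; auto. ring.
  - intros t' x _. apply ex_derive_cont. auto_derive; auto.
  - intros t' x Ht'. rewrite Rabs_pos_eq by apply exp_ge0. eapply Rle_trans. apply B; auto.
    replace ((Rabs t + 2 * d) * Rabs x) with ((Rabs t + d) * Rabs x + d * Rabs x) by ring.
    rewrite exp_plus. pose proof (exp_pos ((Rabs t + d) * Rabs x)).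
    pose proof (le_exp_mult M d x HM ltac:(unfold d; lra)). nra.
  - intros t' x Ht'. rewrite Rabs_mult, (Rabs_pos_eq (exp _)) by apply exp_ge0.
    replace (M * exp ((Rabs t + 2 * d) * Rabs x)) with ((M * exp (d * Rabs x)) * exp ((Rabs t + d) * Rabs x)).
    apply Rmult_le_compat; auto using Rabs_pos. apply exp_ge0.
    rewrite Rmult_assoc, <- exp_plus. do 2 f_equal. ring.
Qed.

Lemma is_derive_Fdn (h t : R) : 0 < h -> is_derive (fun t => Fdn t h) t (- (Fsn t h * Fcn t h)).
Proof. intros Hh. rewrite Fsn_Fcn by auto. exact (is_derive_LS_cos 0 sech h t Hh (sech_dec 0 h Hh)). Qed.
Lemma is_derive_Fcn (h t : R) : 0 < h -> is_derive (fun t => Fcn t h) t (- (Fsn t h * Fdn t h)).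
Proof. intros Hh. rewrite Fsn_Fdn by auto. exact (is_derive_LS_cos 1 sech h t Hh (sech_dec 1 h Hh)). Qed.
Lemma is_derive_Fsn (h t : R) : 0 < h -> is_derive (fun t => Fsn t h) t (Fcn t h * Fdn t h).
Proof. intros Hh. rewrite Fcn_Fdn by auto. exact (is_derive_LS_sin 1 csch h t Hh (csch_dec 1 h Hh)). Qed.

Lemma exp_add_mult (t x y : R) : exp (t * (x + y)) = exp (t * x) * exp (t * y).
Proof. rewrite Rmult_plus_distr_l. apply exp_plus. Qed.

Lemma Rabs_bound_pos (t h : R) : Rabs t < h -> 0 < h.
Proof. pose proof (Rabs_pos t). lra. Qed.

Lemma is_derive_Hdn (h t : R) : Rabs t < h -> is_derive (fun t => Hdn t h) t (Hsn t h * Hcn t h).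
Proof.
  intros Ht. assert (Hh := Rabs_bound_pos _ _ Ht). unfold Hsn, Hcn.
  rewrite (mult_sn_cn h Hh (Rabs t)); auto using gr_exp, exp_add_mult. 2: split; auto using Rabs_pos.
  exact (is_derive_LS_exp 0 sech h t Ht (sech_dec 0 h Hh)).
Qed.
Lemma is_derive_Hcn (h t : R) : Rabs t < h -> is_derive (fun t => Hcn t h) t (Hsn t h * Hdn t h).
Proof.
  intros Ht. assert (Hh := Rabs_bound_pos _ _ Ht). unfold Hsn, Hdn.
  rewrite (mult_sn_dn h Hh (Rabs t)); auto using gr_exp, exp_add_mult. 2: split; auto using Rabs_pos.
  exact (is_derive_LS_exp 1 sech h t Ht (sech_dec 1 h Hh)).
Qed.
Lemma is_derive_Hsn (h t : R) : Rabs t < h -> is_derive (fun t => Hsn t h) t (Hcn t h * Hdn t h).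
Proof.
  intros Ht. assert (Hh := Rabs_bound_pos _ _ Ht). unfold Hcn, Hdn.
  rewrite (mult_cn_dn h Hh (Rabs t)); auto using gr_exp, exp_add_mult. 2: split; auto using Rabs_pos.
  exact (is_derive_LS_exp 1 csch h t Ht (csch_dec 1 h Hh)).
Qed.

Lemma LS_exp_0 (b : Z) (u : R -> R) (h : R) : LS (fun x => exp (0 * x)) b u h = LS (fun _ => 1) b u h.
Proof. apply LS_ext. intros j. rewrite Rmult_0_l, exp_0. reflexivity. Qed.
Lemma LS_cos_0 (b : Z) (u : R -> R) (h : R) : LS (fun x => cos (0 * x)) b u h = LS (fun _ => 1) b u h.
Proof. apply LS_ext. intros j. rewrite Rmult_0_l, cos_0. reflexivity. Qed.

Lemma LS_zero (g u : R -> R) (b : Z) (h : R) : (forall j, g (fr b j) = 0) -> LS g b u h = 0.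
Proof.
  intros H. unfold LS. rewrite (ZS_ext _ (fun _ => 0)). apply ZS_zero. intros. rewrite H. ring.
Qed.

Lemma Fsn_0 (h : R) : Fsn 0 h = 0.
Proof. apply LS_zero. intros j. rewrite Rmult_0_l. apply sin_0. Qed.

Lemma Hsn_0 (h : R) : 0 < h -> Hsn 0 h = 0.
Proof.
  intros Hh. unfold Hsn. rewrite LS_exp_0. apply (LS_parity 0); auto. lra. apply gr_const; lra.
  apply csch_dec, Hh. intros. rewrite csch_neg. ring.
Qed.

Lemma Fcn_PI2 (h : R) : Fcn (PI / 2) h = 0.
Proof.
  apply LS_zero. intros j. unfold fr. rewrite plus_IZR, mult_IZR.
  replace (PI / 2 * (2 * IZR j + 1)) with (IZR j * PI + PI / 2) by field. rewrite cos_plus, cos_PI2, sin_PI2.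
  rewrite (sin_eq_0_1 (IZR j * PI)). ring. exists j; auto.
Qed.

Lemma cos_2jPI (j : Z) : cos (2 * IZR j * PI) = 1.
Proof.
  replace (2 * IZR j * PI) with (2 * (IZR j * PI)) by ring. rewrite cos_2a_sin.
  rewrite (sin_eq_0_1 (IZR j * PI)). ring. exists j; auto.
Qed.

Lemma Fdn_PI (h : R) : Fdn PI h = zz h.
Proof.
  apply LS_ext. intros j. unfold fr. rewrite Z.add_0_r, mult_IZR.
  replace (PI * (2 * IZR j)) with (2 * IZR j * PI) by ring. rewrite cos_2jPI. reflexivity.
Qed.

Lemma Fcn_PI (h : R) : Fcn PI h = - cc h.
Proof.
  unfold Fcn, cc, LS. rewrite (ZS_ext _ (fun j => -1 * (1 * sech (fr 1 j * h)))). rewrite ZS_scal; ring.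
  intros j. unfold fr. rewrite plus_IZR, mult_IZR.
  replace (PI * (2 * IZR j + 1)) with (2 * IZR j * PI + PI) by ring.
  rewrite neg_cos, cos_2jPI. ring.
Qed.

Lemma ZS_pos (r : R) (f : Z -> R) : 0 < r -> dec r f -> (forall j, 0 < f j) -> 0 < ZS f.
Proof.
  intros Hr Hf Hp. unfold ZS.
  assert (E : ex_series (fun n => f (Z.of_nat n) + f (-1 - Z.of_nat n)%Z)).
  { apply ex_series_add; [eapply dec_ex_posR | eapply dec_ex_negR]; eauto. }
  rewrite Series_incr_1 by auto.
  assert (0 <= Series (fun k => f (Z.of_nat (S k)) + f (-1 - Z.of_nat (S k))%Z)).
  { apply Series_nonneg.
    intros n. pose proof (Hp (Z.of_nat (S n))). pose proof (Hp (-1 - Z.of_nat (S n))%Z). lra.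
    apply (ex_series_incr_1 (fun n => f (Z.of_nat n) + f (-1 - Z.of_nat n)%Z)), E. }
  pose proof (Hp (Z.of_nat 0)). pose proof (Hp (-1 - Z.of_nat 0)%Z). lra.
Qed.

Lemma sech_pos (x : R) : 0 < sech x.
Proof. apply Rinv_0_lt_compat, cosh_pos. Qed.

Lemma LS_sech_pos (s : R) (g : R -> R) (b : Z) (h : R) : 0 <= s < h -> gr s g -> (forall x, 0 < g x) ->
  0 < LS g b sech h.
Proof.
  intros Hs Hg Hp. apply (ZS_pos (2 * h - 2 * s)). lra.
  apply (LS_dec s g b sech); auto. lra. apply sech_dec. lra.
  intros j. apply Rmult_lt_0_compat; auto. apply sech_pos.
Qed.

Lemma cc_pos (h : R) : 0 < h -> 0 < cc h.
Proof. intros. apply (LS_sech_pos 0); auto. lra. apply gr_const; lra. intros; lra. Qed.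
Lemma zz_pos (h : R) : 0 < h -> 0 < zz h.
Proof. intros. apply (LS_sech_pos 0); auto. lra. apply gr_const; lra. intros; lra. Qed.
Lemma Hcn_pos (h t : R) : Rabs t < h -> 0 < Hcn t h.
Proof.
  intros. apply (LS_sech_pos (Rabs t)); auto. split; auto. apply Rabs_pos. apply gr_exp. intros; apply exp_pos.
Qed.
Lemma Hdn_pos (h t : R) : Rabs t < h -> 0 < Hdn t h.
Proof.
  intros. apply (LS_sech_pos (Rabs t)); auto. split; auto. apply Rabs_pos. apply gr_exp. intros; apply exp_pos.
Qed.

Lemma is_derive_continuity_pt (f : R -> R) (x l : R) : is_derive f x l -> continuity_pt f x.
Proof.
  intros H. apply continuity_pt_filterlim. apply (ex_derive_cont f x).
  exists l. exact H.
Qed.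

Lemma constant_near0 (f : R -> R) (d : R) :
  (forall t, Rabs t < d -> is_derive f t 0) -> forall t, Rabs t < d -> f t = f 0.
Proof.
  intros H t Ht.
  assert (B : forall x, Rmin 0 t <= x <= Rmax 0 t -> Rabs x < d).
  { intros x Hx. eapply Rle_lt_trans. 2: apply Ht.
    unfold Rmin, Rmax in Hx. destruct (Rle_dec 0 t).
    rewrite !Rabs_pos_eq; lra. rewrite (Rabs_left t) by lra. apply Rabs_le; lra. }
  destruct (MVT_gen f 0 t (fun _ => 0)) as [c [_ Hc]].
  - intros x Hx. apply H, B. lra.
  - intros x Hx. exact (is_derive_continuity_pt _ _ _ (H x (B x Hx))).
  - lra.
Qed.

Lemma constant_everywhere (f : R -> R) : (forall t, is_derive f t 0) -> forall t, f t = f 0.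
Proof. intros H t. apply (constant_near0 f (Rabs t + 1)); auto. lra. Qed.

(** * Comparison with the elliptic integral *)

Section EllipticCurve.

Variable h : R.
Hypothesis Hh : 0 < h.

Let dD := fun t => is_derive_Fdn h t Hh.
Let dS := fun t => is_derive_Fsn h t Hh.
Let dC := fun t => is_derive_Fcn h t Hh.
Let eD : forall t, ex_derive (fun t => Fdn t h) t. Proof. intros; eexists; apply dD. Qed.
Let eS : forall t, ex_derive (fun t => Fsn t h) t. Proof. intros; eexists; apply dS. Qed.
Let eC : forall t, ex_derive (fun t => Fcn t h) t. Proof. intros; eexists; apply dC. Qed.

Ltac derF := auto_derive; [ repeat split; auto |
  repeat rewrite (is_derive_unique _ _ _ (dD _)); repeat rewrite (is_derive_unique _ _ _ (dS _));
  repeat rewrite (is_derive_unique _ _ _ (dC _)) ].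

Lemma Fsn_Fcn_sq (t : R) : Fsn t h ^ 2 + Fcn t h ^ 2 = cc h ^ 2.
Proof.
  rewrite (constant_everywhere (fun t => Fsn t h ^ 2 + Fcn t h ^ 2)).
  - rewrite Fsn_0. unfold Fcn, cc. rewrite LS_cos_0. ring.
  - intros u. derF. ring.
Qed.

Lemma Fdn_Fsn_sq (t : R) : Fdn t h ^ 2 + Fsn t h ^ 2 = zz h ^ 2.
Proof.
  rewrite (constant_everywhere (fun t => Fdn t h ^ 2 + Fsn t h ^ 2)).
  - rewrite Fsn_0. unfold Fdn, zz. rewrite LS_cos_0. ring.
  - intros u. derF. ring.
Qed.

(* If the two were equal, [Fdn - Fcn] would solve [f' = Fsn * f] with [f 0 = 0], hence vanish,
   contradicting the opposite parities under [t |-> t + PI]. *)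
Lemma cc_lt_zz : cc h < zz h.
Proof.
  pose proof (cc_pos h Hh) as Pc. pose proof (zz_pos h Hh) as Pz.
  assert (Sq : cc h ^ 2 <= zz h ^ 2).
  { pose proof (Fsn_Fcn_sq (PI / 2)) as H1. pose proof (Fdn_Fsn_sq (PI / 2)) as H2.
    rewrite Fcn_PI2 in H1. pose proof (pow2_ge_0 (Fdn (PI / 2) h)). lra. }
  destruct (Req_dec (cc h) (zz h)) as [E|E]; [|nra]. exfalso.
  (* The exponential factor makes f nonincreasing: its logarithmic derivative becomes 2 (Fsn - cc),
     and Fsn <= cc. But f would be 0 at 0 and positive at pi. *)
  set (f := fun t => (Fdn t h - Fcn t h) ^ 2 * exp (- (2 * cc h * t))).
  assert (Hf : forall t, is_derive f t (2 * (Fsn t h - cc h) * f t)).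
  { intros t. unfold f. derF. ring. }
  assert (Hf0 : f 0 = 0).
  { unfold f, Fdn, Fcn. rewrite !LS_cos_0. fold (zz h) (cc h). rewrite E. ring. }
  assert (HfPI : 0 < f PI).
  { unfold f. rewrite Fdn_PI, Fcn_PI. apply Rmult_lt_0_compat. 2: apply exp_pos. apply pow_lt. lra. }
  destruct (MVT_gen f 0 PI (fun t => 2 * (Fsn t h - cc h) * f t)) as [c [Hc1 Hc]].
  - intros; apply Hf.
  - intros x _. exact (is_derive_continuity_pt _ _ _ (Hf x)).
  - rewrite Hf0 in Hc. pose proof PI_RGT_0.
    assert (0 <= f c). { unfold f. apply Rmult_le_pos. apply pow2_ge_0. apply exp_ge0. }
    assert (Fsn c h <= cc h). { pose proof (Fsn_Fcn_sq c). pose proof (pow2_ge_0 (Fcn c h)). nra. }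
    assert (0 <= (cc h - Fsn c h) * f c) by (apply Rmult_le_pos; lra). nra.
Qed.

(* [theta_4^2]. *)
Definition nn (h : R) : R := sqrt (zz h ^ 2 - cc h ^ 2).

Lemma nn_pos : 0 < nn h.
Proof. apply sqrt_lt_R0. pose proof cc_lt_zz. pose proof (cc_pos h Hh). nra. Qed.

Lemma nn_sq : nn h ^ 2 = zz h ^ 2 - cc h ^ 2.
Proof. apply pow2_sqrt. pose proof cc_lt_zz. pose proof (cc_pos h Hh). nra. Qed.

Lemma Fdn_nn (t : R) : Fdn t h ^ 2 = nn h ^ 2 + Fcn t h ^ 2.
Proof. rewrite nn_sq. pose proof (Fsn_Fcn_sq t). pose proof (Fdn_Fsn_sq t). lra. Qed.

Lemma Fdn_0 : Fdn 0 h = zz h.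
Proof. unfold Fdn, zz. apply LS_cos_0. Qed.

Lemma Fcn_0 : Fcn 0 h = cc h.
Proof. unfold Fcn, cc. apply LS_cos_0. Qed.

(** [Fdn] starts at [zz > 0] and cannot cross 0, since its square is at least nn^2. *)
Lemma Fdn_pos (t : R) : 0 < Fdn t h.
Proof.
  destruct (Rlt_le_dec 0 (Fdn t h)) as [|H]; auto. exfalso.
  pose proof (zz_pos h Hh) as Pz.
  destruct (IVT_gen (fun t => Fdn t h) 0 t 0) as [x [_ Hx]].
  - intros x. exact (is_derive_continuity_pt _ _ _ (dD x)).
  - rewrite Fdn_0. rewrite Rmin_right, Rmax_left; lra.
  - pose proof (Fdn_nn x) as E. rewrite Hx in E. pose proof nn_pos. pose proof (pow2_ge_0 (Fcn x h)). nra.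
Qed.

Lemma Fdn_PI2 : Fdn (PI / 2) h = nn h.
Proof.
  pose proof (Fdn_nn (PI / 2)) as E. rewrite Fcn_PI2 in E. pose proof nn_pos. pose proof (Fdn_pos (PI / 2)).
  nra.
Qed.

(** The Fourier series of the Jacobi amplitude at zz t, obtained by integrating [Fdn] term by term.
    The summand [t] comes from the frequency 0, whose term in the series is 0 because / 0 = 0. *)
Definition amp (t : R) : R := t + LS (fun x => sin (t * x) / x) 0 sech h.

Lemma is_derive_amp (t : R) : is_derive amp t (Fdn t h).
Proof.
  unfold amp.
  assert (Dcos : dec h (fun j => cos (t * fr 0 j) * sech (fr 0 j * h))).
  { apply dec_le with (2 * h - 2 * 0). lra. apply (LS_dec 0 (fun x => cos (t * x))); auto. lra.
    apply gr_cos; lra. apply sech_dec, Hh. }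
  (* The frequency 0 contributes [sech 0 = 1] to [Fdn]; it is split off to match the derivative of
     the summand [t] of [amp]. *)
  assert (E : Fdn t h = 1 + LS (fun x => if Req_EM_T x 0 then 0 else cos (t * x)) 0 sech h).
  { rewrite <- (ZS_single 0 1) at 1. unfold Fdn, LS. rewrite <- (ZS_plus h); auto.
    - apply ZS_ext. intros j. destruct (Z.eq_dec j 0) as [->|Hj].
      + unfold fr. simpl. destruct (Req_EM_T 0 0); [|lra].
        rewrite Rmult_0_l, Rmult_0_r, cos_0. unfold sech. rewrite cosh_0. field.
      + destruct (Req_EM_T (fr 0 j) 0) as [E|E]. 2: ring.
        exfalso. apply (IZR_neq (2 * j + 0)%Z 0%Z); auto. lia.
    - apply (dec_finite h 1 _ 0); try lra; try lia. intros j. destruct (Z.eq_dec j 0); apply Rabs_le; lra.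
      intros j Hj. destruct (Z.eq_dec j 0); auto. lia.
    - destruct Dcos as [K HK]. exists K. intros j. destruct (Req_EM_T (fr 0 j) 0).
      + rewrite Rmult_0_l, Rabs_R0. eapply Rle_trans. 2: apply (HK j). apply Rabs_pos.
      + apply HK. }
  rewrite E. apply is_derive_add. apply (is_derive_id (K := R_AbsRing)).
  apply (LS_derive_t (fun t x => sin (t * x) / x) (fun t x => if Req_EM_T x 0 then 0 else cos (t * x))
    0 sech h t 1 0 (Rabs t + 1)); auto; try lra.
  - apply sech_dec, Hh.
  - intros t' x _. destruct (Req_EM_T x 0) as [->|Hx].
    + apply is_derive_ext with (fun _ : R => 0). intros; unfold Rdiv; rewrite Rinv_0; simpl; ring.
      apply is_derive_cst.
    + auto_derive; auto. field; auto.
  - intros t' x _. destruct (Req_EM_T x 0). apply continuous_const.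
    apply ex_derive_cont. auto_derive; auto.
  - intros t' x Ht. rewrite Rmult_0_l, exp_0, Rmult_1_r.
    destruct (Req_dec x 0) as [->|Hx].
    + unfold Rdiv. rewrite Rinv_0, Rmult_0_r, Rabs_R0. pose proof (Rabs_pos t); lra.
    + assert (Rabs (sin (t' * x)) <= Rabs (t' * x)).
      { destruct (MVT_gen sin 0 (t' * x) cos) as [c [_ Hc]].
        intros; apply is_derive_Reals, derivable_pt_lim_sin. intros; apply continuity_sin.
        rewrite sin_0, !Rminus_0_r in Hc. rewrite Hc, Rabs_mult. rewrite <- (Rmult_1_l (Rabs (t' * x))) at 2.
        apply Rmult_le_compat_r. apply Rabs_pos. apply Rabs_le, COS_bound. }
      unfold Rdiv. rewrite Rabs_mult, Rabs_inv. rewrite Rabs_mult in H.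
      assert (P : 0 < Rabs x) by (apply Rabs_pos_lt; auto).
      apply Rmult_le_reg_r with (Rabs x); auto. rewrite Rmult_assoc, Rinv_l by lra. rewrite Rmult_1_r.
      eapply Rle_trans. apply H. apply Rmult_le_compat_r. lra.
      pose proof (Rabs_triang t (t' - t)) as Tr. replace (t + (t' - t)) with t' in Tr by ring. lra.
  - intros t' x Ht. rewrite Rmult_0_l, exp_0, Rmult_1_r. pose proof (Rabs_pos t).
    destruct (Req_EM_T x 0). rewrite Rabs_R0; lra.
    apply Rle_trans with 1. apply Rabs_le, COS_bound. lra.
Qed.

Lemma amp_0 : amp 0 = 0.
Proof.
  unfold amp. rewrite LS_zero. ring. intros j. rewrite Rmult_0_l, sin_0. unfold Rdiv; ring.
Qed.

Lemma amp_PI2 : amp (PI / 2) = PI / 2.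
Proof.
  unfold amp. rewrite LS_zero. ring. intros j. unfold fr. rewrite Z.add_0_r, mult_IZR.
  replace (PI / 2 * (2 * IZR j)) with (IZR j * PI) by field.
  rewrite (sin_eq_0_1 (IZR j * PI)). unfold Rdiv; ring. exists j; auto.
Qed.

(** The vector (Fcn, Fsn) turns with angular velocity [Fdn], and so does the angle [amp]. Rotated
    back by [amp], the vector is therefore constant, equal to (cc, 0). *)
Lemma Fsn_amp (t : R) : Fsn t h = cc h * sin (amp t).
Proof.
  assert (eA : forall t, ex_derive amp t) by (intros; eexists; apply is_derive_amp).
  assert (E1 : Fsn t h * cos (amp t) - Fcn t h * sin (amp t) = 0).
  { rewrite (constant_everywhere (fun t => Fsn t h * cos (amp t) - Fcn t h * sin (amp t))).
    - rewrite amp_0, Fsn_0, sin_0. ring.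
    - intros u. derF. rewrite (is_derive_unique _ _ _ (is_derive_amp _)). ring. }
  assert (E2 : Fsn t h * sin (amp t) + Fcn t h * cos (amp t) = cc h).
  { rewrite (constant_everywhere (fun t => Fsn t h * sin (amp t) + Fcn t h * cos (amp t))).
    - rewrite amp_0, Fsn_0, cos_0, Fcn_0. ring.
    - intros u. derF. rewrite (is_derive_unique _ _ _ (is_derive_amp _)). ring. }
  pose proof (sin2_cos2 (amp t)) as E3. unfold Rsqr in E3.
  rewrite <- E2.
  replace ((Fsn t h * sin (amp t) + Fcn t h * cos (amp t)) * sin (amp t))
    with (Fsn t h * (sin (amp t) * sin (amp t) + cos (amp t) * cos (amp t))
      - cos (amp t) * (Fsn t h * cos (amp t) - Fcn t h * sin (amp t))) by ring.
  rewrite E1, E3. ring.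
Qed.

End EllipticCurve.

(** * The incomplete elliptic integral of the first kind *)

Lemma one_minus_ksin_pos (k t : R) : Rabs k < 1 -> 0 < 1 - k ^ 2 * sin t ^ 2.
Proof.
  intros Hk. apply Rabs_def2 in Hk. pose proof (SIN_bound t).
  assert (0 <= sin t ^ 2 <= 1) by (simpl; nra). assert (0 <= k ^ 2 < 1) by (simpl; nra). nra.
Qed.

Lemma continuous_ellint (k t : R) : Rabs k < 1 -> continuous (fun t => / sqrt (1 - k ^ 2 * sin t ^ 2)) t.
Proof.
  intros Hk. pose proof (one_minus_ksin_pos k t Hk) as P.
  apply ex_derive_cont. auto_derive. repeat split; simpl in *; auto.
  match goal with |- sqrt ?x <> 0 => assert (0 < sqrt x) by (apply sqrt_lt_R0; simpl in *; lra) end. lra.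
Qed.

Lemma is_derive_ellF (k t : R) : Rabs k < 1 ->
  is_derive (fun t => ellF t k) t (/ sqrt (1 - k ^ 2 * sin t ^ 2)).
Proof.
  intros Hk. apply (is_derive_RInt (fun t => / sqrt (1 - k ^ 2 * sin t ^ 2)) (fun t => ellF t k) 0 t).
  - apply filter_forall. intros x. apply (RInt_correct (V := R_CompleteNormedModule)).
    apply (ex_RInt_continuous (V := R_CompleteNormedModule)). intros; apply continuous_ellint, Hk.
  - apply continuous_ellint, Hk.
Qed.

Lemma ellF_0 (k : R) : ellF 0 k = 0.
Proof. apply (RInt_point (V := R_CompleteNormedModule)). Qed.

Lemma ellF_incr (k x y : R) : Rabs k < 1 -> x < y -> ellF x k < ellF y k.
Proof.
  intros Hk Hxy. apply (incr_function (fun t => ellF t k) m_infty p_infty (fun t => / sqrt (1 - k ^ 2 * sin t ^ 2)));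
    simpl; auto.
  - intros; apply is_derive_ellF, Hk.
  - intros. apply Rinv_0_lt_compat, sqrt_lt_R0, one_minus_ksin_pos, Hk.
Qed.

Lemma ellF_inj (k x y : R) : Rabs k < 1 -> ellF x k = ellF y k -> x = y.
Proof.
  intros Hk E. destruct (Rtotal_order x y) as [H|[H|H]]; auto;
    apply (ellF_incr k) in H; auto; lra.
Qed.

(** The given [phi] shows that the choice made by [epsilon] satisfies its equation, and injectivity
    of [ellF] identifies the two. *)
Lemma am_eq (phi u k : R) : Rabs k < 1 -> ellF phi k = u -> am u k = phi.
Proof.
  intros Hk E. apply (ellF_inj k); auto. rewrite E. unfold am.
  apply (ClassicalEpsilon.epsilon_spec (inhabits 0) (fun phi => ellF phi k = u)). exists phi; auto.
Qed.

Definition ellK (k : R) : R := ellF (PI / 2) k.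

Lemma ellK_incr (k l : R) : 0 <= k -> k < l -> l < 1 -> ellK k < ellK l.
Proof.
  intros Hk Hkl Hl. unfold ellK, ellF. pose proof PI_RGT_0.
  assert (Rabs k < 1) by (rewrite Rabs_pos_eq; lra). assert (Rabs l < 1) by (rewrite Rabs_pos_eq; lra).
  apply RInt_lt; try lra; try (intros; apply continuous_ellint; auto).
  intros x Hx. pose proof (one_minus_ksin_pos l x ltac:(auto)). pose proof (one_minus_ksin_pos k x ltac:(auto)).
  assert (0 < sin x) by (apply sin_gt_0; lra).
  apply Rinv_lt_contravar. apply Rmult_lt_0_compat; apply sqrt_lt_R0; auto.
  apply sqrt_lt_1; try lra. assert (k ^ 2 < l ^ 2) by (simpl; nra). assert (0 < sin x ^ 2) by (apply pow_lt; auto). nra.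
Qed.

Section Moduli.

Variable h : R.
Hypothesis Hh : 0 < h.

Definition kk (h : R) : R := cc h / zz h.
Definition kk' (h : R) : R := nn h / zz h.

Let Pc := cc_pos h Hh.
Let Pz := zz_pos h Hh.
Let Pn := nn_pos h Hh.
Let Sq := nn_sq h Hh.

Lemma kk_bounds : 0 < kk h < 1.
Proof.
  unfold kk. split. apply Rdiv_lt_0_compat; auto.
  apply Rmult_lt_reg_r with (zz h); auto. unfold Rdiv. rewrite Rmult_assoc, Rinv_l by lra.
  pose proof (cc_lt_zz h Hh). lra.
Qed.

Lemma kk'_bounds : 0 < kk' h < 1.
Proof.
  unfold kk'. split. apply Rdiv_lt_0_compat; auto.
  apply Rmult_lt_reg_r with (zz h); auto. unfold Rdiv. rewrite Rmult_assoc, Rinv_l by lra.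
  nra.
Qed.

Lemma kk_abs : Rabs (kk h) < 1.
Proof. pose proof kk_bounds. rewrite Rabs_pos_eq; lra. Qed.
Lemma kk'_abs : Rabs (kk' h) < 1.
Proof. pose proof kk'_bounds. rewrite Rabs_pos_eq; lra. Qed.

Lemma kk_sq : kk' h ^ 2 + kk h ^ 2 = 1.
Proof.
  unfold kk, kk'. replace ((nn h / zz h) ^ 2 + (cc h / zz h) ^ 2) with ((nn h ^ 2 + cc h ^ 2) / zz h ^ 2) by (field; lra).
  rewrite Sq. field. lra.
Qed.

(* Chain rule for the incomplete elliptic integral along a curve whose delta amplitude is [w]. *)
Lemma is_derive_ellF_comp (k phi' w t : R) (phi : R -> R) : Rabs k < 1 -> 0 < w ->
  is_derive phi t phi' -> 1 - k ^ 2 * sin (phi t) ^ 2 = w ^ 2 ->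
  is_derive (fun t => ellF (phi t) k) t (phi' / w).
Proof.
  intros Hk Hw Hphi E.
  apply is_derive_eq with (scal phi' (/ sqrt (1 - k ^ 2 * sin (phi t) ^ 2))).
  - apply (is_derive_chain (fun x => ellF x k) phi); auto. apply is_derive_ellF, Hk.
  - rewrite E. rewrite sqrt_pow2 by lra. reflexivity.
Qed.

Lemma linear_near0 (f : R -> R) (a d : R) :
  (forall t, Rabs t < d -> is_derive f t a) -> f 0 = 0 -> forall t, Rabs t < d -> f t = a * t.
Proof.
  intros H H0 t Ht.
  assert (E : f t - a * t = f 0 - a * 0).
  { apply (constant_near0 (fun t => f t - a * t) d); auto. intros u Hu.
    apply is_derive_eq with (minus a (a * 1)).
    - apply (is_derive_minus (V := R_NormedModule)); auto.
      apply is_derive_cmult. apply (is_derive_id (K := R_AbsRing)).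
    - unfold minus, plus, opp; simpl. ring. }
  lra.
Qed.

(** Along [amp] the delta amplitude is Fdn / zz, while [amp] itself has derivative [Fdn]; so the
    elliptic integral grows at the constant speed zz. *)
Lemma ellF_amp (t : R) : ellF (amp h t) (kk h) = zz h * t.
Proof.
  apply (linear_near0 (fun t => ellF (amp h t) (kk h)) (zz h) (Rabs t + 1)); try lra.
  - intros u _. pose proof (Fdn_pos h Hh u).
    apply is_derive_eq with (Fdn u h / (Fdn u h / zz h)).
    + apply is_derive_ellF_comp. apply kk_abs. apply Rdiv_lt_0_compat; auto.
      apply is_derive_amp, Hh.
      replace (kk h ^ 2 * sin (amp h u) ^ 2) with ((cc h * sin (amp h u)) ^ 2 / zz h ^ 2) by (unfold kk; field; lra).
      rewrite <- Fsn_amp by auto. pose proof (Fdn_Fsn_sq h Hh u) as E.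
      replace (Fsn u h ^ 2) with (zz h ^ 2 - Fdn u h ^ 2) by lra. field. lra.
    + field. lra.
  - rewrite amp_0. apply ellF_0.
Qed.

Lemma ellK_kk : ellK (kk h) = zz h * (PI / 2).
Proof. rewrite <- ellF_amp, amp_PI2. reflexivity. Qed.

Let dS := fun t Ht => is_derive_Hsn h t Ht.
Let dC := fun t Ht => is_derive_Hcn h t Ht.
Let dD := fun t Ht => is_derive_Hdn h t Ht.

Lemma hyperbolic_invariant (f g w : R -> R) (d t : R) :
  (forall u, Rabs u < d -> is_derive f u (g u * w u)) ->
  (forall u, Rabs u < d -> is_derive g u (f u * w u)) ->
  Rabs t < d -> f t ^ 2 - g t ^ 2 = f 0 ^ 2 - g 0 ^ 2.
Proof.
  intros Hf Hg Ht. apply (constant_near0 (fun t => f t ^ 2 - g t ^ 2) d); auto. intros u Hu.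
  assert (ex_derive f u) by (eexists; apply Hf, Hu). assert (ex_derive g u) by (eexists; apply Hg, Hu).
  auto_derive. auto.
  rewrite (is_derive_unique (fun x : R => f x) _ _ (Hf u Hu)), (is_derive_unique (fun x : R => g x) _ _ (Hg u Hu)). ring.
Qed.

Lemma Hcn_Hsn_sq (t : R) : Rabs t < h -> Hcn t h ^ 2 = Hsn t h ^ 2 + cc h ^ 2.
Proof.
  intros Ht. pose proof (hyperbolic_invariant _ _ (fun t => Hdn t h) h t dC dS Ht) as E. cbv beta in E.
  rewrite Hsn_0 in E by auto. unfold Hcn at 2 in E. rewrite LS_exp_0 in E. fold (cc h) in E. lra.
Qed.

Lemma Hdn_Hsn_sq (t : R) : Rabs t < h -> Hdn t h ^ 2 = Hsn t h ^ 2 + zz h ^ 2.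
Proof.
  intros Ht.
  assert (dS' : forall u, Rabs u < h -> is_derive (fun t => Hsn t h) u (Hdn u h * Hcn u h)).
  { intros u Hu. rewrite Rmult_comm. auto. }
  pose proof (hyperbolic_invariant _ _ (fun t => Hcn t h) h t dD dS' Ht) as E. cbv beta in E.
  rewrite Hsn_0 in E by auto. unfold Hdn at 2 in E. rewrite LS_exp_0 in E. fold (zz h) in E. lra.
Qed.

Lemma sin_atan_sq (x : R) : sin (atan x) ^ 2 = x ^ 2 / (1 + x ^ 2).
Proof.
  rewrite sin_atan. unfold Rsqr.
  assert (P : 0 < 1 + x * x) by nra.
  replace ((x / sqrt (1 + x * x)) ^ 2) with (x ^ 2 / (sqrt (1 + x * x) ^ 2)).
  rewrite pow2_sqrt by lra. field; simpl; lra.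
  field. apply Rgt_not_eq, sqrt_lt_R0, P.
Qed.

Lemma is_derive_atan_comp (q : R -> R) (t q' : R) : is_derive q t q' ->
  is_derive (fun t => atan (q t)) t (q' / (1 + q t ^ 2)).
Proof.
  intros Hq. apply is_derive_eq with (scal q' (/ (1 + Rsqr (q t)))).
  - apply (is_derive_chain atan q); auto. apply is_derive_atan.
  - unfold Rsqr, scal; simpl. unfold mult; simpl. unfold Rdiv. f_equal. f_equal. ring.
Qed.

(** Jacobi's imaginary transformation sn(iu, k) = i tan(am(u, k')) in real form: [Hsn / cc] is the
    tangent of the amplitude for the complementary modulus. *)
Lemma ellF_atan_Hsn (t : R) : Rabs t < h -> ellF (atan (Hsn t h / cc h)) (kk' h) = zz h * t.
Proof.
  apply (linear_near0 (fun t => ellF (atan (Hsn t h / cc h)) (kk' h)) (zz h) h).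
  - intros u Hu. pose proof (Hdn_pos h u Hu) as Pd. pose proof (Hcn_pos h u Hu) as Pcn.
    pose proof (Hcn_Hsn_sq u Hu) as E1. pose proof (Hdn_Hsn_sq u Hu) as E2.
    assert (Q : is_derive (fun t => Hsn t h / cc h) u (Hcn u h * Hdn u h / cc h)).
    { unfold Rdiv. apply is_derive_eq with (scal (/ cc h) (Hcn u h * Hdn u h)).
      apply is_derive_ext with (fun t => scal (/ cc h) (Hsn t h)).
      intros; unscal; ring.
      apply is_derive_cmult. apply dS, Hu.
      unscal; ring. }
    assert (N1 : 1 + (Hsn u h / cc h) ^ 2 = Hcn u h ^ 2 / cc h ^ 2).
    { rewrite E1. field. lra. }
    eapply is_derive_eq.
    (* This [w] is dn(u, k') = dn(iu, k) / cn(iu, k), with [Hdn / zz] and [Hcn / cc] as the values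
       of dn and cn on the imaginary axis. *)
    + apply is_derive_ellF_comp with (w := cc h * Hdn u h / (zz h * Hcn u h)). apply kk'_abs.
      apply Rdiv_lt_0_compat; apply Rmult_lt_0_compat; auto.
      apply is_derive_atan_comp. apply Q.
      rewrite sin_atan_sq, N1.
      replace ((Hsn u h / cc h) ^ 2) with ((Hcn u h ^ 2 - cc h ^ 2) / cc h ^ 2) by (rewrite E1; field; lra).
      replace ((cc h * Hdn u h / (zz h * Hcn u h)) ^ 2)
        with (cc h ^ 2 * Hdn u h ^ 2 / (zz h ^ 2 * Hcn u h ^ 2)) by (field; lra).
      replace (Hdn u h ^ 2) with (Hcn u h ^ 2 - cc h ^ 2 + zz h ^ 2) by lra.
      replace (kk' h ^ 2) with ((zz h ^ 2 - cc h ^ 2) / zz h ^ 2) by (rewrite <- Sq; unfold kk'; field; lra).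
      field. lra.
    + cbv beta. rewrite N1. field. lra.
  - rewrite Hsn_0 by auto. unfold Rdiv. rewrite Rmult_0_l, atan_0. apply ellF_0.
Qed.

Lemma exp_csch_pair (t a : R) :
  exp (t * a) * csch (a * h) + exp (t * - a) * csch (- a * h) = 2 * (sinh (t * a) * csch (a * h)).
Proof.
  replace (t * - a) with (- (t * a)) by ring. replace (- a * h) with (- (a * h)) by ring.
  rewrite csch_neg. unfold sinh. field.
Qed.

Lemma Hsn_series (t : R) : Rabs t < h ->
  is_series (fun n => 2 * (sinh (t * (2 * INR n + 1)) * csch ((2 * INR n + 1) * h))) (Hsn t h).
Proof.
  intros Ht.
  assert (D : dec (2 * h - 2 * Rabs t) (fun j => exp (t * fr 1 j) * csch (fr 1 j * h))).
  { apply (LS_dec (Rabs t) (fun x => exp (t * x))). apply Rabs_pos. apply gr_exp. apply csch_dec, Hh. }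
  assert (P0 : 0 < 2 * h - 2 * Rabs t) by lra.
  apply is_series_ext with (2 := Series_correct _ (ex_series_add _ _ (dec_ex_posR _ _ P0 D) (dec_ex_negR _ _ P0 D))).
  intros n. assert (E1 : fr 1 (Z.of_nat n) = 2 * INR n + 1).
  { unfold fr. rewrite plus_IZR, mult_IZR, <- INR_IZR_INZ. reflexivity. }
  assert (E2 : fr 1 (-1 - Z.of_nat n) = - (2 * INR n + 1)) by (rewrite <- E1; apply fr_refl).
  rewrite E1, E2. apply exp_csch_pair.
Qed.

(* Each term of [Hsn_series] tends to 2 as t tends to h. *)
Lemma Hsn_unbounded (B : R) : exists t, 0 <= t < h /\ B <= Hsn t h.
Proof.
  destruct (INR_unbounded (B + 1)) as [J HJ].
  pose (P := (fun t => sum_n (fun n => 2 * (sinh (t * (2 * INR n + 1)) * csch ((2 * INR n + 1) * h))) J) : R -> R).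
  (* At t = h each quotient of hyperbolic sines is 1. Close to h the partial sum stays above 2 (J +
     1) - 1 > B, and the terms left out are nonnegative. *)
  assert (Ph : P h = 2 * (INR J + 1)).
  { unfold P. transitivity (sum_n (fun _ => 2) J). 2: { rewrite sum_n_const, S_INR.
      eqR. ring. }
    apply sum_n_ext. intros n. unfold csch. rewrite (Rmult_comm h).
    pose proof (pos_INR n). assert (sinh ((2 * INR n + 1) * h) <> 0) by (apply sinh_neq0; nra).
    eqR. field. auto. }
  assert (Pcont : continuous P h).
  { unfold P. apply (continuous_sum_n (fun n t => 2 * (sinh (t * (2 * INR n + 1)) * csch ((2 * INR n + 1) * h)))).
    intros n. apply ex_derive_cont. auto_derive. auto. }
  assert (L : locally h (fun t => Rabs (P t - P h) < 1)).
  { apply (Pcont (fun y => Rabs (y - P h) < 1)). exists (mkposreal 1 Rlt_0_1). intros y Hy. exact Hy. }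
  destruct L as [e He].
  set (t := Rmax (h / 2) (h - e / 2)).
  assert (Ht : 0 <= t < h).
  { unfold t. pose proof (cond_pos e). split. eapply Rle_trans. 2: apply Rmax_l. lra. apply Rmax_lub_lt; lra. }
  exists t. split; auto.
  assert (HP : Rabs (P t - P h) < 1).
  { apply He. change (Rabs (t - h) < e). rewrite Rabs_left by lra.
    assert (h - e / 2 <= t) by apply Rmax_r. pose proof (cond_pos e). lra. }
  apply Rabs_def2 in HP. pose proof (pos_INR J).
  apply Rle_trans with (P t). lra.
  pose proof (Hsn_series t ltac:(rewrite Rabs_pos_eq; lra)) as Hs. unfold P.
  assert (Nn : forall n, 0 <= 2 * (sinh (t * (2 * INR n + 1)) * csch ((2 * INR n + 1) * h))).
  { intros n. pose proof (pos_INR n).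
    assert (0 <= sinh (t * (2 * INR n + 1))).
    { destruct (proj1 Ht) as [H1|H1]. apply Rlt_le, sinh_pos. nra. rewrite <- H1, Rmult_0_l, sinh_0. lra. }
    assert (0 < csch ((2 * INR n + 1) * h)). { apply Rinv_0_lt_compat, sinh_pos. nra. }
    apply Rmult_le_pos. lra. apply Rmult_le_pos; lra. }
  set (a := fun n => 2 * (sinh (t * (2 * INR n + 1)) * csch ((2 * INR n + 1) * h))) in *.
  assert (Hex : ex_series a) by (eexists; apply Hs).
  rewrite <- (is_series_unique _ _ Hs), (Series_incr_n a (S J)) by (auto; lia). simpl pred. rewrite sum_n_Reals.
  assert (0 <= Series (fun k => a (S J + k)%nat)).
  { apply Series_nonneg. intros n. apply Nn. apply (ex_series_incr_n a (S J)), Hex. }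
  lra.
Qed.

(** As t tends to h the amplitude of [ellF_atan_Hsn] tends to pi/2 because [Hsn] is unbounded, which
    bounds K(k') above by zz h times h; it stays below pi/2 for every t < h, which gives the other
    inequality. *)
Lemma ellK_kk' : ellK (kk' h) = zz h * h.
Proof.
  pose proof kk'_abs as Hk. apply Rle_antisym.
  - apply Rnot_lt_le. intros H.
    assert (Cont : continuous (fun t => ellF t (kk' h)) (PI / 2)).
    { apply (ex_derive_cont (fun t => ellF t (kk' h))).
      eexists; apply is_derive_ellF, Hk. }
    assert (L : locally (PI / 2) (fun b => zz h * h < ellF b (kk' h))).
    { apply (Cont (fun y => zz h * h < y)). apply (open_gt (zz h * h)). exact H. }
    destruct L as [e He]. pose proof (cond_pos e) as Pe. pose proof PI_RGT_0.
    set (b := Rmax 0 (PI / 2 - e / 2)).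
    assert (Hb : 0 <= b < PI / 2).
    { unfold b. split. apply Rmax_l. apply Rmax_lub_lt; lra. }
    assert (Eb : zz h * h < ellF b (kk' h)).
    { apply He. change (Rabs (b - PI / 2) < e). rewrite Rabs_left by lra.
      assert (PI / 2 - e / 2 <= b) by apply Rmax_r. lra. }
    destruct (Hsn_unbounded (cc h * tan b)) as [t [Ht Hs]].
    assert (Ht' : Rabs t < h) by (rewrite Rabs_pos_eq; lra).
    pose proof (ellF_atan_Hsn t Ht') as E.
    assert (b <= atan (Hsn t h / cc h)).
    { assert (Tb : tan b <= Hsn t h / cc h).
      { apply Rmult_le_reg_r with (cc h); auto. unfold Rdiv. rewrite Rmult_assoc, Rinv_l by lra. lra. }
      assert (Ab : atan (tan b) = b) by (apply atan_tan; lra).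
      destruct Tb as [Tb|Tb]. apply atan_increasing in Tb. lra. rewrite <- Tb. lra. }
    assert (ellF b (kk' h) <= zz h * t).
    { rewrite <- E. destruct H1 as [H1|H1]. apply Rlt_le, ellF_incr; auto. rewrite H1. lra. }
    nra.
  - apply Rnot_lt_le. intros H. unfold ellK in *.
    set (t := ellF (PI / 2) (kk' h) / zz h).
    assert (E0 : zz h * t = ellF (PI / 2) (kk' h)) by (unfold t; field; lra).
    assert (0 < t).
    { apply Rdiv_lt_0_compat; auto. rewrite <- (ellF_0 (kk' h)). apply ellF_incr; auto.
      pose proof PI_RGT_0; lra. }
    assert (t < h) by nra.
    assert (Ht' : Rabs t < h) by (rewrite Rabs_pos_eq; lra).
    pose proof (ellF_atan_Hsn t Ht') as E. rewrite E0 in E.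
    pose proof (ellF_incr (kk' h) (atan (Hsn t h / cc h)) (PI / 2) Hk (proj2 (atan_bound _))). lra.
Qed.

End Moduli.

(** * The inversion h -> pi^2/(4h) and the point h = pi/2 *)

Lemma kk_mult_zz (h : R) : 0 < h -> cc h = kk h * zz h /\ nn h = kk' h * zz h.
Proof. intros Hh. pose proof (zz_pos h Hh). unfold kk, kk'. split; field; lra. Qed.

(** The quotient K(k') / K(k) = 2h/pi determines k because K is strictly increasing. Were kk h'
    different from kk' h, then kk h and kk' h' would be unequal in the same sense, and multiplying
    the two inequalities between values of K contradicts h h' = pi^2/4. *)
Lemma kk_dual (h : R) : 0 < h -> kk (PI ^ 2 / (4 * h)) = kk' h /\ kk' (PI ^ 2 / (4 * h)) = kk h.
Proof.
  intros Hh. pose proof PI_RGT_0.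
  assert (Hh' : 0 < PI ^ 2 / (4 * h)) by (apply Rdiv_lt_0_compat; [apply pow_lt|]; lra).
  set (h' := PI ^ 2 / (4 * h)) in *.
  assert (E1 := ellK_kk h Hh). assert (E2 := ellK_kk' h Hh).
  assert (E3 := ellK_kk h' Hh'). assert (E4 := ellK_kk' h' Hh').
  assert (Eh : 2 * h * h' = PI * (PI / 2)) by (unfold h'; field; lra).
  destruct (kk_bounds h Hh), (kk'_bounds h Hh), (kk_bounds h' Hh'), (kk'_bounds h' Hh').
  pose proof (kk_sq h Hh). pose proof (kk_sq h' Hh').
  pose proof (zz_pos h Hh). pose proof (zz_pos h' Hh').
  cut (kk h' = kk' h).
  { intros E. split; auto. rewrite E in *. nra. }
  destruct (Rtotal_order (kk h') (kk' h)) as [L|[L|L]]; auto; exfalso.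
  - assert (L' : kk h < kk' h') by nra.
    apply ellK_incr in L; try lra. apply ellK_incr in L'; try lra.
    rewrite E3, E2 in L. rewrite E1, E4 in L'. nra.
  - assert (L' : kk' h' < kk h) by nra.
    apply ellK_incr in L; try lra. apply ellK_incr in L'; try lra.
    rewrite E3, E2 in L. rewrite E1, E4 in L'. nra.
Qed.

Lemma zz_dual (h : R) : 0 < h -> zz (PI ^ 2 / (4 * h)) = 2 / PI * h * zz h.
Proof.
  intros Hh. pose proof PI_RGT_0.
  assert (Hh' : 0 < PI ^ 2 / (4 * h)) by (apply Rdiv_lt_0_compat; [apply pow_lt|]; lra).
  assert (E3 := ellK_kk (PI ^ 2 / (4 * h)) Hh').
  rewrite (proj1 (kk_dual h Hh)), (ellK_kk' h Hh) in E3.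
  apply Rmult_eq_reg_r with (PI / 2); [|lra]. rewrite <- E3. field. lra.
Qed.

Lemma kk_half : kk (PI / 2) = kk' (PI / 2).
Proof.
  pose proof PI_RGT_0. destruct (kk_dual (PI / 2) ltac:(lra)) as [E _].
  rewrite <- E. f_equal. field. lra.
Qed.

Lemma kk_half_sq : kk (PI / 2) ^ 2 = 1 / 2.
Proof.
  pose proof PI_RGT_0. pose proof (kk_sq (PI / 2) ltac:(lra)) as E. rewrite <- kk_half in E. lra.
Qed.

Lemma cc_half : cc (PI / 2) ^ 2 = zz (PI / 2) ^ 2 / 2.
Proof.
  pose proof PI_RGT_0. rewrite (proj1 (kk_mult_zz (PI / 2) ltac:(lra))), Rpow_mult_distr, kk_half_sq. field.
Qed.

Lemma nn_half : nn (PI / 2) = cc (PI / 2).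
Proof.
  pose proof PI_RGT_0. destruct (kk_mult_zz (PI / 2) ltac:(lra)) as [-> ->]. rewrite kk_half. reflexivity.
Qed.

Lemma ee_half : ee (PI / 2) = zz (PI / 2) ^ 2 / 2 - / PI.
Proof.
  pose proof PI_RGT_0 as P. assert (Hh : 0 < PI / 2) by lra.
  pose proof (zz_pos (PI / 2) Hh) as Pz.
  assert (D := is_derive_zz (PI / 2) Hh). rewrite cc_half in D.
  set (z' := zz (PI / 2) * (ee (PI / 2) - zz (PI / 2) ^ 2 / 2)) in *.
  (* The inversion has derivative -1 at its fixed point pi/2, so the functional equation of [zz]
     becomes a linear equation for the derivative of [zz] there. *)
  assert (D1 : is_derive (fun h => zz (PI ^ 2 / (4 * h))) (PI / 2) (- z')).
  { apply is_derive_eq with (scal (-1) z').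
    - apply (is_derive_chain zz (fun h => PI ^ 2 / (4 * h))).
      + replace (PI ^ 2 / (4 * (PI / 2))) with (PI / 2) by (field; lra). exact D.
      + auto_derive. lra. field. lra.
    - unscal; ring. }
  assert (D2 : is_derive (fun h => 2 / PI * h * zz h) (PI / 2) (2 / PI * zz (PI / 2) + z')).
  { assert (Ez : ex_derive zz (PI / 2)) by (eexists; apply D).
    auto_derive; auto. rewrite (is_derive_unique (fun x : R => zz x) _ _ D). field. lra. }
  assert (E : - z' = 2 / PI * zz (PI / 2) + z').
  { apply is_derive_unique in D2. rewrite <- D2. symmetry. apply is_derive_unique.
    apply is_derive_ext_loc with (2 := D1).
    exists (mkposreal _ Hh). intros y Hy. apply zz_dual. change (Rabs (y - PI / 2) < PI / 2) in Hy.
    apply Rabs_def2 in Hy. lra. }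
  assert (E' : zz (PI / 2) * (ee (PI / 2) - zz (PI / 2) ^ 2 / 2) = zz (PI / 2) * - / PI).
  { fold z'. unfold Rdiv in E. lra. }
  apply Rmult_eq_reg_l in E'; lra.
Qed.

(** So [ee] is the logarithmic derivative of theta_4^2 in h. *)
Lemma is_derive_nn (h : R) : 0 < h -> is_derive nn h (nn h * ee h).
Proof.
  intros Hh. pose proof (nn_pos h Hh) as Pn. pose proof (nn_sq h Hh) as Sq.
  assert (Ez : ex_derive zz h) by (eexists; apply is_derive_zz, Hh).
  assert (Ec : ex_derive cc h) by (eexists; apply is_derive_cc, Hh).
  assert (P2 : 0 < zz h ^ 2 - cc h ^ 2) by (rewrite <- Sq; apply pow_lt, Pn).
  unfold nn at 1. auto_derive. repeat split; auto.
  rewrite (is_derive_unique (fun x : R => zz x) _ _ (is_derive_zz h Hh)),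
    (is_derive_unique (fun x : R => cc x) _ _ (is_derive_cc h Hh)).
  match goal with |- context [sqrt ?a] => replace (sqrt a) with (nn h) by (unfold nn; f_equal; simpl; ring) end.
  replace (nn h * ee h) with (nn h ^ 2 * ee h / nn h) by (field; lra). rewrite Sq. field. lra.
Qed.

(** * The Fourier series of sd and its Maclaurin coefficients *)

Lemma is_derive_shift (f : R -> R) (a t l : R) : is_derive f (a + t) l -> is_derive (fun t => f (a + t)) t l.
Proof.
  intros H. apply is_derive_eq with (1 * l); [|ring].
  apply (is_derive_chain f (fun t => a + t)); auto. auto_derive; auto.
Qed.

(* Multiples of sd, cd and nd: a quarter period turns cn, sn and dn into -sd, cd and nd. *)
Definition Sd (h t : R) : R := - Fcn (PI / 2 + t) h.
Definition Cd (h t : R) : R := Fsn (PI / 2 + t) h.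
Definition Nd (h t : R) : R := Fdn (PI / 2 + t) h.

Section SdSeries.

Variable h : R.
Hypothesis Hh : 0 < h.

Let Pc := cc_pos h Hh.
Let Pz := zz_pos h Hh.
Let Pn := nn_pos h Hh.
Let Sq := nn_sq h Hh.

Lemma is_derive_Sd (t : R) : is_derive (Sd h) t (Cd h t * Nd h t).
Proof.
  apply is_derive_eq with (opp (- (Cd h t * Nd h t))). 2: unfold opp; simpl; ring.
  apply (is_derive_opp (fun t => Fcn (PI / 2 + t) h)).
  exact (is_derive_shift (fun t => Fcn t h) (PI / 2) t _ (is_derive_Fcn h (PI / 2 + t) Hh)).
Qed.

Lemma is_derive_Cd (t : R) : is_derive (Cd h) t (- (Sd h t * Nd h t)).
Proof.
  apply is_derive_eq with (Fcn (PI / 2 + t) h * Fdn (PI / 2 + t) h). 2: unfold Sd, Nd; ring.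
  exact (is_derive_shift (fun t => Fsn t h) (PI / 2) t _ (is_derive_Fsn h (PI / 2 + t) Hh)).
Qed.

Lemma is_derive_Nd (t : R) : is_derive (Nd h) t (Sd h t * Cd h t).
Proof.
  apply is_derive_eq with (- (Fsn (PI / 2 + t) h * Fcn (PI / 2 + t) h)). 2: unfold Sd, Cd; ring.
  exact (is_derive_shift (fun t => Fdn t h) (PI / 2) t _ (is_derive_Fdn h (PI / 2 + t) Hh)).
Qed.

Lemma Nd_pos (t : R) : 0 < Nd h t.
Proof. exact (Fdn_pos h Hh (PI / 2 + t)). Qed.

Lemma Nd_sq (t : R) : Nd h t ^ 2 = nn h ^ 2 + Sd h t ^ 2.
Proof. unfold Nd, Sd. rewrite (Fdn_nn h Hh). ring. Qed.

Lemma Cd_sq (t : R) : Cd h t ^ 2 = cc h ^ 2 - Sd h t ^ 2.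
Proof. unfold Cd, Sd. pose proof (Fsn_Fcn_sq h Hh (PI / 2 + t)). lra. Qed.

Lemma Sd_0 : Sd h 0 = 0.
Proof. unfold Sd. rewrite Rplus_0_r, Fcn_PI2. ring. Qed.

Lemma Cd_0 : Cd h 0 = cc h.
Proof. unfold Cd. rewrite Rplus_0_r, Fsn_amp, amp_PI2, sin_PI2 by auto. ring. Qed.

Lemma Nd_0 : Nd h 0 = nn h.
Proof. unfold Nd. rewrite Rplus_0_r. apply Fdn_PI2, Hh. Qed.

(** In elliptic terms [Sd = cc k' sd] and [k' = nn / zz], whence the constant. A neighbourhood of 0,
    on which [Cd] stays positive, is enough for the Maclaurin coefficients. *)
Lemma sd_local : locally 0 (fun t => sd (zz h * t) (kk h) = zz h / (cc h * nn h) * Sd h t).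
Proof.
  assert (L : locally 0 (fun t => 0 < Cd h t)).
  { assert (Cont : continuous (Cd h) 0).
    { apply (ex_derive_cont (Cd h) 0). eexists; apply is_derive_Cd. }
    apply (Cont (fun y => 0 < y)). apply (open_gt 0). rewrite Cd_0. exact Pc. }
  destruct L as [d Hd]. exists d. intros t Ht. change (Rabs (t - 0) < d) in Ht. rewrite Rminus_0_r in Ht.
  assert (HC : forall u, Rabs u < d -> 0 < Cd h u).
  { intros u Hu. apply Hd. change (Rabs (u - 0) < d). now rewrite Rminus_0_r. }
  (* The quotient sn/cn at zz t, that is, the tangent of the amplitude: [Sd / Cd] equals k'
     sn/cn. *)
  set (q := fun t => zz h / nn h * (Sd h t / Cd h t)).
  assert (N1 : forall u, Rabs u < d -> 1 + q u ^ 2 = (cc h * Nd h u / (nn h * Cd h u)) ^ 2).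
  { intros u Hu. specialize (HC u Hu). unfold q.
    replace ((cc h * Nd h u / (nn h * Cd h u)) ^ 2) with (cc h ^ 2 * Nd h u ^ 2 / (nn h ^ 2 * Cd h u ^ 2)) by (field; lra).
    replace ((zz h / nn h * (Sd h u / Cd h u)) ^ 2) with (zz h ^ 2 * Sd h u ^ 2 / (nn h ^ 2 * Cd h u ^ 2)) by (field; lra).
    replace (zz h ^ 2) with (nn h ^ 2 + cc h ^ 2) by lra.
    rewrite Nd_sq. replace (Sd h u ^ 2) with (cc h ^ 2 - Cd h u ^ 2) by (rewrite Cd_sq; ring). field. lra. }
  assert (SQ : forall u, Rabs u < d -> sin (atan (q u)) ^ 2 = (zz h * Sd h u / (cc h * Nd h u)) ^ 2).
  { intros u Hu. rewrite sin_atan_sq, N1 by auto. specialize (HC u Hu). pose proof (Nd_pos u). unfold q. field. lra. }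
  assert (DN : forall u, Rabs u < d -> 1 - kk h ^ 2 * sin (atan (q u)) ^ 2 = (nn h / Nd h u) ^ 2).
  { intros u Hu. rewrite SQ by auto. pose proof (Nd_pos u). unfold kk.
    replace ((nn h / Nd h u) ^ 2) with (nn h ^ 2 / Nd h u ^ 2) by (field; lra).
    replace ((cc h / zz h) ^ 2 * (zz h * Sd h u / (cc h * Nd h u)) ^ 2) with (Sd h u ^ 2 / Nd h u ^ 2) by (field; lra).
    replace (nn h ^ 2) with (Nd h u ^ 2 - Sd h u ^ 2) by (rewrite Nd_sq; ring). field. lra. }
  assert (E : ellF (atan (q t)) (kk h) = zz h * t).
  { apply (linear_near0 (fun t => ellF (atan (q t)) (kk h)) (zz h) d); auto.
    - intros u Hu. pose proof (HC u Hu) as Cu. pose proof (Nd_pos u) as Nu.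
      assert (Q : is_derive q u (zz h / nn h * (Nd h u * cc h ^ 2 / Cd h u ^ 2))).
      { unfold q. apply is_derive_eq with (scal (zz h / nn h) ((Cd h u * Nd h u * Cd h u - Sd h u * - (Sd h u * Nd h u)) / Cd h u ^ 2)).
        - apply is_derive_cmult.
          apply is_derive_div. apply is_derive_Sd. apply is_derive_Cd. lra.
        - unscal.
          replace (cc h * (cc h * 1)) with (Cd h u ^ 2 + Sd h u ^ 2) by (rewrite Cd_sq; ring). field. lra. }
      eapply is_derive_eq.
      + apply is_derive_ellF_comp with (w := nn h / Nd h u). apply kk_abs, Hh.
        apply Rdiv_lt_0_compat; auto. apply is_derive_atan_comp, Q. cbv beta. apply DN, Hu.
      + cbv beta. rewrite N1 by auto. field. lra.
    - unfold q. rewrite Sd_0. unfold Rdiv. rewrite Rmult_0_l, Rmult_0_r, atan_0. apply ellF_0. }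
  assert (A := am_eq _ _ _ (kk_abs h Hh) E).
  unfold sd, dn, sn. rewrite A. rewrite DN by auto.
  pose proof (Nd_pos t). pose proof (HC t Ht).
  assert (P1 : 0 < nn h / Nd h t) by (apply Rdiv_lt_0_compat; auto).
  rewrite sqrt_pow2 by lra.
  rewrite sin_atan. unfold Rsqr. replace (1 + q t * q t) with ((cc h * Nd h t / (nn h * Cd h t)) ^ 2) by (rewrite <- N1 by auto; ring).
  rewrite sqrt_pow2. unfold q. field. lra.
  apply Rlt_le, Rdiv_lt_0_compat; apply Rmult_lt_0_compat; auto.
Qed.

(* [sin (PI / 2 * x)] is (-1)^j at x = 2j + 1. *)
Definition altsum (s : nat) (u : R -> R) (h : R) : R := LS (fun x => x ^ s * sin (PI / 2 * x)) 1 u h.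

Lemma Derive_n_family (G : nat -> R -> R) : (forall k u, is_derive (G k) u (G (S k) u)) ->
  forall n u, Derive_n (G O) n u = G n u.
Proof.
  intros H. induction n as [|n IH]; intros u. reflexivity.
  simpl. rewrite (Derive_ext _ (G n)) by auto. apply is_derive_unique, H.
Qed.

Lemma Derive_n_Sd (i : nat) (C : R) :
  Derive_n (fun u => C * Sd h (/ zz h * u)) (2 * i + 1) 0
  = C * (/ zz h) ^ (2 * i + 1) * ((-1) ^ i * altsum (2 * i + 1) sech h).
Proof.
  set (w := fun (k : nat) (t : R) =>
    LS (fun x => x ^ k * cos (PI / 2 * x + t * x + INR k * (PI / 2))) 1 sech h).
  assert (dw : forall k t, is_derive (w k) t (w (S k) t)).
  { intros k t. unfold w. rewrite S_INR, Rmult_plus_distr_r, Rmult_1_l.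
    apply is_derive_LS_trig; auto. apply sech_dec, Hh. }
  rewrite (Derive_n_ext _ (fun u => (C * (/ zz h) ^ 0) * - w O (/ zz h * u))).
  - rewrite (Derive_n_family (fun k u => (C * (/ zz h) ^ k) * - w k (/ zz h * u))).
    + rewrite Rmult_0_r. f_equal. unfold w, altsum, LS. rewrite <- ZS_scal.
      rewrite (ZS_ext _ (fun j => -1 * ((-1) ^ i * (fr 1 j ^ (2 * i + 1) * sin (PI / 2 * fr 1 j) * sech (fr 1 j * h))))).
      rewrite ZS_scal. ring.
      intros j. rewrite plus_INR, mult_INR. simpl (INR 2). simpl (INR 1).
      generalize (PI / 2 * fr 1 j). intros a.
      assert (E : forall i, cos (a + INR i * PI + PI / 2) = - (sin a * (-1) ^ i)).
      { induction i0 as [|n IH]. simpl. rewrite Rmult_0_l, Rplus_0_r, cos_plus, cos_PI2, sin_PI2. ring.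
        rewrite S_INR. replace (a + (INR n + 1) * PI + PI / 2) with (a + INR n * PI + PI / 2 + PI) by ring.
        rewrite neg_cos, IH. simpl. ring. }
      replace (a + 0 * fr 1 j + ((1 + 1) * INR i + 1) * (PI / 2)) with (a + INR i * PI + PI / 2) by field.
      rewrite E. ring.
    + intros k u. eapply is_derive_eq. apply is_derive_cmult, (is_derive_opp (fun u => w k (/ zz h * u))).
      apply (is_derive_chain (w k) (fun u => / zz h * u)). apply dw. auto_derive; auto.
      unfold opp; simpl. ring.
  - intros u. unfold w, Sd, Fcn. rewrite Rmult_1_r. do 2 f_equal. apply LS_ext. intros j.
    rewrite Rmult_1_l. do 2 f_equal. simpl. ring.
Qed.

(** The odd derivatives at 0 of one function, computed from the assumed Maclaurin series of sd and
    from the Fourier series [Sd]. *)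
Lemma coeff_altsum (p : nat -> {poly int}) : sd_maclaurin p -> forall i,
  altsum (2 * i + 1) sech h
  = (-1) ^ i * (cc h * nn h * zz h ^ (2 * i)) * pder (p (2 * i + 1)%nat) 0 (kk h ^ 2).
Proof.
  intros hp i. specialize (hp (kk h) (kk_bounds h Hh)).
  set (c := fun m => pder (p (2 * m + 1)%nat) 0 (kk h ^ 2) / INR (fact (2 * m + 1))).
  (* The coefficients interleaved with zeros, so that the odd series becomes a power series in u. *)
  set (a := fun n => if Nat.odd n then c (Nat.div2 n) else 0).
  assert (Aodd : forall m, a (2 * m + 1)%nat = c m).
  { intros m. unfold a. rewrite Nat.add_1_r, Nat.odd_succ, Nat.even_mul. simpl Nat.even. simpl orb. cbv iota.
    rewrite Nat.div2_succ_double. reflexivity. }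
  assert (Aeven : forall m, a (2 * m)%nat = 0).
  { intros m. unfold a. rewrite Nat.odd_mul. reflexivity. }
  assert (PS : locally 0 (fun u => is_pseries a u (sd u (kk h)))).
  { apply filter_imp with (2 := hp). intros u Hu.
    assert (Ev : forall y, is_pseries (fun n => a (2 * n)%nat) y 0).
    { intros y. apply is_pseries_R. apply is_series_ext with (fun _ => 0).
      intros n. rewrite Aeven. eqR. ring.
      apply is_series_zero. }
    (* Factoring u out of the odd series requires u to be nonzero; at u = 0 the hypothesis itself
       yields sd 0 = 0. *)
    destruct (Req_dec u 0) as [->|Hu0].
    - assert (E0 : sd 0 (kk h) = 0).
      { apply is_series_unique in Hu. rewrite <- Hu. apply is_series_unique.
        apply is_series_ext with (fun _ => 0). intros n. rewrite (pow_i (2 * n + 1)) by lia.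
        eqR. ring. apply is_series_zero. }
      rewrite E0. rewrite <- (Aeven O). exact (is_pseries_0 (K := R_AbsRing) (V := R_NormedModule) a).
    - replace (sd u (kk h)) with (0 + u * (/ u * sd u (kk h))) by (field; auto).
      apply is_pseries_odd_even. apply Ev.
      apply is_pseries_R. apply is_series_ext with (fun m => scal (/ u) (c m * u ^ (2 * m + 1))).
      + intros m. rewrite Aodd. change (/ u * (c m * u ^ (2 * m + 1)) = c m * (u ^ 2) ^ m).
        rewrite pow_add, pow_mult, pow_1. field. auto.
      + exact (is_series_scal (K := R_AbsRing) (V := R_NormedModule) (/ u) _ _ Hu). }
  (* Convergence at the single point d/2 forces the radius to be at least d/2. *)
  assert (Rad : Rbar_lt 0 (CV_radius a)).
  { destruct PS as [d Hd]. pose proof (cond_pos d) as Pd.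
    apply Rbar_lt_le_trans with (d / 2). simpl. lra.
    apply Rbar_not_lt_le. intros Hlt.
    assert (Hd2 : Rabs (d / 2) = d / 2) by (apply Rabs_pos_eq; lra).
    apply (CV_disk_outside a (d / 2)). rewrite Hd2. exact Hlt.
    assert (Hx : is_pseries a (d / 2) (sd (d / 2) (kk h))).
    { apply Hd. change (Rabs (d / 2 - 0) < d). rewrite Rminus_0_r, Hd2. lra. }
    apply is_pseries_R in Hx. apply ex_series_lim_0. eexists. apply Hx. }
  assert (D := Derive_n_coef a (2 * i + 1) Rad). rewrite Aodd in D.
  assert (Loc : locally 0 (fun u => PSeries a u = zz h / (cc h * nn h) * Sd h (/ zz h * u))).
  { destruct PS as [d1 Hd1]. destruct sd_local as [d2 Hd2].
    assert (Pd : 0 < Rmin d1 (d2 * zz h)).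
    { apply Rmin_pos. apply cond_pos. apply Rmult_lt_0_compat. apply cond_pos. exact Pz. }
    exists (mkposreal _ Pd). intros u Hu. change (Rabs (u - 0) < Rmin d1 (d2 * zz h)) in Hu.
    rewrite Rminus_0_r in Hu.
    pose proof (Rmin_l d1 (d2 * zz h)). pose proof (Rmin_r d1 (d2 * zz h)).
    assert (H1 : is_pseries a u (sd u (kk h))).
    { apply Hd1. change (Rabs (u - 0) < d1). rewrite Rminus_0_r. lra. }
    rewrite (is_pseries_unique _ _ _ H1). rewrite <- Hd2.
    - assert (Cz : forall v : R, zz h * (/ zz h * v) = v) by (intros; field; lra).
      rewrite Cz. reflexivity.
    - change (Rabs (/ zz h * u - 0) < d2). rewrite Rminus_0_r, Rabs_mult, Rabs_inv, (Rabs_pos_eq (zz h)) by lra.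
      apply Rmult_lt_reg_l with (zz h); auto. rewrite <- Rmult_assoc, Rinv_r by lra. lra. }
  rewrite (Derive_n_ext_loc _ _ (2 * i + 1) 0 Loc) in D. rewrite Derive_n_Sd in D. unfold c in D.
  replace (pder (p (2 * i + 1)%nat) 0 (kk h ^ 2) / INR (fact (2 * i + 1)) * INR (fact (2 * i + 1)))
    with (pder (p (2 * i + 1)%nat) 0 (kk h ^ 2)) in D by (field; apply INR_fact_neq_0).
  rewrite <- D. rewrite pow_inv, pow_add, pow_1.
  assert (zz h ^ (2 * i) <> 0) by (apply pow_nonzero; lra).
  transitivity ((-1) ^ i * (-1) ^ i * altsum (2 * i + 1) sech h). rewrite sign_sq; ring. field. lra.
Qed.

End SdSeries.

Lemma is_derive_RInt_0 (f : R -> R) (x : R) : (forall t, continuous f t) ->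
  is_derive (fun s => RInt f 0 s) x (f x).
Proof.
  intros H. apply (is_derive_RInt f (fun s => RInt f 0 s) 0 x).
  - apply filter_forall. intros y. apply (RInt_correct (V := R_CompleteNormedModule)).
    apply (ex_RInt_continuous (V := R_CompleteNormedModule)). intros; apply H.
  - apply H.
Qed.

(** * The value of Gamma at 1/4 *)

Definition expint (n : nat) (s : R) : R := RInt (fun v => exp (- v ^ n)) 0 s.

Lemma continuous_exp_pow (n : nat) (t : R) : continuous (fun v => exp (- v ^ n)) t.
Proof. apply ex_derive_cont. auto_derive; auto. Qed.

Lemma is_derive_expint (n : nat) (s : R) : is_derive (expint n) s (exp (- s ^ n)).
Proof. apply (is_derive_RInt_0 (fun v => exp (- v ^ n))). apply continuous_exp_pow. Qed.

Lemma expint_0 (n : nat) : expint n 0 = 0.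
Proof. apply (RInt_point (V := R_CompleteNormedModule)). Qed.

Lemma continuity_2d_pt_pow (f : R -> R -> R) (n : nat) (x y : R) :
  continuity_2d_pt f x y -> continuity_2d_pt (fun u v => f u v ^ n) x y.
Proof.
  intros H. induction n as [|n IH]. apply (continuity_2d_pt_const x y 1).
  apply (continuity_2d_pt_mult f (fun u v => f u v ^ n)); auto.
Qed.

Lemma ex_RInt_cont (f : R -> R) (a b : R) : (forall t, continuous f t) -> ex_RInt f a b.
Proof. intros H. apply (ex_RInt_continuous (V := R_CompleteNormedModule)). auto. Qed.

(* The derivative of the left side is [2 e^(-s^n) * int_0^s e^(-x^n) dx]; substituting [x = s u]
   turns it into the integral over [u] of the derivative of [H s u]. *)
Lemma expint_sq (n : nat) (H : R -> R -> R) :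
  (forall u, H 0 u = 0) ->
  (forall s u, is_derive (fun s => H s u) s (2 * s * exp (- (s ^ n * (1 + u ^ n))))) ->
  (forall s u, continuous (H s) u) ->
  forall s, expint n s ^ 2 = RInt (H s) 0 1.
Proof.
  intros H0 Hder Hcont s.
  assert (D1 : forall s, is_derive (fun s => expint n s ^ 2) s (2 * expint n s * exp (- s ^ n))).
  { intros t. assert (E : ex_derive (expint n) t) by (eexists; apply is_derive_expint).
    auto_derive; auto. rewrite (is_derive_unique (fun x : R => expint n x) _ _ (is_derive_expint n t)). ring. }
  assert (Scale : forall t, expint n t = RInt (fun u => t * exp (- (t * u) ^ n)) 0 1).
  { intros t. unfold expint.
    pose proof (RInt_comp_lin (V := R_CompleteNormedModule) (fun v => exp (- v ^ n)) t 0 0 1) as E.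
    replace (t * 0 + 0) with 0 in E by ring. replace (t * 1 + 0) with t in E by ring.
    rewrite <- E by (apply ex_RInt_cont, continuous_exp_pow).
    apply RInt_ext. intros x _. rewrite Rplus_0_r. reflexivity. }
  assert (D2 : forall s, is_derive (fun s => RInt (H s) 0 1) s (2 * expint n s * exp (- s ^ n))).
  { intros t.
    apply is_derive_eq with (RInt (fun u => Derive (fun s => H s u) t) 0 1).
    - apply (is_derive_RInt_param H 0 1 t).
      + apply filter_forall. intros x u _. eexists. apply Hder.
      + intros u _.
        apply continuity_2d_pt_ext with (fun x y => 2 * x * exp (- (x ^ n * (1 + y ^ n)))).
        intros x y. symmetry. apply is_derive_unique, Hder.
        apply continuity_2d_pt_mult. apply continuity_2d_pt_mult. apply continuity_2d_pt_const.
        apply continuity_2d_pt_id1.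
        apply (continuity_1d_2d_pt_comp exp (fun x y => - (x ^ n * (1 + y ^ n)))).
        apply derivable_continuous_pt, derivable_pt_exp.
        apply continuity_2d_pt_opp, continuity_2d_pt_mult.
        apply (continuity_2d_pt_pow (fun x _ => x)), continuity_2d_pt_id1.
        apply continuity_2d_pt_plus. apply continuity_2d_pt_const.
        apply (continuity_2d_pt_pow (fun _ y => y)), continuity_2d_pt_id2.
      + apply filter_forall. intros y. apply ex_RInt_cont. apply Hcont.
    - rewrite Scale.
      transitivity (RInt (fun u => scal (2 * exp (- t ^ n)) (t * exp (- (t * u) ^ n))) 0 1).
      + apply RInt_ext. intros u _. unscal.
        rewrite (is_derive_unique (fun s : R => H s u) _ _ (Hder t u)).
        rewrite Rpow_mult_distr.
        replace (- (t ^ n * (1 + u ^ n))) with (- t ^ n + - (t ^ n * u ^ n)) by ring.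
        rewrite exp_plus. eqR. ring.
      + rewrite (RInt_scal (V := R_CompleteNormedModule)).
        unscal. ring.
        apply ex_RInt_cont. intros x. apply ex_derive_cont. auto_derive; auto. }
  assert (E : expint n s ^ 2 - RInt (H s) 0 1 = expint n 0 ^ 2 - RInt (H 0) 0 1).
  { apply (constant_everywhere (fun s => expint n s ^ 2 - RInt (H s) 0 1)).
    intros t. eapply is_derive_eq. apply (is_derive_minus (V := R_NormedModule)). apply D1. apply D2.
    unfold minus, plus, opp; simpl. ring. }
  rewrite expint_0 in E.
  assert (E0 : RInt (H 0) 0 1 = 0).
  { transitivity (RInt (fun _ => 0) 0 1). apply RInt_ext. intros; apply H0.
    rewrite RInt_cst; eqR; ring. }
  rewrite E0 in E. lra.
Qed.

(** The Gaussian case: 2 s e^(-s^2 (1 + u^2)) has the elementary primitive (1 - e^(-s^2 (1 + u^2)))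
    / (1 + u^2) in s. Its first part integrates to atan 1 and the second is at most e^(-s^2). *)
Lemma expint2_bounds (s : R) : PI / 4 - exp (- s ^ 2) <= expint 2 s ^ 2 <= PI / 4.
Proof.
  assert (P : forall u, 0 < 1 + u ^ 2) by (intros u; pose proof (pow2_ge_0 u); lra).
  assert (C1 : forall u, continuous (fun u => / (1 + u ^ 2)) u).
  { intros u. apply ex_derive_cont. auto_derive; auto. simpl in P. specialize (P u). lra. }
  assert (C2 : forall u, continuous (fun u => exp (- (s ^ 2 * (1 + u ^ 2))) / (1 + u ^ 2)) u).
  { intros u. apply ex_derive_cont. auto_derive; auto. simpl in P. specialize (P u). lra. }
  assert (I1 : RInt (fun u => / (1 + u ^ 2)) 0 1 = PI / 4).
  { replace (PI / 4) with (minus (atan 1) (atan 0)).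
    2: { rewrite atan_1, atan_0. unfold minus, plus, opp; simpl. ring. }
    apply is_RInt_unique. apply (is_RInt_derive (V := R_CompleteNormedModule) atan); intros x _; auto.
    apply is_derive_eq with (/ (1 + x²)). apply is_derive_atan. unfold Rsqr. f_equal. ring. }
  rewrite (expint_sq 2 (fun s u => / (1 + u ^ 2) - exp (- (s ^ 2 * (1 + u ^ 2))) / (1 + u ^ 2))).
  - set (J := RInt (fun u => exp (- (s ^ 2 * (1 + u ^ 2))) / (1 + u ^ 2)) 0 1).
    assert (EJ : RInt (fun u => / (1 + u ^ 2) - exp (- (s ^ 2 * (1 + u ^ 2))) / (1 + u ^ 2)) 0 1 = PI / 4 - J).
    { rewrite <- I1. apply (RInt_minus (V := R_CompleteNormedModule) (fun u => / (1 + u ^ 2))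
        (fun u => exp (- (s ^ 2 * (1 + u ^ 2))) / (1 + u ^ 2))); apply ex_RInt_cont; auto. }
    rewrite EJ.
    assert (0 <= J <= exp (- s ^ 2)).
    { split.
      - replace 0 with (RInt (fun _ => 0) 0 1).
        2: { rewrite RInt_cst; eqR; ring. }
        apply RInt_le; try lra. apply ex_RInt_const. apply ex_RInt_cont; auto.
        intros x _. apply Rlt_le, Rdiv_lt_0_compat. apply exp_pos. apply P.
      - replace (exp (- s ^ 2)) with (RInt (fun _ => exp (- s ^ 2)) 0 1).
        2: { rewrite RInt_cst; eqR; ring. }
        apply RInt_le; try lra. apply ex_RInt_cont; auto. apply ex_RInt_const.
        intros x _. specialize (P x). pose proof (pow2_ge_0 x). pose proof (pow2_ge_0 s).
        apply Rle_trans with (exp (- (s ^ 2 * (1 + x ^ 2)))).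
        + apply Rmult_le_reg_r with (1 + x ^ 2); auto. unfold Rdiv. rewrite Rmult_assoc, Rinv_l by lra.
          pose proof (exp_pos (- (s ^ 2 * (1 + x ^ 2)))). nra.
        + apply exp_le. nra. }
    lra.
  - intros u. replace (- (0 ^ 2 * (1 + u ^ 2))) with 0 by ring. rewrite exp_0. specialize (P u). field. lra.
  - intros t u. specialize (P u). simpl in P. auto_derive. lra. simpl. field. lra.
  - intros t u. apply (continuous_minus (V := R_NormedModule)). apply C1.
    apply ex_derive_cont. auto_derive; auto. specialize (P u). simpl in P. lra.
Qed.

Lemma expint_incr (n : nat) (x y : R) : x <= y -> expint n x <= expint n y.
Proof.
  intros [H|H]. 2: rewrite H; lra.
  apply Rlt_le, (incr_function (expint n) m_infty p_infty (fun s => exp (- s ^ n))); simpl; auto.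
  intros; apply is_derive_expint. intros; apply exp_pos.
Qed.

Lemma expint_nonneg (n : nat) (s : R) : 0 <= s -> 0 <= expint n s.
Proof. intros H. rewrite <- (expint_0 n). apply expint_incr, H. Qed.

Lemma expint2_upper (s : R) : 0 <= s -> expint 2 s <= sqrt PI / 2.
Proof.
  intros Hs. pose proof (expint_nonneg 2 s Hs). destruct (expint2_bounds s) as [_ B].
  pose proof PI_RGT_0.
  assert (sqrt PI ^ 2 = PI) by (apply pow2_sqrt; lra). pose proof (sqrt_pos PI).
  apply Rnot_lt_le. intros Hc. nra.
Qed.

(** A lemniscatic integral, the angular part of the square of the integral of e^(-x^4). *)
Definition quartint : R := RInt (fun u => / sqrt (1 + u ^ 4)) 0 1.

Lemma quart_pos (u : R) : 1 <= 1 + u ^ 4.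
Proof. replace (u ^ 4) with ((u ^ 2) ^ 2) by ring. pose proof (pow2_ge_0 (u ^ 2)). lra. Qed.

Lemma sqrt_quart (u : R) : 1 <= sqrt (1 + u ^ 4).
Proof. rewrite <- sqrt_1 at 1. apply sqrt_le_1_alt, quart_pos. Qed.

Lemma continuous_quart (u : R) : continuous (fun u => / sqrt (1 + u ^ 4)) u.
Proof.
  apply ex_derive_cont. pose proof (quart_pos u) as P. pose proof (sqrt_quart u) as P2.
  simpl in P, P2. auto_derive. repeat split; auto; lra.
Qed.

Lemma continuous_quart_expint (s u : R) :
  continuous (fun u => expint 2 (s ^ 2 * sqrt (1 + u ^ 4)) * / sqrt (1 + u ^ 4)) u.
Proof.
  apply (continuous_mult (fun u => expint 2 (s ^ 2 * sqrt (1 + u ^ 4))) (fun u => / sqrt (1 + u ^ 4))).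
  2: apply continuous_quart.
  apply (continuous_comp (fun u => s ^ 2 * sqrt (1 + u ^ 4)) (expint 2)).
  - apply ex_derive_cont. pose proof (quart_pos u) as P. simpl in P.
    auto_derive. lra.
  - apply (is_derive_cont _ _ _ (is_derive_expint 2 _)).
Qed.

(** With w^2 = 1 + u^4 the substitution v = s^2 w turns 2 s e^(-s^4 w^2) ds into e^(-v^2) dv / w, so
    the radial integration is Gaussian. *)
Lemma expint4_sq (s : R) :
  expint 4 s ^ 2 = RInt (fun u => expint 2 (s ^ 2 * sqrt (1 + u ^ 4)) * / sqrt (1 + u ^ 4)) 0 1.
Proof.
  apply (expint_sq 4 (fun s u => expint 2 (s ^ 2 * sqrt (1 + u ^ 4)) * / sqrt (1 + u ^ 4))).
  - intros u. replace (0 ^ 2 * sqrt (1 + u ^ 4)) with 0 by ring. rewrite expint_0. ring.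
  - intros t u. pose proof (sqrt_quart u) as P. set (w := sqrt (1 + u ^ 4)) in *.
    assert (W : w ^ 2 = 1 + u ^ 4). { apply pow2_sqrt. pose proof (quart_pos u); lra. }
    apply is_derive_ext with (fun s => scal (/ w) (expint 2 (s ^ 2 * w))).
    intros; unscal; ring.
    apply is_derive_eq with (scal (/ w) (scal (2 * t * w) (exp (- (t ^ 2 * w) ^ 2)))).
    + apply is_derive_cmult.
      apply (is_derive_chain (expint 2) (fun s => s ^ 2 * w)). apply is_derive_expint.
      auto_derive; auto. ring.
    + unfold scal; simpl (scal _ _); unfold mult; simpl mult.
      replace ((t ^ 2 * w) ^ 2) with (t ^ 4 * w ^ 2) by ring. rewrite W. 
      change (/ w * (2 * t * w * exp (- (t ^ 4 * (1 + u ^ 4)))) = 2 * t * exp (- (t ^ 4 * (1 + u ^ 4)))).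
      field. lra.
  - intros t u. apply continuous_quart_expint.
Qed.

Lemma quartint_pos : 0 < quartint.
Proof.
  unfold quartint. replace 0 with (RInt (fun _ => 0) 0 1) at 1.
  2: { rewrite RInt_cst; eqR; ring. }
  apply RInt_lt. lra. intros; apply continuous_quart. intros; apply continuous_const.
  intros x _. apply Rinv_0_lt_compat. pose proof (sqrt_quart x). lra.
Qed.

Lemma expint4_bounds (s : R) :
  expint 2 (s ^ 2) * quartint <= expint 4 s ^ 2 <= sqrt PI / 2 * quartint.
Proof.
  rewrite expint4_sq. unfold quartint.
  assert (Sc : forall c, c * RInt (fun u => / sqrt (1 + u ^ 4)) 0 1 = RInt (fun u => c * / sqrt (1 + u ^ 4)) 0 1).
  { intros c. symmetry. apply (RInt_scal (V := R_CompleteNormedModule) (fun u => / sqrt (1 + u ^ 4))).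
    apply ex_RInt_cont, continuous_quart. }
  assert (Cc : forall c t, continuous (fun u => c * / sqrt (1 + u ^ 4)) t).
  { intros c t. apply (continuous_mult (fun _ => c) (fun u => / sqrt (1 + u ^ 4))). apply continuous_const. apply continuous_quart. }
  pose proof (pow2_ge_0 s).
  rewrite !Sc. split; apply RInt_le; try lra; try (apply ex_RInt_cont; auto; intros; apply continuous_quart_expint);
    intros x _; pose proof (sqrt_quart x); (apply Rmult_le_compat_r; [apply Rlt_le, Rinv_0_lt_compat; lra|]).
  - apply expint_incr. nra.
  - apply expint2_upper. nra.
Qed.

(** The substitution u = tan(phi/2): then sin phi = 2u / (1 + u^2), and 1 - sin^2(phi) / 2 = (1 +
    u^4) / (1 + u^2)^2. *)
Lemma quartint_ellK (k : R) : k ^ 2 = 1 / 2 -> quartint = ellK k / 2.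
Proof.
  intros Hk.
  assert (Hk1 : Rabs k < 1). { apply Rabs_def1; nra. }
  apply is_RInt_unique.
  replace (ellK k / 2) with (minus (ellF (2 * atan 1) k / 2) (ellF (2 * atan 0) k / 2)).
  2: { rewrite atan_1, atan_0, Rmult_0_r, ellF_0. unfold ellK, minus, plus, opp; simpl.
       replace (2 * (PI / 4)) with (PI / 2) by field. field. }
  apply (is_RInt_derive (V := R_CompleteNormedModule) (fun u => ellF (2 * atan u) k / 2)).
  - intros u _.
    assert (E1 : is_derive (fun u => 2 * atan u) u (2 / (1 + u ^ 2))).
    { apply is_derive_eq with (2 * (/ (1 + Rsqr u))). apply is_derive_cmult. apply is_derive_atan.
      unfold Rsqr, Rdiv. do 2 f_equal. ring. }
    pose proof (sqrt_quart u) as P. pose proof (pow2_ge_0 u) as P2.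
    set (w := sqrt (1 + u ^ 4)) in *.
    assert (W : w ^ 2 = 1 + u ^ 4). { apply pow2_sqrt. pose proof (quart_pos u); lra. }
    apply is_derive_ext with (fun u => / 2 * ellF (2 * atan u) k).
    intros t. eqR. field.
    apply is_derive_eq with (/ 2 * (2 / (1 + u ^ 2) / (w / (1 + u ^ 2)))).
    + apply is_derive_cmult.
      apply is_derive_ellF_comp; auto. apply Rdiv_lt_0_compat; lra.
      assert (S1 : 0 < sqrt (1 + u²)). { apply sqrt_lt_R0. unfold Rsqr. nra. }
      assert (S2 : sqrt (1 + u²) * sqrt (1 + u²) = 1 + u * u). { apply sqrt_sqrt. unfold Rsqr. nra. }
      replace (sin (2 * atan u)) with (2 * u / (1 + u ^ 2)).
      * replace ((w / (1 + u ^ 2)) ^ 2) with (w ^ 2 / (1 + u ^ 2) ^ 2) by (field; lra).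
        rewrite W, Hk. field. lra.
      * rewrite sin_2a, sin_atan, cos_atan.
        replace (1 + u ^ 2) with (sqrt (1 + u²) * sqrt (1 + u²)) by (rewrite S2; ring). field. lra.
    + field. lra.
  - intros u _. apply continuous_quart.
Qed.

(** The integral of e^(-x^4) over the positive half-line. *)
Definition expint4_lim : R := sqrt (sqrt PI / 2 * quartint).

Lemma expint4_lim_pos : 0 < expint4_lim.
Proof.
  apply sqrt_lt_R0, Rmult_lt_0_compat. 2: apply quartint_pos.
  pose proof (sqrt_lt_R0 PI PI_RGT_0). lra.
Qed.

Lemma expint4_converges : exists C, 0 < C /\
  forall s, 1 <= s -> Rabs (expint 4 s - expint4_lim) <= C / (1 + s).
Proof.
  pose proof quartint_pos as Q. pose proof expint4_lim_pos as P.
  pose proof PI_RGT_0.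
  assert (c0 : 0 < sqrt PI / 2) by (pose proof (sqrt_lt_R0 PI PI_RGT_0); lra).
  assert (c2 : (sqrt PI / 2) ^ 2 = PI / 4).
  { replace ((sqrt PI / 2) ^ 2) with (sqrt PI ^ 2 / 4) by field. rewrite pow2_sqrt by lra. reflexivity. }
  assert (L2 : expint4_lim ^ 2 = sqrt PI / 2 * quartint).
  { apply pow2_sqrt. apply Rmult_le_pos; lra. }
  set (c := sqrt PI / 2) in *. set (L := expint4_lim) in *.
  exists (quartint / (c * L)). split. apply Rdiv_lt_0_compat; auto. apply Rmult_lt_0_compat; auto.
  intros s Hs.
  destruct (expint4_bounds s) as [B1 B2]. fold c in B2.
  destruct (expint2_bounds (s ^ 2)) as [B3 _].
  assert (Ps2 : 0 <= s ^ 2) by apply pow2_ge_0.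
  pose proof (expint2_upper (s ^ 2) Ps2) as B4. fold c in B4.
  pose proof (expint_nonneg 2 (s ^ 2) Ps2) as B5.
  set (x := expint 2 (s ^ 2)) in *.
  assert (Ex : exp (- (s ^ 2) ^ 2) <= / (1 + s)).
  { apply Rle_trans with (exp (- s)). apply exp_le.
    assert (s <= s ^ 2) by (simpl; nra). assert (s ^ 2 <= (s ^ 2) ^ 2) by (simpl (_ ^ 2) at 2; nra). lra.
    rewrite exp_Ropp. apply Rinv_le_contravar. lra. apply exp_ineq1_le. }
  (* From (c - x)(c + x) <= e^(-s^4) and c + x >= c. *)
  assert (B6 : c * (c - x) <= / (1 + s)) by nra.
  pose proof (expint_nonneg 4 s ltac:(lra)) as B7. set (y := expint 4 s) in *.
  assert (yL : y <= L) by nra.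
  rewrite Rabs_left1 by lra.
  assert (B8 : L * (L - y) <= (c - x) * quartint).
  { assert (y * y <= L * y) by (apply Rmult_le_compat_r; lra).
    replace (L * (L - y)) with (L ^ 2 - L * y) by ring. rewrite L2. simpl in B1. lra. }
  unfold Rdiv. apply Rmult_le_reg_l with (c * L). apply Rmult_lt_0_compat; auto.
  replace (c * L * (quartint * / (c * L) * / (1 + s))) with (quartint * / (1 + s)) by (field; lra).
  nra.
Qed.

Lemma expint_le_id (n : nat) (s : R) : 0 <= s -> expint n s <= s.
Proof.
  intros Hs. unfold expint.
  replace s with (RInt (fun _ => 1) 0 s) at 2.
  2: { rewrite RInt_cst; eqR; ring. }
  apply RInt_le; auto. apply ex_RInt_cont, continuous_exp_pow. apply ex_RInt_const.
  intros x Hx. rewrite <- exp_0. apply exp_le. pose proof (pow_le x n ltac:(lra)). lra.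
Qed.

Lemma Rpower_quarter_pow4 (x : R) : 0 < x -> Rpower (x ^ 4) (1 / 4) = x.
Proof.
  intros Hx. rewrite <- (Rpower_pow 4 x Hx), Rpower_mult.
  replace (INR 4 * (1 / 4)) with 1 by (simpl; field). apply Rpower_1, Hx.
Qed.

Lemma Rpower_quarter_lt (x t : R) : 0 < x -> 0 < t -> t < x ^ 4 -> Rpower t (1 / 4) < x.
Proof.
  intros Hx Ht H. rewrite <- (Rpower_quarter_pow4 x Hx). apply Rlt_Rpower_l; lra.
Qed.

Lemma Rpower_quarter_gt (x t : R) : 0 < x -> x ^ 4 < t -> x < Rpower t (1 / 4).
Proof.
  intros Hx H. rewrite <- (Rpower_quarter_pow4 x Hx) at 1. apply Rlt_Rpower_l. lra.
  split; auto. apply pow_lt, Hx.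
Qed.

Lemma Rpower_pos (x y : R) : 0 < Rpower x y.
Proof. apply exp_pos. Qed.

(** The substitution t = v^4 in Euler's integral, done through the explicit primitive [F], so that
    both improper ends reduce to estimates of [expint 4]. *)
Lemma Gamma_quarter : Gamma (1 / 4) = 4 * expint4_lim.
Proof.
  set (F := fun t => 4 * expint 4 (Rpower t (1 / 4))).
  assert (DF : forall t, 0 < t -> is_derive F t (Rpower t (1 / 4 - 1) * exp (- t))).
  { intros t Ht.
    assert (DR : is_derive (fun t => Rpower t (1 / 4)) t (1 / 4 * Rpower t (1 / 4 - 1))).
    { apply is_derive_Reals. apply derivable_pt_lim_power, Ht. }
    assert (E4 : Rpower t (1 / 4) ^ 4 = t).
    { rewrite <- Rpower_pow by apply Rpower_pos. rewrite Rpower_mult.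
      replace (1 / 4 * INR 4) with 1 by (simpl; field). apply Rpower_1, Ht. }
    apply is_derive_eq with (4 * (1 / 4 * Rpower t (1 / 4 - 1) * exp (- Rpower t (1 / 4) ^ 4))).
    - apply is_derive_cmult.
      apply (is_derive_chain (expint 4) (fun t => Rpower t (1 / 4))); auto. apply is_derive_expint.
    - rewrite E4. field. }
  assert (Int : forall a b, 0 < a -> 0 < b ->
    is_RInt (fun t => Rpower t (1 / 4 - 1) * exp (- t)) a b (F b - F a)).
  { intros a b Ha Hb. apply (is_RInt_derive (V := R_CompleteNormedModule) F).
    - intros x Hx. apply DF. apply Rlt_le_trans with (Rmin a b); [apply Rmin_pos; auto|lra].
    - intros x Hx. assert (0 < x) by (apply Rlt_le_trans with (Rmin a b); [apply Rmin_pos; auto|lra]).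
      apply (continuous_mult (fun t => Rpower t (1 / 4 - 1)) (fun t => exp (- t))).
      apply is_derive_cont with ((1 / 4 - 1) * Rpower x (1 / 4 - 1 - 1)).
      apply is_derive_Reals. apply derivable_pt_lim_power; auto.
      apply ex_derive_cont. auto_derive; auto. }
  destruct expint4_converges as [C [HC Conv]].
  unfold Gamma. apply (is_RInt_gen_unique (V := R_CompleteNormedModule)).
  intros P [eps HP]. pose proof (cond_pos eps) as Pe.
  (* With these bounds F a <= 4 eps/8, and F b is within 4 C / (1 + M) < eps/2 of its limit. *)
  apply Filter_prod with (fun a => 0 < a < (eps / 8) ^ 4)
    (fun b => (Rmax 1 (8 * C / eps)) ^ 4 < b).
  - assert (Pd : 0 < (eps / 8) ^ 4) by (apply pow_lt; lra).
    exists (mkposreal _ Pd). intros y Hy Hy0. change (Rabs (y - 0) < (eps / 8) ^ 4) in Hy.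
    rewrite Rminus_0_r, Rabs_pos_eq in Hy; lra.
  - exists ((Rmax 1 (8 * C / eps)) ^ 4). intros y Hy. exact Hy.
  - intros a b [Ha Ha'] Hb. simpl.
    pose proof (Rmax_l 1 (8 * C / eps)) as M1. pose proof (Rmax_r 1 (8 * C / eps)) as M2.
    set (M := Rmax 1 (8 * C / eps)) in *.
    assert (Pb : 0 < b). { apply Rlt_trans with (M ^ 4); auto. apply pow_lt. lra. }
    exists (F b - F a). split. apply Int; auto.
    apply HP. change (Rabs (F b - F a - 4 * expint4_lim) < eps).
    assert (Fa : 0 <= F a <= eps / 2).
    { unfold F. pose proof (Rpower_pos a (1 / 4)). pose proof (Rpower_quarter_lt (eps / 8) a ltac:(lra) Ha Ha').
      pose proof (expint_le_id 4 (Rpower a (1 / 4)) ltac:(lra)).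
      pose proof (expint_nonneg 4 (Rpower a (1 / 4)) ltac:(lra)). lra. }
    assert (Fb : Rabs (F b - 4 * expint4_lim) < eps / 2).
    { unfold F. rewrite <- Rmult_minus_distr_l, Rabs_mult, (Rabs_pos_eq 4) by lra.
      pose proof (Rpower_quarter_gt M b ltac:(lra) Hb) as Hg.
      set (s := Rpower b (1 / 4)) in *. pose proof (Conv s ltac:(lra)) as Hc.
      assert (C / (1 + s) < eps / 8).
      { apply Rmult_lt_reg_r with (1 + s). lra. unfold Rdiv at 1. rewrite Rmult_assoc, Rinv_l by lra.
        assert (8 * C <= eps * M).
        { apply Rmult_le_reg_r with (/ eps). apply Rinv_0_lt_compat; lra.
          replace (eps * M * / eps) with M by (field; lra). exact M2. }
        nra. }
      lra. }
    apply Rabs_def2 in Fb. apply Rabs_def1; lra.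
Qed.

Lemma Gamma_quarter_pos : 0 < Gamma (1 / 4).
Proof. rewrite Gamma_quarter. pose proof expint4_lim_pos. lra. Qed.

Lemma Gamma_quarter_sq (k : R) : k ^ 2 = 1 / 2 -> Gamma (1 / 4) ^ 2 = 4 * sqrt PI * ellK k.
Proof.
  intros Hk. rewrite Gamma_quarter, Rpow_mult_distr.
  replace (expint4_lim ^ 2) with (sqrt PI / 2 * quartint).
  - rewrite (quartint_ellK k Hk). field.
  - symmetry. apply pow2_sqrt. pose proof quartint_pos. pose proof (sqrt_pos PI). nra.
Qed.

Lemma zz_half_Gamma : zz (PI / 2) ^ 2 = Gamma (1 / 4) ^ 4 / (4 * PI ^ 3).
Proof.
  pose proof PI_RGT_0 as P.
  replace (Gamma (1 / 4) ^ 4) with ((Gamma (1 / 4) ^ 2) ^ 2) by ring.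
  rewrite (Gamma_quarter_sq (kk (PI / 2)) kk_half_sq), ellK_kk by lra.
  replace ((4 * sqrt PI * (zz (PI / 2) * (PI / 2))) ^ 2) with (4 * sqrt PI ^ 2 * PI ^ 2 * zz (PI / 2) ^ 2) by field.
  rewrite pow2_sqrt by lra. field. lra.
Qed.

From mathcomp Require Import ssreflect.

(** * The symmetry of the Maclaurin polynomials under x -> 1 - x *)

(** For g'^2 = k + l g^2 - g^4 and g'' = g (l - 2 g^2), the second derivative of g P(g^2) is g times
    this polynomial at g^2. The arguments [c2], [c4], [c6] stand for the reals 2, 4, 6. *)
Definition quartic_step (c2 c4 c6 l k : R) (P : {poly R}) : {poly R} :=
  ((l%:P - c2%:P * 'X) * (P + c2%:P * 'X * P^`())
   + (k%:P + l%:P * 'X - 'X * 'X) * (c6%:P * P^`() + c4%:P * 'X * P^`()^`()))%R.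

(* If [g'^2 = k + l g^2 - g^4] then [g^(2j) = g * R_j (g^2)], where [R_j] is this polynomial. *)
Fixpoint quartic_poly (l k : R) (j : nat) : {poly R} :=
  match j with
  | O => 1%R
  | S j => quartic_step 2 4 6 l k (quartic_poly l k j)
  end.

Lemma quartic_step_horner (c2 c4 c6 l k : R) (P : {poly R}) (y : R) :
  ((quartic_step c2 c4 c6 l k P).[y])%R
  = (l - c2 * y) * ((P.[y])%R + c2 * y * (P^`().[y])%R)
    + (k + l * y - y * y) * (c6 * (P^`().[y])%R + c4 * y * (P^`()^`().[y])%R).
Proof. unfold quartic_step. rewrite !hornerE. reflexivity. Qed.

Lemma is_derive_horner (P : {poly R}) (x : R) :
  is_derive (fun y : R => (P.[y])%R) x (P^`().[x])%R.
Proof.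
  revert P. apply (poly_ind (R := R)).
  - apply is_derive_ext with (fun _ : R => 0).
    intros; rewrite horner0; reflexivity.
    rewrite deriv0 horner0. apply is_derive_cst.
  - intros P c IH.
    apply is_derive_ext with (fun y : R => (P.[y])%R * y + c).
    intros; rewrite hornerMXaddC; reflexivity.
    rewrite derivMXaddC hornerD hornerMX.
    apply is_derive_eq with ((P^`().[x])%R * x + (P.[x])%R * 1 + 0).
    + apply (is_derive_add (fun y : R => (P.[y])%R * y) (fun _ => c)).
      apply is_derive_prod; auto.
      apply (is_derive_id (K := R_AbsRing)).
      apply is_derive_cst.
    + match goal with |- _ = ?r => change r with ((P.[x])%R + (P^`().[x])%R * x) end. ring.
Qed.

Lemma is_derive_pder (q : {poly int}) (j : nat) (x : R) :
  is_derive (fun y => pder q j y) x (pder q (S j) x).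
Proof. unfold pder. rewrite derivnS. apply is_derive_horner. Qed.

Lemma is_derive_horner_comp (P : {poly R}) (f : R -> R) (u f' : R) : is_derive f u f' ->
  is_derive (fun u => (P.[f u])%R) u ((P^`().[f u])%R * f').
Proof.
  intros H. apply is_derive_eq with (scal f' (P^`().[f u])%R).
  apply (is_derive_chain (fun y : R => (P.[y])%R) f); auto. apply is_derive_horner.
  unscal; apply Rmult_comm.
Qed.

(** Behind this is the passage from g(u) to -i g(iu), which changes the sign of l and of g^2 and
    multiplies derivatives of order 2j by (-1)^j. The first two derivatives are included because
    [quartic_step] uses them. *)
Lemma quartic_poly_reflect (l k : R) (j : nat) : forall y,
  ((quartic_poly (- l) k j).[y])%R = (-1) ^ j * ((quartic_poly l k j).[- y])%R
  /\ ((quartic_poly (- l) k j)^`().[y])%R = - (-1) ^ j * ((quartic_poly l k j)^`().[- y])%R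
  /\ ((quartic_poly (- l) k j)^`()^`().[y])%R = (-1) ^ j * ((quartic_poly l k j)^`()^`().[- y])%R.
Proof.
  assert (D : forall (P Q : {poly R}) (a : R), (forall y : R, (P.[y])%R = a * (Q.[- y])%R) ->
    forall y : R, (P^`().[y])%R = - a * (Q^`().[- y])%R).
  { intros P Q a H y.
    rewrite <- (is_derive_unique _ _ _ (is_derive_horner P y)).
    apply is_derive_unique. apply is_derive_ext with (fun y : R => a * (Q.[- y])%R).
    intros; symmetry; apply H.
    apply is_derive_eq with (a * ((Q^`().[- y])%R * -1)). 2: ring.
    apply is_derive_cmult. apply (is_derive_horner_comp Q (fun y => - y)).
    auto_derive; auto. }
  cut (forall y : R, ((quartic_poly (- l) k j).[y])%R = (-1) ^ j * ((quartic_poly l k j).[- y])%R).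
  { intros H y. split; auto. pose proof (D _ _ _ H) as H1. split; auto.
    rewrite (D _ _ _ H1 y). eqR. ring. }
  induction j as [|j IH]; intros y.
  - simpl. by rewrite !hornerE.
  - pose proof (D _ _ _ IH) as H1. pose proof (D _ _ _ H1) as H2.
    simpl quartic_poly. rewrite !quartic_step_horner IH H1 H2.
    change (GRing.opp y) with (- y). simpl. eqR. ring.
Qed.

Section Quartic.

Variables (g g1 : R -> R) (l k : R).
Hypothesis Hg : forall u, is_derive g u (g1 u).
Hypothesis Hg1 : forall u, is_derive g1 u (g u * (l - 2 * g u ^ 2)).
Hypothesis Hsq : forall u, g1 u ^ 2 = k + l * g u ^ 2 - g u ^ 4.

Lemma is_derive_horner_sq (P : {poly R}) (u : R) :
  is_derive (fun u => (P.[(g u ^ 2)%coqR])%R) u ((P^`().[(g u ^ 2)%coqR])%R * (2 * g u * g1 u)).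
Proof.
  apply (is_derive_horner_comp P (fun u => g u ^ 2)).
  assert (E : ex_derive g u) by (eexists; apply Hg).
  auto_derive; auto. rewrite (is_derive_unique (fun x : R => g x) _ _ (Hg u)). ring.
Qed.

Local Notation ev P u := ((P.[(g u ^ 2)%coqR])%R).

Lemma Derive_n_quartic (j : nat) : forall u,
  Derive_n g (2 * j) u = g u * ev (quartic_poly l k j) u
  /\ Derive_n g (2 * j + 1) u = g1 u * (ev (quartic_poly l k j) u
       + 2 * g u ^ 2 * ev ((quartic_poly l k j)^`()) u).
Proof.
  assert (Odd : forall j, (forall u, Derive_n g (2 * j) u = g u * ev (quartic_poly l k j) u) ->
    forall u, Derive_n g (2 * j + 1) u = g1 u * (ev (quartic_poly l k j) u
       + 2 * g u ^ 2 * ev ((quartic_poly l k j)^`()) u)).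
  { intros i H u. rewrite Nat.add_1_r. simpl Derive_n. rewrite (Derive_ext _ _ _ H).
    apply is_derive_unique.
    eapply is_derive_eq.
    - apply is_derive_prod.
      apply Hg. apply is_derive_horner_sq.
    - unfold plus, mult; simpl. ring. }
  cut (forall u, Derive_n g (2 * j) u = g u * ev (quartic_poly l k j) u).
  { intros H u. split; auto. }
  induction j as [|j IH]; intros u.
  - simpl. rewrite hornerC. eqR. change (g u = g u * 1). ring.
  - replace (2 * S j)%nat with (S (2 * j + 1)) by lia. simpl Derive_n.
    rewrite (Derive_ext _ _ _ (Odd j IH)). apply is_derive_unique.
    set (P := quartic_poly l k j).
    eapply is_derive_eq.
    + apply is_derive_prod.
      apply Hg1.
      apply (is_derive_add (fun u => (P.[(g u ^ 2)%coqR])%R)).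
      apply is_derive_horner_sq.
      apply is_derive_prod.
      2: apply is_derive_horner_sq.
      instantiate (1 := 4 * g u * g1 u).
      assert (E : ex_derive g u) by (eexists; apply Hg).
      auto_derive; auto. rewrite (is_derive_unique (fun x : R => g x) _ _ (Hg u)). ring.
    + simpl quartic_poly. fold P. rewrite quartic_step_horner. unfold plus, mult; simpl.
      assert (E := Hsq u). simpl in E.
      generalize ((P.[g u * (g u * 1)])%R) ((P^`().[g u * (g u * 1)])%R) ((P^`()^`().[g u * (g u * 1)])%R).
      intros p0 p1 p2.
      replace (k + l * (g u * (g u * 1)) - g u * (g u * 1) * (g u * (g u * 1))) with (g1 u * (g1 u * 1)) by (rewrite E; ring).
      eqR. ring.
Qed.

End Quartic.

(** The value of p at k^2 depends only on l = k^2 - k'^2 and on k^2 k'^2. Exchanging k and k'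
    reverses l and keeps the product, which is the source of the symmetry under x -> 1 - x. *)
Lemma pder_quartic (p : nat -> {poly int}) (h : R) (i : nat) : sd_maclaurin p -> 0 < h ->
  pder (p (2 * i + 1)%nat) 0 (kk h ^ 2)
  = ((quartic_poly (kk h ^ 2 - kk' h ^ 2) (kk h ^ 2 * kk' h ^ 2) i).[0%coqR])%R.
Proof.
  intros hp Hh. pose proof (cc_pos h Hh) as Pc. pose proof (zz_pos h Hh) as Pz.
  pose proof (nn_pos h Hh) as Pn. pose proof (nn_sq h Hh) as Sq.
  set (z := zz h) in *.
  (* This is k k' sd(u), the multiple of sd whose differential equation has leading term -g^4. *)
  set (g := fun u => / z * Sd h (/ z * u)).
  set (g1 := fun u => / z ^ 2 * (Cd h (/ z * u) * Nd h (/ z * u))).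
  assert (comp : forall (f : R -> R) u l, is_derive f (/ z * u) l ->
    is_derive (fun u => f (/ z * u)) u (/ z * l)).
  { intros f u l H. apply (is_derive_chain f (fun u => / z * u)); auto. auto_derive; auto. ring. }
  assert (dS := fun u => comp _ u _ (is_derive_Sd h Hh (/ z * u))).
  assert (dC := fun u => comp _ u _ (is_derive_Cd h Hh (/ z * u))).
  assert (dN := fun u => comp _ u _ (is_derive_Nd h Hh (/ z * u))).
  assert (Hg : forall u, is_derive g u (g1 u)).
  { intros u. unfold g, g1. eapply is_derive_eq. apply is_derive_cmult, dS. field. lra. }
  assert (G0 : g 0 = 0) by (unfold g; rewrite Rmult_0_r Sd_0; ring).
  assert (G1 : g1 0 = cc h * nn h / z ^ 2).
  { unfold g1. rewrite Rmult_0_r Cd_0; auto. rewrite Nd_0; auto. field. lra. }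
  assert (Q := Derive_n_quartic g g1 (kk h ^ 2 - kk' h ^ 2) (kk h ^ 2 * kk' h ^ 2) Hg).
  assert (Q' := fun A B => proj2 (Q A B i 0)). clear Q.
  rewrite G0 in Q'. rewrite G1 in Q'.
  assert (D : Derive_n g (2 * i + 1) 0
    = / z * (/ z) ^ (2 * i + 1) * ((-1) ^ i * altsum (2 * i + 1) sech h)).
  { apply (Derive_n_Sd h Hh i (/ z)). }
  rewrite (coeff_altsum h Hh p hp i) in D. fold z in D.
  assert (Z1 : z ^ (2 * i) <> 0) by (apply pow_nonzero; lra).
  assert (D' : Derive_n g (2 * i + 1) 0 = cc h * nn h / z ^ 2 * pder (p (2 * i + 1)%nat) 0 (kk h ^ 2)).
  { rewrite D pow_inv pow_add pow_1.
    transitivity ((-1) ^ i * (-1) ^ i * (cc h * nn h / z ^ 2 * pder (p (2 * i + 1)%nat) 0 (kk h ^ 2))).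
    field. lra. rewrite sign_sq. ring. }
  replace (0 ^ 2) with 0 in Q' by ring. rewrite Rmult_0_r Rmult_0_l Rplus_0_r in Q'.
  apply Rmult_eq_reg_l with (cc h * nn h / z ^ 2).
  - rewrite <- D'. apply Q'.
    + intros u. unfold g1. eapply is_derive_eq. apply is_derive_cmult, is_derive_prod. apply dC. apply dN.
      unfold g. generalize (Cd_sq h Hh (/ z * u)) (Nd_sq h Hh (/ z * u)).
      generalize (Sd h (/ z * u)) (Cd h (/ z * u)) (Nd h (/ z * u)). intros S C N EC EN.
      transitivity (/ z ^ 3 * S * (C ^ 2 - N ^ 2)). field. lra.
      rewrite EC EN. unfold kk, kk'. fold z. field. lra.
    + intros u. unfold g1, g. generalize (Cd_sq h Hh (/ z * u)) (Nd_sq h Hh (/ z * u)).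
      generalize (Sd h (/ z * u)) (Cd h (/ z * u)) (Nd h (/ z * u)). intros S C N EC EN.
      transitivity (/ z ^ 4 * (C ^ 2 * N ^ 2)). field. lra.
      rewrite EC EN. unfold kk, kk'. fold z. field. lra.
  - apply Rmult_integral_contrapositive_currified. nra. apply Rinv_neq_0_compat, pow_nonzero. lra.
Qed.

Lemma is_derive_kk_sq (h : R) : 0 < h ->
  is_derive (fun h => kk h ^ 2) h (- 2 * kk h ^ 2 * nn h ^ 2).
Proof.
  intros Hh. pose proof (zz_pos h Hh) as Pz. pose proof (nn_sq h Hh) as Sq.
  assert (Ez : ex_derive zz h) by (eexists; apply is_derive_zz, Hh).
  assert (Ec : ex_derive cc h) by (eexists; apply is_derive_cc, Hh).
  unfold kk. auto_derive. repeat split; auto; lra.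
  rewrite (is_derive_unique (fun x : R => zz x) _ _ (is_derive_zz h Hh))
    (is_derive_unique (fun x : R => cc x) _ _ (is_derive_cc h Hh)).
  rewrite Sq. field. lra.
Qed.

(** The symmetry is available only at the points x = kk h ^ 2. Derivatives are therefore taken along
    this curve in h, and the nonzero speed x' is divided out; each derivative of the left side costs
    a sign. *)
Lemma pder_reflect (p : nat -> {poly int}) (i : nat) : sd_maclaurin p -> forall j h, 0 < h ->
  (-1) ^ j * pder (p (2 * i + 1)%nat) j (1 - kk h ^ 2) = (-1) ^ i * pder (p (2 * i + 1)%nat) j (kk h ^ 2).
Proof.
  intros hp. induction j as [|j IH]; intros h Hh.
  - pose proof PI_RGT_0. destruct (kk_dual h Hh) as [E1 E2].
    assert (Hh' : 0 < PI ^ 2 / (4 * h)) by (apply Rdiv_lt_0_compat; [apply pow_lt|]; lra).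
    pose proof (pder_quartic p _ i hp Hh') as Q. rewrite E1 E2 in Q.
    pose proof (kk_sq h Hh) as E3. replace (1 - kk h ^ 2) with (kk' h ^ 2) by lra.
    rewrite Q (pder_quartic p h i hp Hh).
    replace (kk' h ^ 2 - kk h ^ 2) with (- (kk h ^ 2 - kk' h ^ 2)) by ring.
    replace (kk' h ^ 2 * kk h ^ 2) with (kk h ^ 2 * kk' h ^ 2) by ring.
    rewrite (proj1 (quartic_poly_reflect _ _ i 0)).
    assert (E0 : (- (0%coqR : R))%R = 0%coqR :> R) by exact Ropp_0. rewrite E0.
    simpl. eqR. ring.
  - set (q := p (2 * i + 1)%nat) in *.
    set (x' := - 2 * kk h ^ 2 * nn h ^ 2).
    assert (Dx := is_derive_kk_sq h Hh). fold x' in Dx.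
    assert (D1 : is_derive (fun h => (-1) ^ j * pder q j (1 - kk h ^ 2)) h
      ((-1) ^ j * (- x' * pder q (S j) (1 - kk h ^ 2)))).
    { apply is_derive_cmult.
      apply (is_derive_chain (fun x => pder q j x) (fun h => 1 - kk h ^ 2)). apply is_derive_pder.
      eapply is_derive_eq. apply (is_derive_minus (V := R_NormedModule) (fun _ => 1) (fun h => kk h ^ 2)).
      apply is_derive_cst. apply Dx.
      unfold minus, plus, opp, zero; simpl. ring. }
    assert (D2 : is_derive (fun h => (-1) ^ i * pder q j (kk h ^ 2)) h
      ((-1) ^ i * (x' * pder q (S j) (kk h ^ 2)))).
    { apply is_derive_cmult.
      apply (is_derive_chain (fun x => pder q j x) (fun h => kk h ^ 2)); auto. apply is_derive_pder. }
    assert (E : (-1) ^ j * (- x' * pder q (S j) (1 - kk h ^ 2)) = (-1) ^ i * (x' * pder q (S j) (kk h ^ 2))).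
    { rewrite <- (is_derive_unique _ _ _ D2). symmetry. apply is_derive_unique.
      apply is_derive_ext_loc with (2 := D1). exists (mkposreal _ Hh). intros y Hy.
      change (Rabs (y - h) < h) in Hy. apply Rabs_def2 in Hy. apply IH. lra. }
    assert (x' <> 0).
    { unfold x'. pose proof (kk_bounds h Hh). pose proof (nn_pos h Hh).
      assert (0 < kk h ^ 2 * nn h ^ 2) by (apply Rmult_lt_0_compat; apply pow_lt; lra). lra. }
    apply Rmult_eq_reg_l with x'; auto.
    transitivity ((-1) ^ j * (- x' * pder q (S j) (1 - kk h ^ 2))). simpl. ring.
    rewrite E. ring.
Qed.

(** At the fixed point x = 1/2 the symmetry says that the derivative equals (-1)^(i + j) times
    itself. *)
Lemma pder_half_zero (p : nat -> {poly int}) (i j : nat) : sd_maclaurin p ->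
  Nat.odd (i + j) = true -> pder (p (2 * i + 1)%nat) j (1 / 2) = 0.
Proof.
  intros hp Ho. pose proof PI_RGT_0.
  pose proof (pder_reflect p i hp j (PI / 2) ltac:(lra)) as E. rewrite kk_half_sq in E.
  replace (1 - 1 / 2) with (1 / 2) in E by field.
  assert (S2 : (-1) ^ i = - (-1) ^ j).
  { apply Nat.odd_spec in Ho. destruct Ho as [m Hm].
    assert (E2 : (-1) ^ i * (-1) ^ j = -1).
    { rewrite -pow_add Hm Nat.add_1_r -tech_pow_Rmult pow_1_even. ring. }
    replace ((-1) ^ i) with ((-1) ^ i * ((-1) ^ j * (-1) ^ j)) by (rewrite sign_sq; ring).
    rewrite -Rmult_assoc E2. ring. }
  rewrite S2 in E. assert (E3 : (-1) ^ j * pder (p (2 * i + 1)%nat) j (1 / 2) = 0) by lra.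
  replace (pder (p (2 * i + 1)%nat) j (1 / 2))
    with ((-1) ^ j * ((-1) ^ j * pder (p (2 * i + 1)%nat) j (1 / 2))) by (rewrite -Rmult_assoc sign_sq; ring).
  rewrite E3. ring.
Qed.

(** * Derivatives in h at the lemniscatic point *)

(* Polynomial expressions in [zeta = zz'/zz], [Z = zz^2], [d = 1 - 2 x] (with [x = kk^2]) and the
   derivatives of a polynomial in x; they are closed under d/dh. *)
Inductive qexp :=
  | QC (r : R) | QZeta | QZ | QD | QP (j : nat) | QAdd (a b : qexp) | QMul (a b : qexp).

(** The rules are zeta' = zeta^2 + x (1 - x) Z^2, Z' = 2 Z zeta, d' = 4 x (1 - x) Z and x' = -2 x (1
    - x) Z, with x (1 - x) = (1 - d^2) / 4. The variable d is preferred to x because it vanishes at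
    x = 1/2. *)
Fixpoint qderive (a : qexp) : qexp :=
  match a with
  | QC _ => QC 0
  | QZeta => QAdd (QMul QZeta QZeta) (QMul (QMul (QC (/ 4)) (QAdd (QC 1) (QMul (QC (-1)) (QMul QD QD)))) (QMul QZ QZ))
  | QZ => QMul (QC 2) (QMul QZ QZeta)
  | QD => QMul (QAdd (QC 1) (QMul (QC (-1)) (QMul QD QD))) QZ
  | QP j => QMul (QMul (QC (- / 2)) (QMul (QAdd (QC 1) (QMul (QC (-1)) (QMul QD QD))) QZ)) (QP (S j))
  | QAdd a b => QAdd (qderive a) (qderive b)
  | QMul a b => QAdd (QMul (qderive a) b) (QMul a (qderive b))
  end.

Fixpoint qeval (zeta Z d : R) (P : nat -> R) (a : qexp) : R :=
  match a with
  | QC r => r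
  | QZeta => zeta
  | QZ => Z
  | QD => d
  | QP j => P j
  | QAdd a b => qeval zeta Z d P a + qeval zeta Z d P b
  | QMul a b => qeval zeta Z d P a * qeval zeta Z d P b
  end.

(* d/dh on [cc * nn * zz^(2i) * a]; the prefactor has logarithmic derivative
   [(2i + 2) zeta - d Z]. *)
Definition qstep (i : nat) (a : qexp) : qexp :=
  QAdd (qderive a) (QMul (QAdd (QMul (QC (2 * INR i + 2)) QZeta) (QMul (QC (-1)) (QMul QD QZ))) a).

Fixpoint qiter (i k : nat) : qexp :=
  match k with O => QP O | S k => qstep i (qiter i k) end.

Definition qval (q : {poly int}) (h : R) (a : qexp) : R :=
  qeval (ee h - cc h ^ 2) (zz h ^ 2) (1 - 2 * kk h ^ 2) (fun j => pder q j (kk h ^ 2)) a.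

Lemma kk_sq_zz (h : R) : 0 < h -> kk h ^ 2 * zz h ^ 2 = cc h ^ 2.
Proof. intros Hh. rewrite (proj1 (kk_mult_zz h Hh)). ring. Qed.

Lemma is_derive_qval (q : {poly int}) (h : R) (a : qexp) : 0 < h ->
  is_derive (fun h => qval q h a) h (qval q h (qderive a)).
Proof.
  intros Hh. pose proof (kk_sq_zz h Hh) as Ek. pose proof (nn_sq h Hh) as En.
  assert (Dz := is_derive_zz h Hh). assert (Dc := is_derive_cc h Hh).
  assert (De := is_derive_ee h Hh). assert (Dk := is_derive_kk_sq h Hh).
  assert (Ez : ex_derive zz h) by (eexists; apply Dz).
  assert (Ec : ex_derive cc h) by (eexists; apply Dc).
  assert (Ee : ex_derive ee h) by (eexists; apply De).
  assert (Enk : nn h ^ 2 = (1 - kk h ^ 2) * zz h ^ 2) by (rewrite En -Ek; ring).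
  induction a as [r| | | |j|a IHa b IHb|a IHa b IHb]; unfold qval; cbn [qeval qderive].
  - apply is_derive_cst.
  - auto_derive; auto.
    rewrite (is_derive_unique (fun x : R => ee x) _ _ De) (is_derive_unique (fun x : R => cc x) _ _ Dc).
    replace (ee h ^ 2 - cc h ^ 2 * zz h ^ 2) with (ee h ^ 2 - kk h ^ 2 * zz h ^ 2 * zz h ^ 2) by (rewrite Ek; ring).
    transitivity (ee h ^ 2 - kk h ^ 2 * zz h ^ 2 * zz h ^ 2 - 2 * cc h ^ 2 * (ee h - zz h ^ 2)). ring.
    rewrite -Ek. field.
  - auto_derive; auto. rewrite (is_derive_unique (fun x : R => zz x) _ _ Dz). ring.
  - eapply is_derive_eq. apply (is_derive_minus (V := R_NormedModule) (fun _ => 1) (fun h => 2 * kk h ^ 2)).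
    apply is_derive_cst. apply is_derive_cmult. apply Dk.
    rewrite Enk. unfold minus, plus, opp, zero; simpl. ring.
  - eapply is_derive_eq. apply (is_derive_chain (fun x => pder q j x) (fun h => kk h ^ 2)).
    apply is_derive_pder. apply Dk. rewrite Enk. unscal. field.
  - apply (is_derive_add (fun h => qval q h a) (fun h => qval q h b)); auto.
  - apply is_derive_prod; auto.
Qed.

Definition qfun (q : {poly int}) (i : nat) (h : R) (a : qexp) : R :=
  cc h * nn h * zz h ^ (2 * i) * qval q h a.

Lemma is_derive_qfun (q : {poly int}) (i : nat) (h : R) (a : qexp) : 0 < h ->
  is_derive (fun h => qfun q i h a) h (qfun q i h (qstep i a)).
Proof.
  intros Hh. pose proof (kk_sq_zz h Hh) as Ek.
  assert (Dz := is_derive_zz h Hh). assert (Dc := is_derive_cc h Hh).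
  assert (Dn := is_derive_nn h Hh). assert (Dq := is_derive_qval q h a Hh).
  assert (Ez : ex_derive zz h) by (eexists; apply Dz).
  assert (Ec : ex_derive cc h) by (eexists; apply Dc).
  assert (En : ex_derive nn h) by (eexists; apply Dn).
  assert (Pz := zz_pos h Hh).
  assert (Dp : is_derive (fun h => zz h ^ (2 * i)) h (2 * INR i * (ee h - cc h ^ 2) * zz h ^ (2 * i))).
  { destruct i as [|i].
    - simpl. eapply is_derive_eq. apply is_derive_cst. unfold zero; simpl. ring.
    - eapply is_derive_eq. apply (is_derive_pow zz (2 * S i)). apply Dz.
      rewrite mult_INR. replace (pred (2 * S i)) with (2 * i + 1)%nat by lia.
      replace (2 * S i)%nat with (S (2 * i + 1)) by lia. simpl (INR 2). simpl pow. ring. }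
  apply is_derive_eq with ((((cc h * (ee h - zz h ^ 2)) * nn h + cc h * (nn h * ee h)) * zz h ^ (2 * i)
    + cc h * nn h * (2 * INR i * (ee h - cc h ^ 2) * zz h ^ (2 * i))) * qval q h a
    + cc h * nn h * zz h ^ (2 * i) * qval q h (qderive a)).
  - apply (is_derive_prod (fun h => cc h * nn h * zz h ^ (2 * i)) (fun h => qval q h a)); auto.
    apply (is_derive_prod (fun h => cc h * nn h)); auto. apply is_derive_prod; auto.
  - change (qfun q i h (qstep i a)) with (cc h * nn h * zz h ^ (2 * i) *
      (qval q h (qderive a) + ((2 * INR i + 2) * (ee h - cc h ^ 2) + -1 * ((1 - 2 * kk h ^ 2) * zz h ^ 2)) * qval q h a)).
    rewrite -Ek. ring.
Qed.

(* The k-th derivative of sech, for k <= 4. *)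
Definition useq (k : nat) (x : R) : R :=
  match k with
  | 0%nat => sech x
  | 1%nat => - (th x * sech x)
  | 2%nat => sech x - 2 * sech x ^ 3
  | 3%nat => th x * (6 * sech x ^ 3 - sech x)
  | _ => sech x - 20 * sech x ^ 3 + 24 * sech x ^ 5
  end.

Lemma th_sq (x : R) : th x ^ 2 = 1 - sech x ^ 2.
Proof.
  pose proof (cosh_pos x). pose proof (cosh_sq x) as E. unfold th, sech.
  replace ((sinh x / cosh x) ^ 2) with (sinh x * sinh x / (cosh x * cosh x)) by (field; lra).
  replace (sinh x * sinh x) with (cosh x * cosh x - 1) by lra. field. lra.
Qed.

Lemma is_derive_useq (k : nat) (x : R) : (k < 4)%nat -> is_derive (useq k) x (useq (S k) x).
Proof.
  intros Hk. pose proof (th_sq x) as E.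
  assert (Es := ex_derive_sech x). assert (Et := ex_derive_th x).
  assert (E1 : Derive (fun x : R => sech x) x = - (th x * sech x)) by apply is_derive_unique, is_derive_sech.
  assert (E2 : Derive (fun x : R => th x) x = sech x ^ 2).
  { transitivity (1 - th x ^ 2). apply is_derive_unique, is_derive_th. rewrite E. ring. }
  destruct k as [|[|[|[|k]]]]; try lia; cbv beta iota delta [useq].
  - apply is_derive_sech.
  - auto_derive; auto. rewrite E1 E2.
    transitivity (th x ^ 2 * sech x - sech x ^ 3). ring. rewrite E. ring.
  - auto_derive; auto. rewrite E1. ring.
  - auto_derive; auto. rewrite E1 E2.
    transitivity (sech x ^ 2 * (6 * sech x ^ 3 - sech x) - th x ^ 2 * (18 * sech x ^ 3 - sech x)). ring.
    rewrite E. ring.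
Qed.

Lemma tame_useq (k : nat) : tame (useq k).
Proof.
  assert (T : forall v : R -> R, (exists M, 0 <= M /\ forall x, Rabs (v x) <= M) -> tame (fun x => v x * sech x)).
  { intros v [M [HM Hv]]. apply tame_mult. apply tame_sech. intros d Hd. exists M. split; auto. }
  assert (Ext : forall u v, (forall x, u x = v x) -> tame u -> tame v).
  { intros u v Huv Hu d Hd. destruct (Hu d Hd) as [K [HK Hx]]. exists K. split; auto.
    intros x Hx'. rewrite -Huv. auto. }
  assert (B2 : forall x, 0 <= sech x ^ 2 <= 1 /\ 0 <= sech x ^ 4 <= 1).
  { intros x. pose proof (sech_pos x) as Ps. pose proof (sech_le1 x) as Pl.
    rewrite Rabs_pos_eq in Pl; [|lra].
    assert (P2 : 0 <= sech x ^ 2 <= 1) by (simpl; nra).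
    replace (sech x ^ 4) with (sech x ^ 2 * sech x ^ 2) by ring. split; auto. nra. }
  destruct k as [|[|[|[|k]]]].
  - apply tame_sech.
  - apply tame_opp, tame_th_sech.
  - apply (Ext (fun x => (1 - 2 * sech x ^ 2) * sech x)). intros x; simpl; ring.
    apply T. exists 3. split. lra. intros x. specialize (B2 x). apply Rabs_le. lra.
  - apply (Ext (fun x => (th x * (6 * sech x ^ 2 - 1)) * sech x)). intros x; simpl; ring.
    apply T. exists 7. split. lra. intros x. specialize (B2 x). rewrite Rabs_mult.
    replace 7 with (1 * 7) by ring. apply Rmult_le_compat; try apply Rabs_pos. apply th_bound.
    apply Rabs_le. lra.
  - apply (Ext (fun x => (1 - 20 * sech x ^ 2 + 24 * sech x ^ 4) * sech x)). intros x; simpl; ring.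
    apply T. exists 50. split. lra. intros x. specialize (B2 x). apply Rabs_le. lra.
Qed.

Lemma altsum_growth (s : nat) (e : R) : 0 < e -> gr e (fun x => x ^ s * sin (PI / 2 * x)).
Proof.
  intros He. replace e with (e + 0) by ring. apply (gr_mult e 0 (fun x => x ^ s)).
  apply gr_pow, He. apply gr_sin. lra.
Qed.

Lemma is_derive_altsum (s k : nat) (h : R) : 0 < h -> (k < 4)%nat ->
  is_derive (altsum s (useq k)) h (altsum (S s) (useq (S k)) h).
Proof.
  intros Hh Hk.
  replace (altsum (S s) (useq (S k)) h) with (LS (fun x => x * (x ^ s * sin (PI / 2 * x))) 1 (useq (S k)) h).
  - apply (LS_derive_h (fun x => x ^ s * sin (PI / 2 * x)) (useq k) (useq (S k))); auto using tame_useq.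
    intros; apply altsum_growth; auto.
    intros x _. apply is_derive_useq, Hk.
    intros x _. apply ex_derive_cont.
    assert (Es := ex_derive_sech). assert (Et := ex_derive_th).
    destruct k as [|[|[|[|k]]]]; try lia; cbv beta iota delta [useq]; auto_derive; auto.
  - apply LS_ext. intros j. simpl. ring.
Qed.

(** Both sides of [coeff_altsum] are differentiated k times in h. Each derivative brings down one
    frequency, so the exponent grows with k while the index of p stays. *)
Lemma altsum_qfun (p : nat -> {poly int}) (i k : nat) : sd_maclaurin p -> (k <= 4)%nat ->
  forall h, 0 < h ->
  altsum (2 * i + 1 + k) (useq k) h = (-1) ^ i * qfun (p (2 * i + 1)%nat) i h (qiter i k).
Proof.
  intros hp. induction k as [|k IH]; intros Hk h Hh.
  - rewrite Nat.add_0_r. rewrite (coeff_altsum h Hh p hp i). unfold qfun, qval. simpl. ring.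
  - replace (2 * i + 1 + S k)%nat with (S (2 * i + 1 + k)) by lia.
    rewrite <- (is_derive_unique _ _ _ (is_derive_altsum (2 * i + 1 + k) k h Hh ltac:(lia))).
    apply is_derive_unique.
    apply is_derive_ext_loc with (fun h => (-1) ^ i * qfun (p (2 * i + 1)%nat) i h (qiter i k)).
    + exists (mkposreal _ Hh). intros y Hy. change (Rabs (y - h) < h) in Hy. apply Rabs_def2 in Hy.
      symmetry. apply IH. lia. lra.
    + apply is_derive_cmult. apply is_derive_qfun, Hh.
Qed.

(** Since sin (pi/2 x) is odd, the parity hypothesis makes opposite frequencies contribute equally;
    hence the half. *)
Lemma altsum_series (s : nat) (u : R -> R) (h : R) : 0 < h -> tame u ->
  (forall x, (- x) ^ s * u (- x * h) = - (x ^ s * u (x * h))) ->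
  is_series (fun n => (-1) ^ n * INR (2 * n + 1) ^ s * u (INR (2 * n + 1) * h)) (altsum s u h / 2).
Proof.
  intros Hh Hu Hpar.
  set (f := fun j => fr 1 j ^ s * sin (PI / 2 * fr 1 j) * u (fr 1 j * h)).
  assert (Hd : dec h f).
  { replace h with (2 * h - 2 * (h / 2)) at 1 by field.
    apply (LS_dec (h / 2) (fun x => x ^ s * sin (PI / 2 * x))). lra. apply altsum_growth; lra.
    apply tame_dec; auto. }
  assert (Ef : forall n, f (Z.of_nat n) = (-1) ^ n * INR (2 * n + 1) ^ s * u (INR (2 * n + 1) * h)).
  { intros n. unfold f.
    assert (E1 : fr 1 (Z.of_nat n) = INR (2 * n + 1)).
    { unfold fr. rewrite INR_IZR_INZ. f_equal. lia. }
    rewrite E1.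
    assert (E2 : sin (PI / 2 * INR (2 * n + 1)) = (-1) ^ n).
    { rewrite plus_INR mult_INR. simpl (INR 2). simpl (INR 1).
      replace (PI / 2 * ((1 + 1) * INR n + 1)) with (PI / 2 + INR n * PI) by field.
      rewrite -cos_sin. clear E1. induction n as [|n IH]. rewrite Rmult_0_l. apply cos_0.
      rewrite S_INR. replace ((INR n + 1) * PI) with (INR n * PI + PI) by ring. rewrite neg_cos IH. simpl. ring. }
    rewrite E2. ring. }
  assert (Fr : forall j, f (-1 - j)%Z = f j).
  { intros j. unfold f.
    assert (E1 : fr 1 (-1 - j) = - fr 1 j) by apply (fr_refl 1 j). rewrite E1.
    replace (PI / 2 * - fr 1 j) with (- (PI / 2 * fr 1 j)) by ring. rewrite sin_neg.
    transitivity (- ((- fr 1 j) ^ s * u (- fr 1 j * h)) * sin (PI / 2 * fr 1 j)). ring.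
    rewrite Hpar. ring. }
  assert (Ex : ex_series (fun n => f (Z.of_nat n))) by (apply (dec_ex_posR h f); auto).
  apply is_series_ext with (fun n => f (Z.of_nat n)). exact Ef.
  replace (altsum s u h / 2) with (Series (fun n => f (Z.of_nat n))).
  apply Series_correct, Ex.
  change (altsum s u h) with (ZS f). rewrite (ZS_split h f Hh Hd).
  rewrite (Series_ext (fun n => f (-1 - Z.of_nat n)%Z) (fun n => f (Z.of_nat n))).
  2: intros; apply Fr. field.
Qed.

Section AtHalf.

Variables (p : nat -> {poly int}).
Hypothesis hp : sd_maclaurin p.

Definition tval (s : nat) (u : R -> R) : R := altsum s u (PI / 2) / 2.

Definition Zhalf : R := Gamma (1 / 4) ^ 4 / (4 * PI ^ 3).

(** At h = pi/2 one has ee - cc^2 = -1/pi, d = 0 and cc nn zz^(2i) = Zhalf^(i+1) / 2; the half in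
    [tval] turns this into a quarter. *)
Lemma tval_eval (i k : nat) : (k <= 4)%nat ->
  tval (2 * i + 1 + k) (useq k)
  = (-1) ^ i * (Zhalf ^ S i / 4
      * qeval (- / PI) Zhalf 0 (fun j => pder (p (2 * i + 1)%nat) j (1 / 2)) (qiter i k)).
Proof.
  intros Hk. pose proof PI_RGT_0 as P. unfold tval.
  rewrite (altsum_qfun p i k hp Hk (PI / 2)); [|lra].
  unfold qfun, qval. rewrite kk_half_sq nn_half ee_half.
  rewrite cc_half. rewrite pow_mult zz_half_Gamma. fold Zhalf.
  replace (Zhalf / 2 - / PI - Zhalf / 2) with (- / PI) by ring.
  replace (1 - 2 * (1 / 2)) with 0 by field.
  generalize (qeval (- / PI) Zhalf 0 (fun j => pder (p (2 * i + 1)%nat) j (1 / 2)) (qiter i k)). intros v.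
  transitivity ((-1) ^ i * (cc (PI / 2) ^ 2 * Zhalf ^ i * v) / 2). field.
  rewrite cc_half zz_half_Gamma. fold Zhalf. simpl. field.
Qed.

End AtHalf.

Lemma useq_neg (k : nat) (x : R) : (k <= 4)%nat -> useq k (- x) = (-1) ^ k * useq k x.
Proof.
  intros Hk. destruct k as [|[|[|[|[|k]]]]]; try lia; unfold useq; rewrite ?sech_neg ?th_neg; ring.
Qed.

Lemma pow_neg (x : R) (s : nat) : (- x) ^ s = (-1) ^ s * x ^ s.
Proof. rewrite -Rpow_mult_distr. f_equal. ring. Qed.

Lemma is_series_tval (s k : nat) : (k <= 4)%nat -> Nat.odd (s + k) = true ->
  is_series (fun n => (-1) ^ n * INR (2 * n + 1) ^ s * useq k (INR (2 * n + 1) * PI / 2)) (tval s (useq k)).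
Proof.
  intros Hk Hodd. pose proof PI_RGT_0.
  apply is_series_ext with (fun n => (-1) ^ n * INR (2 * n + 1) ^ s * useq k (INR (2 * n + 1) * (PI / 2))).
  - intros n. f_equal. f_equal. field.
  - apply altsum_series. lra. apply tame_useq.
    intros x. replace (- x * (PI / 2)) with (- (x * (PI / 2))) by ring.
    rewrite useq_neg; auto. rewrite pow_neg.
    assert (E : (-1) ^ s * (-1) ^ k = -1).
    { apply Nat.odd_spec in Hodd. destruct Hodd as [j Hj]. rewrite -pow_add Hj Nat.add_1_r.
      rewrite -tech_pow_Rmult pow_1_even. ring. }
    transitivity ((-1) ^ s * (-1) ^ k * (x ^ s * useq k (x * (PI / 2)))). ring. rewrite E. ring.
Qed.

Lemma is_series_comb (f g : nat -> R) (a b A B : R) : is_series f A -> is_series g B ->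
  is_series (fun n => a * f n + b * g n) (a * A + b * B).
Proof.
  intros Hf Hg.
  exact (is_series_plus (K := R_AbsRing) (V := R_NormedModule) _ _ _ _
    (is_series_scal (K := R_AbsRing) (V := R_NormedModule) a _ _ Hf)
    (is_series_scal (K := R_AbsRing) (V := R_NormedModule) b _ _ Hg)).
Qed.

(** * Evaluation of the four series *)

Ltac qcompute := cbn [qiter qstep qderive qeval].

(** By [pder_half_zero] the odd derivatives at 1/2 vanish for even i and the even ones for odd i;
    the hypotheses on [P] here and in the four lemmas below reflect these two cases. *)
Lemma qiter2_eval (i : nat) (w Z : R) (P : nat -> R) : P 1%nat = 0 ->
  qeval w Z 0 P (qiter i 2)
  = (2 * INR i + 2) * (2 * INR i + 3) * w ^ 2 * P O
    + Z ^ 2 * ((INR i / 2 - / 2) * P O + / 4 * P 2%nat).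
Proof. intros H1. qcompute. rewrite H1. field. Qed.

Lemma qiter3_eval (i : nat) (w Z : R) (P : nat -> R) : P 1%nat = 0 -> P 3%nat = 0 ->
  qeval w Z 0 P (qiter i 3)
  = (2 * INR i + 2) * (2 * INR i + 3) * (2 * INR i + 4) * w ^ 3 * P O
    + 3 * (2 * INR i + 4) * w * Z ^ 2 * ((INR i / 2 - / 2) * P O + / 4 * P 2%nat).
Proof. intros H1 H3. qcompute. rewrite H1 H3. field. Qed.

Lemma qiter4_eval (i : nat) (w Z : R) (P : nat -> R) : P 1%nat = 0 -> P 3%nat = 0 ->
  qeval w Z 0 P (qiter i 4)
  = (2 * INR i + 2) * (2 * INR i + 3) * (2 * INR i + 4) * (2 * INR i + 5) * w ^ 4 * P O
    + 6 * (2 * INR i + 4) * (2 * INR i + 5) * w ^ 2 * Z ^ 2 * ((INR i / 2 - / 2) * P O + / 4 * P 2%nat)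
    + Z ^ 4 / 16 * (P 4%nat + 12 * (INR i - 3) * P 2%nat + (12 * INR i ^ 2 - 28 * INR i + 8) * P O).
Proof. intros H1 H3. qcompute. rewrite H1 H3. field. Qed.

Lemma qiter1_eval_odd (i : nat) (w Z : R) (P : nat -> R) : P O = 0 ->
  qeval w Z 0 P (qiter i 1) = - / 2 * Z * P 1%nat.
Proof. intros H0. qcompute. rewrite H0. field. Qed.

Lemma qiter2_eval_odd (i : nat) (w Z : R) (P : nat -> R) : P O = 0 -> P 2%nat = 0 ->
  qeval w Z 0 P (qiter i 2) = - (2 * INR i + 3) * w * Z * P 1%nat.
Proof. intros H0 H2. qcompute. rewrite H0 H2. field. Qed.

Lemma Zhalf_pow (k : nat) :
  Zhalf ^ (2 * k) = Gamma (1 / 4) ^ (8 * k) / (2 ^ (4 * k) * PI ^ (6 * k)).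
Proof.
  pose proof PI_RGT_0. unfold Zhalf. generalize (Gamma (1 / 4)). intros G.
  rewrite (pow_mult (G ^ 4 / _)) (pow_mult G) (pow_mult 2) (pow_mult PI).
  rewrite -Rpow_mult_distr /Rdiv -pow_inv -Rpow_mult_distr. f_equal. field. lra.
Qed.

Theorem theorem3p7 (p : nat -> {poly int}) (hp : sd_maclaurin p)
    (m : nat) (hm : (0 < m)%nat) :
  let G := Gamma (1 / 4) in
  let M := INR m in
  let P := fun n j : nat => pder (p n) j (1 / 2) in
  let y := fun n : nat => INR (2 * n + 1) * PI / 2 in
  is_series
    (fun n : nat => (-1) ^ n * INR (2 * n + 1) ^ (4 * m + 1) / cosh (y n) ^ 3)
    (G ^ (8 * m + 4) / (2 ^ (4 * m + 5) * PI ^ (6 * m + 4))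
     * (PI * P (4 * m + 1)%nat 0%nat
        + (4 * M + 1) * P (4 * m - 1)%nat 1%nat))
  /\
  is_series
    (fun n : nat => (-1) ^ n * INR (2 * n + 1) ^ (4 * m - 1) / cosh (y n) ^ 3)
    (- (G ^ (8 * m - 4) / (2 ^ (4 * m + 7) * PI ^ (6 * m + 3)))
     * (128 * (8 * M ^ 2 - 6 * M + 1) * PI ^ 4 * P (4 * m - 3)%nat 0%nat
        + G ^ 8 * ((4 * M - 6) * P (4 * m - 3)%nat 0%nat
                   + P (4 * m - 3)%nat 2%nat)))
  /\
  is_series
    (fun n : nat =>
       (-1) ^ n * INR (2 * n + 1) ^ (4 * m) * sinh (y n) / cosh (y n) ^ 4)
    (G ^ (8 * m - 4) / (3 * 2 ^ (4 * m + 6) * PI ^ (6 * m))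
     * (- 256 * M * (8 * M ^ 2 - 6 * M + 1) * P (4 * m - 3)%nat 0%nat
        - G ^ 8 / PI ^ 4
          * (PI * P (4 * m - 1)%nat 1%nat
             + 6 * M * ((4 * M - 6) * P (4 * m - 3)%nat 0%nat
                        + P (4 * m - 3)%nat 2%nat))))
  /\
  is_series
    (fun n : nat => (-1) ^ n * INR (2 * n + 1) ^ (4 * m + 1) / cosh (y n) ^ 5)
    (G ^ (8 * m - 4) / (3 * 2 ^ (4 * m + 15) * PI ^ (6 * m + 9))
     * (32768 * M * (2 * M - 1) * (4 * M - 1) * (4 * M + 1) * PI ^ 8
          * P (4 * m - 3)%nat 0%nat
        + 256 * PI ^ 4 * G ^ 8
          * (9 * PI ^ 2 * P (4 * m + 1)%nat 0%nat
             + 10 * (4 * M + 1) * PI * P (4 * m - 1)%nat 1%nat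
             + 6 * M * (4 * M + 1)
               * ((4 * M - 6) * P (4 * m - 3)%nat 0%nat
                  + P (4 * m - 3)%nat 2%nat))
        + G ^ 16
          * (8 * (M - 2) * (6 * M - 7) * P (4 * m - 3)%nat 0%nat
             + 12 * (2 * M - 5) * P (4 * m - 3)%nat 2%nat
             + P (4 * m - 3)%nat 4%nat))).
Proof.
  intros G M P y.
  destruct m as [|k]; [lia|]. clear hm.
  pose proof PI_RGT_0 as Ppi. pose proof Gamma_quarter_pos as PG. fold G in PG.
  assert (EM : M = INR k + 1) by (unfold M; apply S_INR).
  assert (Epow : forall N, (-1) ^ (2 * N) = 1) by apply pow_1_even.
  assert (I3 : INR (2 * k) = 2 * INR k) by (rewrite mult_INR; simpl; ring).
  assert (I2 : INR (2 * k + 1) = 2 * INR k + 1) by (rewrite plus_INR I3; simpl; ring).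
  set (Q := Zhalf ^ (2 * k)).
  assert (EQ : Q = G ^ (8 * k) / (2 ^ (4 * k) * PI ^ (6 * k))) by apply Zhalf_pow.
  (* With m = k + 1 these are the values of p_(4m-3), p_(4m-1), p_(4m+1) and of their derivatives,
     i.e. i = 2k, 2k+1, 2k+2. *)
  set (a := P (4 * k + 1)%nat). set (b := P (4 * k + 3)%nat). set (d := P (4 * k + 5)%nat).
  assert (Ha : forall j, (j <= 4)%nat -> tval (4 * k + 1 + j) (useq j)
    = Q * Zhalf / 4 * qeval (- / PI) Zhalf 0 a (qiter (2 * k) j)).
  { intros j Hj. pose proof (tval_eval p hp (2 * k) j Hj) as E.
    replace (2 * (2 * k) + 1)%nat with (4 * k + 1)%nat in E by lia. rewrite E Epow.
    change (Zhalf ^ S (2 * k)) with (Zhalf * Q). unfold a, P. field. }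
  assert (Hb : forall j, (j <= 4)%nat -> tval (4 * k + 3 + j) (useq j)
    = - (Q * Zhalf ^ 2 / 4 * qeval (- / PI) Zhalf 0 b (qiter (2 * k + 1) j))).
  { intros j Hj. pose proof (tval_eval p hp (2 * k + 1) j Hj) as E.
    replace (2 * (2 * k + 1) + 1)%nat with (4 * k + 3)%nat in E by lia. rewrite E.
    rewrite pow_add Epow. replace (S (2 * k + 1)) with (S (S (2 * k))) by lia.
    change (Zhalf ^ S (S (2 * k))) with (Zhalf * (Zhalf * Q)). unfold b, P. field. }
  assert (Hd : tval (4 * k + 5) (useq 0) = Q * Zhalf ^ 3 / 4 * d O).
  { pose proof (tval_eval p hp (2 * k + 2) 0 ltac:(lia)) as E.
    replace (2 * (2 * k + 2) + 1 + 0)%nat with (4 * k + 5)%nat in E by lia. rewrite E.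
    replace (2 * k + 2)%nat with (2 * (k + 1))%nat at 1 by lia. rewrite Epow.
    replace (S (2 * k + 2)) with (S (S (S (2 * k)))) by lia.
    change (Zhalf ^ S (S (S (2 * k)))) with (Zhalf * (Zhalf * (Zhalf * Q))).
    replace (2 * (2 * k + 2) + 1)%nat with (4 * k + 5)%nat by lia. unfold d, P. simpl. field. }
  assert (Za : forall j, Nat.odd j = true -> a j = 0).
  { intros j Hj. unfold a, P. replace (4 * k + 1)%nat with (2 * (2 * k) + 1)%nat by lia.
    apply pder_half_zero; auto. rewrite (Nat.odd_add (2 * k) j) (Nat.odd_mul 2 k) Hj. reflexivity. }
  assert (Zb : forall j, Nat.odd j = false -> b j = 0).
  { intros j Hj. unfold b, P. replace (4 * k + 3)%nat with (2 * (2 * k + 1) + 1)%nat by lia.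
    apply pder_half_zero; auto. rewrite (Nat.odd_add (2 * k + 1) j) (Nat.odd_add (2 * k) 1) (Nat.odd_mul 2 k) Hj. reflexivity. }
  pose proof (Za 1%nat eq_refl) as Za1. pose proof (Za 3%nat eq_refl) as Za3.
  pose proof (Zb 0%nat eq_refl) as Zb0. pose proof (Zb 2%nat eq_refl) as Zb2.
  assert (Ta2 := Ha 2%nat ltac:(lia)). rewrite (qiter2_eval _ _ _ _ Za1) I3 in Ta2.
  assert (Ta3 := Ha 3%nat ltac:(lia)). rewrite (qiter3_eval _ _ _ _ Za1 Za3) I3 in Ta3.
  assert (Ta4 := Ha 4%nat ltac:(lia)). rewrite (qiter4_eval _ _ _ _ Za1 Za3) I3 in Ta4.
  assert (Tb0 := Hb 0%nat ltac:(lia)). change (qeval (- / PI) Zhalf 0 b (qiter (2 * k + 1) 0)) with (b O) in Tb0.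
  rewrite Zb0 in Tb0.
  assert (Tb1 := Hb 1%nat ltac:(lia)). rewrite (qiter1_eval_odd _ _ _ _ Zb0) in Tb1.
  assert (Tb2 := Hb 2%nat ltac:(lia)). rewrite (qiter2_eval_odd _ _ _ _ Zb0 Zb2) I2 in Tb2.
  replace (4 * S k + 1)%nat with (4 * k + 5)%nat by lia.
  replace (4 * S k - 1)%nat with (4 * k + 3)%nat by lia.
  replace (4 * S k - 3)%nat with (4 * k + 1)%nat by lia.
  replace (4 * S k)%nat with (4 * k + 4)%nat by lia.
  replace (8 * S k + 4)%nat with (8 * k + 12)%nat by lia.
  replace (8 * S k - 4)%nat with (8 * k + 4)%nat by lia.
  replace (6 * S k)%nat with (6 * k + 6)%nat by lia.
  fold a b d. rewrite EM.
  assert (EZ : Zhalf = G ^ 4 / (4 * PI ^ 3)) by reflexivity.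
  assert (NG : G ^ (8 * k) <> 0) by (apply pow_nonzero; lra).
  assert (N2 : 2 ^ (4 * k) <> 0) by (apply pow_nonzero; lra).
  assert (NP : PI ^ (6 * k) <> 0) by (apply pow_nonzero; lra).
  replace (4 * k + 1 + 2)%nat with (4 * k + 3)%nat in Ta2 by lia.
  replace (4 * k + 1 + 3)%nat with (4 * k + 4)%nat in Ta3 by lia.
  replace (4 * k + 1 + 4)%nat with (4 * k + 5)%nat in Ta4 by lia.
  replace (4 * k + 3 + 0)%nat with (4 * k + 3)%nat in Tb0 by lia.
  replace (4 * k + 3 + 1)%nat with (4 * k + 4)%nat in Tb1 by lia.
  replace (4 * k + 3 + 2)%nat with (4 * k + 5)%nat in Tb2 by lia.
  assert (Odd : forall r, Nat.odd (4 * k + r) = Nat.odd r).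
  { intros r. rewrite (Nat.odd_add (4 * k) r) (Nat.odd_mul 4 k). simpl. destruct (Nat.odd r); reflexivity. }
  assert (Ser : forall r j, (j <= 4)%nat -> Nat.odd (r + j) = true ->
    is_series (fun n => (-1) ^ n * INR (2 * n + 1) ^ (4 * k + r) * useq j (y n)) (tval (4 * k + r) (useq j))).
  { intros r j Hj Ho. apply is_series_tval; auto. rewrite -Nat.add_assoc Odd. exact Ho. }
  assert (Pc : forall n, cosh (y n) <> 0) by (intros n; pose proof (cosh_pos (y n)); lra).
  (* Making the multiples of k opaque and splitting the powers leaves [field] with numeral exponents
     and the fixed factors G^(8k), 2^(4k), PI^(6k). *)
  set (e8 := (8 * k)%nat) in *. set (e4 := (4 * k)%nat) in *. set (e6 := (6 * k)%nat) in *.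
  clearbody e8 e4 e6. rewrite !(pow_add G) !(pow_add 2) !(pow_add PI).
  generalize dependent (G ^ e8). intros g EQ NG.
  set (T := fun r j n => (-1) ^ n * INR (2 * n + 1) ^ (e4 + r) * useq j (y n)).
  split; [|split; [|split]].
  (* sech^3 = (sech - sech'') / 2. *)
  - apply is_series_ext with (fun n => / 2 * T 5%nat 0%nat n
      + - / 2 * T 5%nat 2%nat n).
    { intros n. eqR. unfold T, useq, sech. field. apply Pc. }
    match goal with |- is_series _ ?v => replace v with
      (/ 2 * tval (e4 + 5) (useq 0) + - / 2 * tval (e4 + 5) (useq 2)) end.
    apply is_series_comb; apply Ser; auto; lia.
    rewrite Hd Tb2 EQ EZ. field. repeat split; auto; lra.
  - apply is_series_ext with (fun n => / 2 * T 3%nat 0%nat n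
      + - / 2 * T 3%nat 2%nat n).
    { intros n. eqR. unfold T, useq, sech. field. apply Pc. }
    match goal with |- is_series _ ?v => replace v with
      (/ 2 * tval (e4 + 3) (useq 0) + - / 2 * tval (e4 + 3) (useq 2)) end.
    apply is_series_comb; apply Ser; auto; lia.
    rewrite Tb0 Ta2 EQ EZ. field. repeat split; auto; lra.
  (* th sech^3 = (sech''' - sech') / 6. *)
  - apply is_series_ext with (fun n => / 6 * T 4%nat 3%nat n
      + - / 6 * T 4%nat 1%nat n).
    { intros n. eqR. unfold T, useq, sech, th. field. apply Pc. }
    match goal with |- is_series _ ?v => replace v with
      (/ 6 * tval (e4 + 4) (useq 3) + - / 6 * tval (e4 + 4) (useq 1)) end.
    apply is_series_comb; apply Ser; auto; lia.
    rewrite Tb1 Ta3 EQ EZ. field. repeat split; auto; lra.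
  (* 24 sech^5 is the fourth derivative of sech plus 9 sech - 10 sech''. The factor 1 gives the sum
     the shape of [is_series_comb]. *)
  - apply is_series_ext with (fun n => / 24 * T 5%nat 4%nat n
      + 1 * (9 / 24 * T 5%nat 0%nat n
      + - 10 / 24 * T 5%nat 2%nat n)).
    { intros n. eqR. unfold T, useq, sech. field. apply Pc. }
    match goal with |- is_series _ ?v => replace v with
      (/ 24 * tval (e4 + 5) (useq 4) + 1 * (9 / 24 * tval (e4 + 5) (useq 0) + - 10 / 24 * tval (e4 + 5) (useq 2))) end.
    apply is_series_comb; [|apply is_series_comb]; apply Ser; auto; lia.
    rewrite Hd Tb2 Ta4 EQ EZ. field. repeat split; auto; lra.
Qed.
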